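(* Let $\mathcal S$ be an admissible set of positive real Schur roots. Then each $\mathcal S$-compartment $\mathcal U_\epsilon$ can be labelled with an element $g(\epsilon)\in G(\mathcal S)$ of the picture group so that, whenever $\mathcal U_\epsilon$ and $\mathcal U_{\epsilon'}$ are separated by a wall $D(\beta)$, $\beta\in\mathcal S$, with $\mathcal U_{\epsilon'}$ on the positive side of $D(\beta)$, one has $$g(\epsilon)\,x(\beta)=g(\epsilon').$$
   Context: Setting: $K$ is a field; $Q$ is a valued quiver with vertices $1,\dots,n$ without loops, oriented cycles or multiple edges (positive integers $f_i$ at vertices, pairs $(d_{ij},d_{ji})$ on arrows $i\to j$ with $f_id_{ij}=f_jd_{ji}$) with a fixed $K$-modulation: division algebras $F_i$, $\dim_K F_i=f_i$, and $F_i$-$F_j$-bimodules $M_{ij}$, $\dim_K M_{ij}=f_id_{ij}$. Representations are right $F_i$-vector spaces $V_i$ with $F_j$-linear maps $V_i\otimes M_{ij}\to V_j$; $\Lambda$ is the corresponding hereditary algebra; dimension vectors have coordinates $\dim_{F_i}V_i$. Exceptional modules have division endomorphism algebra and no self-extensions; positive real Schur roots are their dimension vectors; $M_\beta$ is the unique exceptional module of dimension vector $\beta$. $hom(\alpha,\beta)=\dim_K\mathrm{Hom}_\Lambda(M_\alpha,M_\beta)$, $ext(\alpha,\beta)=\dim_K\mathrm{Ext}_\Lambda(M_\alpha,M_\beta)$; distinct roots are hom-orthogonal if $hom$ vanishes in both directions. A subroot $\beta'\subset\beta$ (quotient root $\beta\twoheadrightarrow\beta'$) is a real Schur root $\beta'$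 with $M_{\beta'}$ isomorphic to a submodule (quotient) of $M_\beta$. Admissible: a finite set $\mathcal S$ of positive real Schur roots which has a lateral ordering (total order with $hom(\alpha,\beta)\ne0\Rightarrow\alpha\le\beta$ and $ext(\alpha,\beta)\ne0\Rightarrow\alpha>\beta$) and a vertical ordering $(\beta_1,\dots,\beta_m)$ (all subroots and quotient roots of $\beta_k$ are of the form $\beta_j$ with $j\le k$); it is listed in its vertical ordering. Walls and compartments: $\langle x,y\rangle=\sum_i x_iy_if_i$, $H(\beta)=\{x\in\mathbb R^n:\langle x,\beta\rangle=0\}$, $D(\beta)=\{x\in\mathbb R^n:\langle x,\beta\rangle=0,\ \langle x,\beta'\rangle\le0\ \forall\beta'\subset\beta\}$; the positive side of $D(\beta)$ is where $\langle x,\beta\rangle>0$. For $\epsilon\in\{0,+,-\}^m$, $\mathcal U_\epsilon=\{x:\langle x,\beta_i\rangle>0\text{ if }\epsilon_i=+,\ \langle x,\beta_j\rangle<0\text{ if }\epsilon_j=-\}$; $\epsilon$ is admissible if for all $k$: $\epsilon_k=0\iff D(\beta_k)\cap\mathcal U_{\epsilon_1,\dots,\epsilon_{k-1}}=\emptyset$ (the empty sequence giving $\mathbb R^n$). The $\mathcal S$-compartments are the $\mathcal U_\epsilon$ with $\epsilon$ admissible. Two compartments are separated by the wall $D(\beta)$ if they lie on opposite sides of it and the intersection of their closures contains a nonempty relatively open subset of $H(\beta)$ contained in $D(\beta)$. Picture group: $G(\mathcal S)$ has one generator $x(\beta)$ for each $\beta\in\mathcal S$ and, for each hom-orthogonal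 pair $\beta_i,\beta_j\in\mathcal S$ with $ext(\beta_i,\beta_j)=0$, the relation $x(\beta_i)x(\beta_j)=\prod x(\gamma_k)$, where $\gamma_k$ runs over all roots in $\mathcal S$ of the form $a_k\beta_i+b_k\beta_j$, $a_k,b_k\in\mathbb Z_{\ge0}$, in increasing order of $a_k/b_k$ (from $\beta_j$ at $0/1$ to $\beta_i$ at $1/0$). *)

(* Defs.v *)
From HB Require Import structures.
From mathcomp Require Import all_boot all_order all_algebra.
From mathcomp Require Import generic_quotient falgebra.
From mathcomp Require Import all_classical all_reals all_analysis.
Set Implicit Arguments.
Unset Strict Implicit.
Unset Printing Implicit Defensive.
Import Order.TTheory GRing.Theory Num.Theory.
Import numFieldNormedType.Exports.
Local Open Scope classical_set_scope.
Local Open Scope ring_scope.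

(* Since the arrows form a relation there is at most one arrow i -> j, and
   since there is no oriented cycle there are no loops and no pairs of opposite
   arrows. *)
Record valued_quiver (n : nat) := ValuedQuiver {
  arrow : rel 'I_n;
  qval : 'I_n -> nat;
  qdeg : 'I_n -> 'I_n -> nat;
  qval_gt0 : forall i, (0 < qval i)%N;
  qdeg_gt0 : forall i j, arrow i j -> (0 < qdeg i j)%N && (0 < qdeg j i)%N;
  qval_sym : forall i j, arrow i j ->
    (qval i * qdeg i j = qval j * qdeg j i)%N;
  acyclic : forall c : seq 'I_n, cycle arrow c -> c = [::] }.

Record bimodule (K : fieldType) (A B : falgType K) := Bimodule {
  bimod_sort :> vectType K;
  lact : A -> bimod_sort -> bimod_sort;
  bract : bimod_sort -> B -> bimod_sort;
  lact_linear : forall a, linear (lact a);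
  lact_linearl : forall x, linear (lact ^~ x);
  lact1 : forall x, lact 1 x = x;
  lactM : forall a b x, lact (a * b) x = lact a (lact b x);
  bract_linear : forall b, linear (bract ^~ b);
  bract_linearr : forall x, linear (bract x);
  bract1 : forall x, bract x 1 = x;
  bractM : forall x a b, bract x (a * b) = bract (bract x a) b;
  lact_bract : forall a x b, lact a (bract x b) = bract (lact a x) b }.

(* The bimodules mod_bim i j for which there is no arrow i -> j are junk: they
   are never used. *)
Record modulation (K : fieldType) (n : nat) (Q : valued_quiver n) :=
  Modulation {
  mod_alg : 'I_n -> falgType K;
  mod_algV : forall i (x : mod_alg i), x != 0 -> x \is a GRing.unit;
  mod_alg_dim : forall i, \dim {:mod_alg i} = qval Q i;
  mod_bim : forall i j, bimodule (mod_alg i) (mod_alg j);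
  mod_bim_dim : forall i j, arrow Q i j ->
    \dim {:mod_bim i j} = (qval Q i * qdeg Q i j)%N }.

(* A right A-vector space is a vector space over the converse ring A^c. *)
Definition ract (K : fieldType) (A : falgType K) (V : vectType A^c)
  (v : V) (a : A) : V := (a : A^c) *: v.

(* By the universal property of the tensor product, a B-linear map from the
   tensor product of V and M over A to W is the same as a balanced map. *)
Record balanced (K : fieldType) (A B : falgType K) (V : vectType A^c)
    (M : bimodule A B) (W : vectType B^c) (phi : V -> M -> W) : Prop :=
  Balanced {
  balDl : forall u v x, phi (u + v) x = phi u x + phi v x;
  balDr : forall v x y, phi v (x + y) = phi v x + phi v y;
  bal_ract : forall v a x, phi (ract v a) x = phi v (lact a x);
  bal_bract : forall v x b, phi v (bract x b) = ract (phi v x) b }.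

Section Representations.
Variables (K : fieldType) (n : nat) (Q : valued_quiver n).
Variable Mod : modulation K Q.
Local Notation F := (mod_alg Mod).
Local Notation M := (mod_bim Mod).

Record rep := Rep {
  rep_space :> forall i, vectType (F i)^c;
  rep_map : forall i j, rep_space i -> M i j -> rep_space j;
  rep_balanced : forall i j, arrow Q i j -> balanced (@rep_map i j) }.

Definition dimvec (V : rep) : 'rV[nat]_n := \row_i dim (V i).

Record morphism (V W : rep) (f : forall i, V i -> W i) : Prop := Morphism {
  mor_linear : forall i, linear (f i);
  mor_map : forall i j, arrow Q i j -> forall (v : V i) (x : M i j),
    f j (rep_map v x) = rep_map (f i v) x }.

(* The elements of K act through their images in F i. *)
Definition is_hom_dim (V W : rep) (d : nat) : Prop :=
  exists e : 'I_d -> forall i, V i -> W i,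
    (forall k, morphism (e k)) /\
    forall f : (forall i, V i -> W i), morphism f ->
      exists! a : 'rV[K]_d, forall i v,
        f i v = \sum_k ract (e k i v) (a 0 k)%:A.

Definition hom_dim (V W : rep) : nat := get [set d | is_hom_dim V W d].

(* Applying Hom(-, W) to the standard projective resolution
     0 -> (+)_(i -> j) V_i (x) M_ij (x) P_j -> (+)_i V_i (x) P_i -> V -> 0,
   where P_i is the projective at i, shows that Ext^1(V, W) is the cokernel of
     (+)_i Hom(V_i, W_i) -> (+)_(i -> j) Hom(V_i (x) M_ij, W_j).
   Equivalently, a cocycle c defines the extension with spaces W_i (+) V_i and
   structure maps ((w, v), x) |-> (w x + c(v, x), v x), and two cocycles give
   equivalent extensions iff they differ by a coboundary. *)
Definition cochain (V W : rep) : Type := forall i j, V i -> M i j -> W j.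

Definition cocycle (V W : rep) (c : cochain V W) : Prop :=
  forall i j, arrow Q i j -> balanced (@c i j).

Definition coboundary (V W : rep) (c : cochain V W) : Prop :=
  exists h : (forall i, V i -> W i), (forall i, linear (h i)) /\
    forall i j, arrow Q i j -> forall (v : V i) (x : M i j),
      c i j v x = h j (rep_map v x) - rep_map (h i v) x.

Definition is_ext_dim (V W : rep) (d : nat) : Prop :=
  exists e : 'I_d -> cochain V W,
    (forall k, cocycle (e k)) /\
    forall c : cochain V W, cocycle c ->
      exists! a : 'rV[K]_d, coboundary ((fun i j v x =>
        c i j v x - \sum_k ract (e k i j v x) (a 0 k)%:A) : cochain V W).

Definition ext_dim (V W : rep) : nat := get [set d | is_ext_dim V W d].

Definition embeds (V W : rep) : Prop :=
  exists2 f : (forall i, V i -> W i), morphism f & forall i, injective (f i).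

Definition projects (V W : rep) : Prop :=
  exists2 f : (forall i, V i -> W i), morphism f &
    forall i w, exists v, f i v = w.

Definition division_end (V : rep) : Prop :=
  (exists i, exists v : V i, v != 0) /\
  forall f : (forall i, V i -> V i), morphism f ->
    (exists i v, f i v != 0) ->
    exists2 g : (forall i, V i -> V i), morphism g &
      forall i, cancel (f i) (g i) /\ cancel (g i) (f i).

Definition exceptional (V : rep) : Prop :=
  division_end V /\ ext_dim V V = 0%N.

Definition real_schur_root (beta : 'rV[nat]_n) : Prop :=
  exists2 V : rep, exceptional V & dimvec V = beta.

Definition zero_rep : rep.
Proof.
exists (fun i => 'rV[(F i)^c]_0) (fun i j _ _ => 0) => i j _.
by split=> *; rewrite ?addr0 // /ract scaler0.
Defined.

(* The exceptional module M_beta; it is unique up to isomorphism, hence none of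
   the notions below depends on the choice. The value zero_rep is junk: it is taken
   only when beta is not a real Schur root. *)
Definition root_module (beta : 'rV[nat]_n) : rep :=
  if pselect (exists V, exceptional V /\ dimvec V = beta) is left exV
  then projT1 (cid exV) else zero_rep.

Definition rhom (alpha beta : 'rV[nat]_n) : nat :=
  hom_dim (root_module alpha) (root_module beta).

Definition rext (alpha beta : 'rV[nat]_n) : nat :=
  ext_dim (root_module alpha) (root_module beta).

Definition hom_orthogonal (alpha beta : 'rV[nat]_n) : Prop :=
  [/\ alpha <> beta, rhom alpha beta = 0%N & rhom beta alpha = 0%N].

Definition subroot (beta' beta : 'rV[nat]_n) : Prop :=
  real_schur_root beta' /\ embeds (root_module beta') (root_module beta).

Definition quotient_root (beta' beta : 'rV[nat]_n) : Prop :=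
  real_schur_root beta' /\ projects (root_module beta) (root_module beta').

Definition lateral_ordering (m : nat) (S : 'I_m -> 'rV[nat]_n)
    (le : rel 'I_m) : Prop :=
  [/\ reflexive le, antisymmetric le, transitive le & total le] /\
  forall i j, (rhom (S i) (S j) <> 0%N -> le i j) /\
              (rext (S i) (S j) <> 0%N -> le j i /\ i <> j).

(* The admissible set is {S 0, ..., S (m - 1)}, listed in its vertical
   ordering. *)
Record admissible_set (m : nat) (S : 'I_m -> 'rV[nat]_n) : Prop :=
  AdmissibleSet {
  adm_inj : injective S;
  adm_root : forall k, real_schur_root (S k);
  adm_lateral : exists le : rel 'I_m, lateral_ordering S le;
  adm_vertical : forall k beta,
    subroot beta (S k) \/ quotient_root beta (S k) ->
    exists2 j : 'I_m, (j <= k)%N & S j = beta }.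

Section Compartments.
Variable R : realType.

Definition pairing (x : 'rV[R]_n) (beta : 'rV[nat]_n) : R :=
  \sum_i x 0 i * (beta 0 i)%:R * (qval Q i)%:R.

Definition hyperplane (beta : 'rV[nat]_n) : set 'rV[R]_n :=
  [set x | pairing x beta = 0].

Definition wall (beta : 'rV[nat]_n) : set 'rV[R]_n :=
  [set x | pairing x beta = 0 /\
           forall beta', subroot beta' beta -> pairing x beta' <= 0].

Definition positive_side (beta : 'rV[nat]_n) : set 'rV[R]_n :=
  [set x | 0 < pairing x beta].

Definition negative_side (beta : 'rV[nat]_n) : set 'rV[R]_n :=
  [set x | pairing x beta < 0].

End Compartments.
End Representations.

Inductive sign := Zero | Plus | Minus.

Section SignVectors.
Variables (K : fieldType) (n : nat) (Q : valued_quiver n).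
Variables (Mod : modulation K Q) (R : realType).
Variables (m : nat) (S : 'I_m -> 'rV[nat]_n).

(* The set U of the first p signs of eps. *)
Definition region (eps : 'I_m -> sign) (p : nat) : set 'rV[R]_n :=
  [set x | forall i : 'I_m, (i < p)%N ->
    match eps i with
    | Zero => True
    | Plus => 0 < pairing Q x (S i)
    | Minus => pairing Q x (S i) < 0
    end].

Definition compartment (eps : 'I_m -> sign) : set 'rV[R]_n := region eps m.

Definition admissible_sign (eps : 'I_m -> sign) : Prop :=
  forall k : 'I_m,
    eps k = Zero <-> wall Mod (S k) `&` region eps k = set0.

Definition wall_separated (beta : 'rV[nat]_n) (U U' : set 'rV[R]_n) : Prop :=
  ((U `<=` negative_side Q beta /\ U' `<=` positive_side Q beta) \/
   (U `<=` positive_side Q beta /\ U' `<=` negative_side Q beta)) /\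
  exists O : set 'rV[R]_n,
    [/\ open O, (O `&` hyperplane Q beta) !=set0,
        O `&` hyperplane Q beta `<=` closure U `&` closure U' &
        O `&` hyperplane Q beta `<=` wall Mod beta].

End SignVectors.

Arguments positive_side {n} Q R beta _.
Arguments compartment {n} Q R {m} S eps _.

(* The letter (true, i) is the generator i, and (false, i) is its inverse. *)
Definition word (I : choiceType) := seq (bool * I).

Section PresentedGroup.
Variables (I : choiceType) (rel : word I -> word I -> Prop).

Inductive word_eq : word I -> word I -> Prop :=
| word_eq_refl u : word_eq u u
| word_eq_sym u v : word_eq u v -> word_eq v u
| word_eq_trans u v w : word_eq u v -> word_eq v w -> word_eq u w
| word_eq_cancel u v b i :
    word_eq (u ++ [:: (b, i); (~~ b, i)] ++ v) (u ++ v)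
| word_eq_rel u v r s : rel r s -> word_eq (u ++ r ++ v) (u ++ s ++ v).

Definition word_eqb (u v : word I) : bool := `[< word_eq u v >].

Lemma word_eqb_refl : reflexive word_eqb.
Proof. by move=> u; apply/asboolP; apply: word_eq_refl. Qed.

Lemma word_eqb_sym : symmetric word_eqb.
Proof. by move=> u v; apply/asboolP/asboolP; apply: word_eq_sym. Qed.

Lemma word_eqb_trans : transitive word_eqb.
Proof.
move=> v u w /asboolP uv /asboolP vw; apply/asboolP.
exact: word_eq_trans uv vw.
Qed.

Canonical word_eq_equiv :=
  EquivRel word_eqb word_eqb_refl word_eqb_sym word_eqb_trans.

Definition presented_group := {eq_quot word_eqb}%qT.
HB.instance Definition _ := Choice.on presented_group.
HB.instance Definition _ := EqQuotient.on presented_group.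

Definition pg_class (u : word I) : presented_group := (\pi u)%qT.

Lemma pg_classP u v : pg_class u = pg_class v <-> word_eq u v.
Proof. by split=> [/eqmodP/asboolP//|uv]; apply/eqmodP/asboolP. Qed.

Lemma pg_class_repr (x : presented_group) : pg_class (repr x) = x.
Proof. exact: reprK. Qed.

Lemma word_eq_ctx a b u v :
  word_eq u v -> word_eq (a ++ u ++ b) (a ++ v ++ b).
Proof.
elim=> [w|w x _|w x y _ h1 _ h2|w x c i|w x r s rs].
- exact: word_eq_refl.
- exact: word_eq_sym.
- exact: word_eq_trans h1 h2.
- by have := word_eq_cancel (a ++ w) (x ++ b) c i; rewrite -!catA.
- by have := word_eq_rel (a ++ w) (x ++ b) rs; rewrite -!catA.
Qed.

Lemma word_eq_cat u u' v v' :
  word_eq u u' -> word_eq v v' -> word_eq (u ++ v) (u' ++ v').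
Proof.
move=> uu vv; apply: (@word_eq_trans _ (u' ++ v)).
  exact: (word_eq_ctx [::] v uu).
by have := word_eq_ctx u' [::] vv; rewrite !cats0.
Qed.

Definition word_inv (u : word I) : word I :=
  rev [seq (~~ l.1, l.2) | l <- u].

Lemma word_invK : involutive word_inv.
Proof.
move=> u; rewrite /word_inv map_rev revK -map_comp -[RHS]map_id.
by apply: eq_map => -[b i] /=; rewrite negbK.
Qed.

Lemma word_eq_mulV u : word_eq (u ++ word_inv u) [::].
Proof.
elim: u => [|[b i] u ihu]; first exact: word_eq_refl.
rewrite /word_inv /= rev_cons -cats1 -[(b, i) :: _]/([:: (b, i)] ++ _).
rewrite -/(word_inv u); apply: word_eq_trans (word_eq_cancel [::] [::] b i).
by have := word_eq_ctx [:: (b, i)] [:: (~~ b, i)] ihu; rewrite -!catA.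
Qed.

Lemma word_eq_mulVl u : word_eq (word_inv u ++ u) [::].
Proof. by have := word_eq_mulV (word_inv u); rewrite word_invK. Qed.

Definition pg_one : presented_group := pg_class [::].
Definition pg_mul (x y : presented_group) : presented_group :=
  pg_class (repr x ++ repr y).
Definition pg_inv (x : presented_group) : presented_group :=
  pg_class (word_inv (repr x)).

Lemma repr_class u : word_eq (repr (pg_class u)) u.
Proof. by apply/pg_classP; rewrite pg_class_repr. Qed.

Lemma pg_mulA : associative pg_mul.
Proof.
move=> x y z; apply/pg_classP.
apply: word_eq_trans (word_eq_cat (word_eq_refl _) (repr_class _)) _.
rewrite catA; apply: word_eq_sym.
exact: word_eq_cat (repr_class _) (word_eq_refl _).
Qed.

Lemma pg_mul1 : left_id pg_one pg_mul.
Proof.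
move=> x; rewrite -[RHS]pg_class_repr; apply/pg_classP.
exact: word_eq_cat (repr_class [::]) (word_eq_refl (repr x)).
Qed.

Lemma pg_mulr1 : right_id pg_one pg_mul.
Proof.
move=> x; rewrite -[RHS]pg_class_repr; apply/pg_classP.
have := word_eq_cat (word_eq_refl (repr x)) (repr_class [::]).
by rewrite cats0.
Qed.

Lemma pg_mulV : left_inverse pg_one pg_inv pg_mul.
Proof.
move=> x; apply/pg_classP; apply: word_eq_trans (word_eq_mulVl (repr x)).
exact: word_eq_cat (repr_class _) (word_eq_refl _).
Qed.

Lemma pg_mulrV : right_inverse pg_one pg_inv pg_mul.
Proof.
move=> x; apply/pg_classP; apply: word_eq_trans (word_eq_mulV (repr x)).
exact: word_eq_cat (word_eq_refl _) (repr_class _).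
Qed.

HB.instance Definition _ := isGroup.Build presented_group
  pg_mulA pg_mul1 pg_mulr1 pg_mulV pg_mulrV.

Lemma pg_classM u v : (pg_class u * pg_class v)%g = pg_class (u ++ v).
Proof. by apply/pg_classP; apply: word_eq_cat; exact: repr_class. Qed.

End PresentedGroup.

Section PictureGroup.
Variables (K : fieldType) (n : nat) (Q : valued_quiver n).
Variables (Mod : modulation K Q) (m : nat) (S : 'I_m -> 'rV[nat]_n).

(* s lists the roots of S of the form a *: S i + b *: S j, each one with its
   pair of coefficients (a, b), in increasing order of a / b; the order of the
   fractions is tested by cross-multiplication because b may be 0. *)
Definition rank2_list (i j : 'I_m) (s : seq ('I_m * (nat * nat))) : Prop :=
  [/\ forall k, (k \in [seq t.1 | t <- s]) <->
        (exists a b, S k = S i *+ a + S j *+ b),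
      forall t, t \in s -> S t.1 = S i *+ t.2.1 + S j *+ t.2.2 &
      pairwise (fun t t' => t.2.1 * t'.2.2 < t'.2.1 * t.2.2)%N s].

Inductive picture_rel : word 'I_m -> word 'I_m -> Prop :=
| PictureRel i j s :
    hom_orthogonal Mod (S i) (S j) -> rext Mod (S i) (S j) = 0%N ->
    rank2_list i j s ->
    picture_rel [:: (true, i); (true, j)] [seq (true, t.1) | t <- s].

Definition picture_group : groupType := presented_group picture_rel.

Definition picture_gen (k : 'I_m) : picture_group :=
  pg_class picture_rel [:: (true, k)].

End PictureGroup.

(* The dimensions hom_dim and ext_dim always exist (hom_dimP, ext_dimP), so that
   the default value of get is never used, and ext_dim V W = 0 iff every short
   exact sequence 0 -> W -> E -> V -> 0 splits (ext_dim_eq0_split). *)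
Module HomExtDim.
Import VectorInternalTheory.

Lemma submod_vspace (K : fieldType) (V : vectType K) (A : set V) :
  A 0 -> (forall a x y, A x -> A y -> A (a *: x + y)) ->
  exists U : {vspace V}, forall x, A x <-> x \in U.
Proof.
move=> A0 AD.
pose P d := `[< exists U : {vspace V}, (forall x, x \in U -> A x) /\ \dim U = d >].
have P0 : exists d, P d.
  exists 0%N; apply/asboolP; exists 0%VS; split; last exact: dimv0.
  by move=> x; rewrite memv0 => /eqP ->.
have Pb d : P d -> (d <= \dim {:V})%N.
  by move=> /asboolP[U [_ <-]]; apply/dimvS/subvf.
case: (ex_maxnP P0 Pb) => d /asboolP[U [UA dU]] dmax.
exists U => x; split=> [Ax|]; last exact: UA.
have := dmax (\dim (U + <[x]>)).
have -> : P (\dim (U + <[x]>)).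
  apply/asboolP; exists (U + <[x]>)%VS; split=> // y /memv_addP[u uU [w /vlineP[a ->] ->]].
  by rewrite addrC; apply: AD => //; apply: UA.
move=> /(_ isT); rewrite -dU => le_d.
have /eqP -> : (U == U + <[x]>)%VS by rewrite eqEdim addvSl.
by rewrite (subvP (addvSr _ _)) // memv_line.
Qed.

Lemma quot_basis (K : fieldType) (V : vectType K) (A B : set V) :
  A 0 -> (forall a x y, A x -> A y -> A (a *: x + y)) ->
  B 0 -> (forall a x y, B x -> B y -> B (a *: x + y)) -> B `<=` A ->
  exists d (e : 'I_d -> V), (forall k, A (e k)) /\
    forall x, A x -> exists! a : 'rV[K]_d, B (x - \sum_k a 0 k *: e k).
Proof.
move=> A0 AD B0 BD BA.
have [U AU] := submod_vspace A0 AD; have [W BW] := submod_vspace B0 BD.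
have WU : (W <= U)%VS by apply/subvP => x /BW/BA/AU.
pose C := (U :\: W)%VS; pose X := vbasis C.
exists (\dim C), (fun k => X`_k); split=> [k|x /AU].
  by apply/AU; apply: (subvP (diffvSl U W)); apply/vbasis_mem/mem_nth; rewrite size_tuple.
rewrite -(addv_diff_cap U W) (capv_idPr WU) => /memv_addP[c cC [w wW ->]].
exists (\row_k coord X k c); split=> [|a].
  apply/BW; under eq_bigr do rewrite mxE.
  by rewrite -(coord_vbasis cC) addrAC subrr add0r.
move=> /BW h; have h2 : c - \sum_k a 0 k *: X`_k \in W.
  by have := memvB h wW; rewrite addrAC addrK.
have h3 : c - \sum_k a 0 k *: X`_k \in C.
  rewrite memvB // memv_suml // => k _; rewrite memvZ //.
  by apply/vbasis_mem/mem_nth; rewrite size_tuple.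
have : c - \sum_k a 0 k *: X`_k \in (W :&: C)%VS by rewrite memv_cap h2 h3.
rewrite capvC capv_diff memv0 subr_eq0 => /eqP ->.
apply/rowP => k; rewrite mxE coord_sum_free ?mxE //.
exact: basis_free (vbasisP C).
Qed.

Section Lin.
Variables (K : fieldType) (A : falgType K).
Lemma ractA (V : vectType A^c) (v : V) a b : ract v (a * b) = ract (ract v a) b.
Proof. by rewrite /ract scalerA. Qed.
Lemma ractDl (V : vectType A^c) (u v : V) a : ract (u + v) a = ract u a + ract v a.
Proof. by rewrite /ract scalerDr. Qed.
Lemma ractDr (V : vectType A^c) (v : V) a b : ract v (a + b) = ract v a + ract v b.
Proof. by rewrite /ract scalerDl. Qed.
Lemma linear_ract (V W : vectType A^c) (f : V -> W) : linear f ->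
  forall v a, f (ract v a) = ract (f v) a.
Proof.
move=> lf v a; pose g : {linear V -> W} := HB.pack f (GRing.isLinear.Build _ _ _ _ f lf).
by rewrite -[f]/(g : _ -> _) linearZ.
Qed.
Lemma linear_add (V W : vectType A^c) (f : V -> W) : linear f ->
  forall u v, f (u + v) = f u + f v.
Proof.
move=> lf u v; pose g : {linear V -> W} := HB.pack f (GRing.isLinear.Build _ _ _ _ f lf).
by rewrite -[f]/(g : _ -> _) linearD.
Qed.
Lemma ract1 (V : vectType A^c) (v : V) : ract v 1 = v.
Proof. exact: scale1r. Qed.

(* K-coordinates of W *)
Definition kc (W : vectType A^c) (w : W) (t : 'I_(dim W)) (u : 'I_(dim A)) : K :=
  v2r ((v2r w) 0 t : A) 0 u.
Lemma kc_inj (W : vectType A^c) (w w' : W) : kc w =2 kc w' -> w = w'.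
Proof.
move=> h; apply: v2r_inj; apply/rowP => t; apply: (@v2r_inj _ A); apply/rowP => u.
exact: h.
Qed.
Lemma kcP (W : vectType A^c) (k : K) (w w' : W) t u :
  kc (ract w k%:A + w') t u = k * kc w t u + kc w' t u.
Proof.
rewrite /kc /ract linearP !mxE.
rewrite -[(_ * _ : A^c)]/((v2r w 0 t : A) * k%:A) -scalerAr mulr1.
by rewrite -[_ + _]/((k *: (v2r w 0 t : A) + v2r w' 0 t) : A) linearP !mxE.
Qed.
End Lin.

Lemma dbl0 (V : zmodType) (a : V) : a = a + a -> a = 0.
Proof. by rewrite -[LHS]addr0 => /addrI/esym. Qed.

Section Lin2.
Variables (K : fieldType) (A : falgType K).
Lemma ractC (V : vectType A^c) (v : V) a (k : K) :
  ract (ract v a) k%:A = ract (ract v k%:A) a.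
Proof. by rewrite -!ractA mulr_algl mulr_algr. Qed.
Lemma ractN (V : vectType A^c) (v : V) a : ract (- v) a = - ract v a.
Proof. by rewrite /ract scalerN. Qed.
Lemma ract0 (V : vectType A^c) a : ract (0 : V) a = 0.
Proof. by rewrite /ract scaler0. Qed.
Lemma linear_0 (V W : vectType A^c) (f : V -> W) : linear f -> f 0 = 0.
Proof. by move=> lf; have := linear_add lf 0 0; rewrite addr0; exact: dbl0. Qed.
Lemma ract_sum (V : vectType A^c) I (r : seq I) (v : I -> V) a :
  ract (\sum_(i <- r) v i) a = \sum_(i <- r) ract (v i) a.
Proof. by rewrite /ract scaler_sumr. Qed.
Lemma linear_comb (V W : vectType A^c) (f g : V -> W) k : linear f -> linear g ->
  linear (fun v => ract (f v) k%:A + g v).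
Proof.
move=> lf lg a u v.
rewrite lf lg ractDl -[a *: f u]/(ract (f u) a) ractC scalerDr -!addrA; congr (_ + _).
by rewrite addrCA.
Qed.
Lemma v2r_expand (V : vectType A^c) (v : V) : v = \sum_s ract (r2v (delta_mx 0 s)) (v2r v 0 s : A).
Proof.
apply: v2r_inj; rewrite linear_sum [LHS]row_sum_delta; apply: eq_bigr => s _.
by rewrite /ract linearZ /= r2vK.
Qed.
Lemma linear_sumE (V W : vectType A^c) (f : V -> W) : linear f ->
  forall v, f v = \sum_s ract (f (r2v (delta_mx 0 s))) (v2r v 0 s : A).
Proof.
move=> lf v; pose g : {linear V -> W} := HB.pack f (GRing.isLinear.Build _ _ _ _ f lf).
rewrite {1}[v]v2r_expand -[f]/(g : _ -> _) linear_sum; apply: eq_bigr => s _.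
by rewrite /ract linearZ.
Qed.
Lemma linear_add_fun (V W : vectType A^c) (f g : V -> W) : linear f -> linear g ->
  linear (fun v => f v + g v).
Proof. by move=> lf lg a u v; rewrite lf lg scalerDr -!addrA; congr (_ + _); rewrite addrCA. Qed.
End Lin2.

Section Bal.
Variables (K : fieldType) (A B : falgType K) (V : vectType A^c) (M : bimodule A B) (W : vectType B^c).
Lemma bal_comb (f g : V -> M -> W) k : balanced f -> balanced g ->
  balanced (fun v x => ract (f v x) k%:A + g v x).
Proof.
move=> bf bg; split=> [u v x|v x y|v a x|v x b].
- by rewrite (balDl bf) (balDl bg) ractDl !addrA; congr (_ + _); rewrite addrAC.
- by rewrite (balDr bf) (balDr bg) ractDl !addrA; congr (_ + _); rewrite addrAC.
- by rewrite (bal_ract bf) (bal_ract bg).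
- by rewrite (bal_bract bf) (bal_bract bg) ractC ractDl.
Qed.
Lemma bal0 : balanced (fun (_ : V) (_ : M) => (0 : W)).
Proof. by split=> *; rewrite ?addr0 // ract0. Qed.
Lemma bract_alg (x : M) (k : K) : bract x k%:A = k *: x.
Proof.
pose g : {linear B -> M} := HB.pack (bract x) (GRing.isLinear.Build _ _ _ _ _ (bract_linearr x)).
by rewrite -[bract x]/(g : _ -> _) linearZ /= bract1.
Qed.
Lemma lact_alg (x : M) (k : K) : lact k%:A x = k *: x.
Proof.
pose g : {linear A -> M} := HB.pack (fun a : A => lact a x)
  (GRing.isLinear.Build _ _ _ _ _ (@lact_linearl _ _ _ M x)).
by rewrite -[lact _ x]/(g _) linearZ /= lact1.
Qed.
Lemma bal_0r (f : V -> M -> W) v : balanced f -> f v 0 = 0.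
Proof. by move=> bf; have := balDr bf v 0 0; rewrite addr0; exact: dbl0. Qed.
Lemma bal_0l (f : V -> M -> W) x : balanced f -> f 0 x = 0.
Proof. by move=> bf; have := balDl bf 0 0 x; rewrite addr0; exact: dbl0. Qed.
Lemma bal_det (f g : V -> M -> W) : balanced f -> balanced g ->
  (forall s u, f (r2v (delta_mx 0 s)) (r2v (delta_mx 0 u)) =
               g (r2v (delta_mx 0 s)) (r2v (delta_mx 0 u))) -> f =2 g.
Proof.
move=> bf bg h.
have suml (f' : V -> M -> W) : balanced f' -> forall I (r : seq I) (v : I -> V) x,
  f' (\sum_(i <- r) v i) x = \sum_(i <- r) f' (v i) x.
  move=> bf' I r v x; elim: r => [|i r ih]; first by rewrite !big_nil bal_0l.
  by rewrite !big_cons (balDl bf') ih.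
have sumr (f' : V -> M -> W) : balanced f' -> forall I (r : seq I) v (x : I -> M),
  f' v (\sum_(i <- r) x i) = \sum_(i <- r) f' v (x i).
  move=> bf' I r v x; elim: r => [|i r ih]; first by rewrite !big_nil bal_0r.
  by rewrite !big_cons (balDr bf') ih.
have h2 s y : f (r2v (delta_mx 0 s)) y = g (r2v (delta_mx 0 s)) y.
  rewrite -[y]v2rK [v2r y]row_sum_delta linear_sum /= !sumr //; apply: eq_bigr => u _.
  by rewrite linearZ /= -bract_alg (bal_bract bf) (bal_bract bg) h.
move=> v x; rewrite [v]v2r_expand !suml //; apply: eq_bigr => s _.
by rewrite (bal_ract bf) (bal_ract bg) h2.
Qed.
End Bal.

Section Fin.
Variables (K : fieldType) (n : nat) (Q : valued_quiver n) (Mod : modulation K Q).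
Variables (V W : rep Mod).
Local Notation F := (mod_alg Mod).
Local Notation M := (mod_bim Mod).

Definition TE := {ij : 'I_n * 'I_n &
  (('I_(dim (V ij.1)) * 'I_(dim (M ij.1 ij.2))) * ('I_(dim (W ij.2)) * 'I_(dim (F ij.2))))%type}.
Definition phiE (c : cochain V W) : {ffun TE -> K^o} :=
  [ffun t : TE => if arrow Q (tag t).1 (tag t).2 then
     kc (c _ _ (r2v (delta_mx 0 (tagged t).1.1)) (r2v (delta_mx 0 (tagged t).1.2)))
      (tagged t).2.1 (tagged t).2.2 else 0].

Definition combE k (c c' : cochain V W) : cochain V W := fun i j v x =>
  ract (c i j v x) k%:A + c' i j v x.
Lemma phiE_comb k (c c' : cochain V W) : phiE (combE k c c') = k *: phiE c + phiE c'.
Proof.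
by apply/ffunP => t; rewrite !ffunE; case: ifP => _; rewrite ?kcP // scaler0 addr0.
Qed.
Lemma cocycle_comb k (c c' : cochain V W) : cocycle c -> cocycle c' -> cocycle (combE k c c').
Proof. by move=> h h' i j ij; apply: bal_comb; [apply: h|apply: h']. Qed.
Lemma coboundary_comb k (c c' : cochain V W) : coboundary c -> coboundary c' -> coboundary (combE k c c').
Proof.
move=> [h [lh ch]] [h' [lh' ch']]; exists (fun i v => ract (h i v) k%:A + h' i v); split.
  by move=> i; apply: linear_comb.
move=> i j ij v x; rewrite /combE ch // ch' // ractDl ractN.
have bW := rep_balanced W ij.
rewrite (balDl bW) (bal_ract bW).
rewrite lact_alg -(bract_alg x) (bal_bract bW) opprD !addrA; congr (_ + _); rewrite addrAC //.
Qed.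
Lemma phiE_det c c' : cocycle c -> cocycle c' -> phiE c = phiE c' ->
  forall i j, arrow Q i j -> c i j =2 c' i j.
Proof.
move=> hc hc' /ffunP h i j ij; apply: bal_det; [exact: hc|exact: hc'|].
move=> s u; apply: kc_inj => t w.
by have := h (existT _ (i, j) ((s, u), (t, w)) : TE); rewrite !ffunE /= ij.
Qed.
Lemma cob_ext (c c' : cochain V W) : (forall i j, arrow Q i j -> c i j =2 c' i j) ->
  coboundary c -> coboundary c'.
Proof. by move=> e [h [lh ch]]; exists h; split=> // i j ij v x; rewrite -e // ch. Qed.

Definition zeroE : cochain V W := fun i j _ _ => 0.
Arguments zeroE : clear implicits.
Lemma cocycle0 : cocycle zeroE.
Proof. by move=> i j _; apply: bal0. Qed.
Lemma cob0 : coboundary zeroE.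
Proof.
exists (fun _ _ => 0); split=> [i a u v|i j ij v x]; first by rewrite scaler0 addr0.
by rewrite (bal_0l x (rep_balanced W ij)) subr0.
Qed.
Lemma phiE0 : phiE zeroE = 0.
Proof.
have h : combE (-1) zeroE zeroE = zeroE.
  by do 4!(apply: functional_extensionality_dep => ?); rewrite /combE /zeroE ract0 addr0.
by have := phiE_comb (-1) zeroE zeroE; rewrite h scaleN1r addNr.
Qed.

Lemma ext_dim_ex : exists d, is_ext_dim V W d.
Proof.
pose A := [set y | exists2 c, cocycle c & phiE c = y].
pose B := [set y | exists2 c, cocycle c /\ coboundary c & phiE c = y].
have [|||||d [e [eA eB]]] := @quot_basis K _ A B.
- by exists zeroE; [exact: cocycle0|exact: phiE0].
- by move=> a _ _ [c hc <-] [c' hc' <-]; exists (combE a c c'); [exact: cocycle_comb|exact: phiE_comb].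
- by exists zeroE; [split; [exact: cocycle0|exact: cob0]|exact: phiE0].
- move=> a _ _ [c [hc bc] <-] [c' [hc' bc'] <-]; exists (combE a c c'); last exact: phiE_comb.
  by split; [exact: cocycle_comb|exact: coboundary_comb].
- by move=> _ [c [hc _] <-]; exists c.
exists d.
have /choice[E hE] : forall k, exists c, cocycle c /\ phiE c = e k.
  by move=> k; have [c] := eA k; exists c.
exists E; split=> [k|c hc]; first by case: (hE k).
have key (a : 'rV[K]_d) : exists2 c', cocycle c' /\
    phiE c' = phiE c - \sum_k a 0 k *: e k &
    c' = (fun i j v x => c i j v x - \sum_k ract (E k i j v x) (a 0 k)%:A).
  eexists; last by reflexivity.
  have Hs (r : seq 'I_d) : cocycle (fun i j v x => \sum_(k <- r) ract (E k i j v x) (a 0 k)%:A) /\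
    phiE (fun i j v x => \sum_(k <- r) ract (E k i j v x) (a 0 k)%:A) = \sum_(k <- r) a 0 k *: e k.
    elim: r => [|k r [ih1 ih2]].
      have -> : (fun i j v x => \sum_(k <- [::]) ract (E k i j v x) (a 0 k)%:A) = zeroE.
        by do 4!(apply: functional_extensionality_dep => ?); rewrite big_nil.
      by rewrite big_nil phiE0; split=> //; exact: cocycle0.
    have -> : (fun i j v x => \sum_(k <- k :: r) ract (E k i j v x) (a 0 k)%:A) =
      combE (a 0 k) (E k) (fun i j v x => \sum_(k <- r) ract (E k i j v x) (a 0 k)%:A).
      by do 4!(apply: functional_extensionality_dep => ?); rewrite big_cons.
    rewrite phiE_comb ih2 big_cons; have [h1 h2] := hE k.
    by split; [exact: cocycle_comb|rewrite h2].
  have [s1 s2] := Hs (index_enum 'I_d).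
  set s := (fun i j v x => \sum_k _) in s1 s2.
  have -> : (fun i j v x => c i j v x - \sum_k ract (E k i j v x) (a 0 k)%:A) = combE (-1) s c.
    do 4!(apply: functional_extensionality_dep => ?); rewrite /combE /s scaleN1r.
    by rewrite {2}/ract scaleN1r addrC.
  split; first exact: cocycle_comb.
  by rewrite phiE_comb s2 scaleN1r addrC.
have {}key (a : 'rV[K]_d) : B (phiE c - \sum_k a 0 k *: e k) <->
    coboundary (fun i j v x => c i j v x - \sum_k ract (E k i j v x) (a 0 k)%:A).
  have [c' [h1 h2] h3] := key a; rewrite -h3 -h2; split=> [[c'' [h4 h5] h6]|h].
    exact: cob_ext (phiE_det h4 h1 h6) h5.
  by exists c'.
have [|a [ha ua]] := eB (phiE c); first by exists c.
by exists a; split=> [|a' ha']; [apply/key|apply/ua/key].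
Qed.

Lemma ext_dimP : is_ext_dim V W (ext_dim V W).
Proof.
have [d hd] := ext_dim_ex.
by apply: (@getPex _ [set d | is_ext_dim V W d]); exists d.
Qed.

Lemma ext_dim_eq0 : ext_dim V W = 0%N <->
  forall c : (cochain V W), cocycle c -> coboundary c.
Proof.
have hd := ext_dimP.
split=> [h0 c hc|h].
  move: hd; rewrite h0 => -[e [he eu]]; have [a [ha _]] := eu c hc.
  apply: cob_ext ha => i j ij v x /=; by rewrite big_ord0 subr0.
case: hd; move: (ext_dim V W) => [//|d] e [he eu].
have [a [ha ua]] := eu zeroE cocycle0.
have z (b : 'rV[K]_d.+1) : coboundary (fun i j v x => zeroE i j v x - \sum_k ract (e k i j v x) (b 0 k)%:A).
  apply: h => i j ij; split=> *.
  - rewrite /zeroE !sub0r -opprD -big_split /=; congr (- _); apply: eq_bigr => k _.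
    by rewrite (balDl (he k _ _ ij)) ractDl.
  - rewrite /zeroE !sub0r -opprD -big_split /=; congr (- _); apply: eq_bigr => k _.
    by rewrite (balDr (he k _ _ ij)) ractDl.
  - rewrite /zeroE !sub0r; congr (- _); apply: eq_bigr => k _.
    by rewrite (bal_ract (he k _ _ ij)).
  - rewrite /zeroE !sub0r ractN ract_sum; congr (- _); apply: eq_bigr => k _.
    by rewrite (bal_bract (he k _ _ ij)) ractC.
have := ua 0 (z 0); rewrite (ua (const_mx 1) (z _)) => /rowP /(_ ord0); rewrite !mxE.
by move/eqP; rewrite oner_eq0.
Qed.
End Fin.

Section FinHom.
Variables (K : fieldType) (n : nat) (Q : valued_quiver n) (Mod : modulation K Q).
Variables (V W : rep Mod).
Local Notation F := (mod_alg Mod).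
Local Notation M := (mod_bim Mod).
Local Notation maps := (forall i, V i -> W i).

Definition TH := {i : 'I_n & ('I_(dim (V i)) * ('I_(dim (W i)) * 'I_(dim (F i))))%type}.
Definition phiH (f : maps) : {ffun TH -> K^o} :=
  [ffun t : TH => kc (f _ (r2v (delta_mx 0 (tagged t).1)))
      (tagged t).2.1 (tagged t).2.2].

Definition combH k (f g : maps) : maps := fun i v => ract (f i v) k%:A + g i v.

Lemma phiH_comb k f g : phiH (combH k f g) = k *: phiH f + phiH g.
Proof. by apply/ffunP => t; rewrite !ffunE kcP. Qed.

Lemma morphism_comb k f g : morphism f -> morphism g -> morphism (combH k f g).
Proof.
move=> mf mg; split=> [i|i j ij v x].
  by apply: linear_comb; [case: mf|case: mg].
have bW := rep_balanced W ij.
rewrite /combH (mor_map mf) // (mor_map mg) // (balDl bW) (bal_ract bW).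
by rewrite lact_alg -(bract_alg x) (bal_bract bW).
Qed.

Lemma phiH_det f g : morphism f -> morphism g -> phiH f = phiH g ->
  forall i, f i =1 g i.
Proof.
move=> [lf _] [lg _] /ffunP h i v.
rewrite (linear_sumE (lf i)) (linear_sumE (lg i)); apply: eq_bigr => s _.
congr ract; apply: kc_inj => t u.
by have := h (existT _ i (s, (t, u)) : TH); rewrite !ffunE.
Qed.

Definition zeroH : maps := fun _ _ => 0.

Lemma morphism0 : morphism zeroH.
Proof.
split=> [i a u v|i j ij v x]; first by rewrite scaler0 addr0.
by rewrite /zeroH (bal_0l x (rep_balanced W ij)).
Qed.

Lemma phiH0 : phiH zeroH = 0.
Proof.
have h : combH (-1) zeroH zeroH = zeroH.
  by do 2!(apply: functional_extensionality_dep => ?); rewrite /combH /zeroH ract0 addr0.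
by have := phiH_comb (-1) zeroH zeroH; rewrite h scaleN1r addNr.
Qed.

Lemma hom_dim_ex : exists d, is_hom_dim V W d.
Proof.
pose A := [set y | exists2 f, morphism f & phiH f = y].
have [||||y ->|d [e [eA eB]]] := @quot_basis K _ A [set 0].
- by exists zeroH; [exact: morphism0|exact: phiH0].
- move=> a _ _ [f hf <-] [g hg <-].
  by exists (combH a f g); [exact: morphism_comb|exact: phiH_comb].
- by [].
- by move=> a x y /= -> ->; rewrite scaler0 addr0.
- by exists zeroH; [exact: morphism0|exact: phiH0].
exists d.
have /choice[E hE] : forall k, exists f, morphism f /\ phiH f = e k.
  by move=> k; have [f] := eA k; exists f.
exists E; split=> [k|f hf]; first by case: (hE k).
have key (a : 'rV[K]_d) : phiH f - \sum_k a 0 k *: e k = 0 <->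
    forall i v, f i v = \sum_k ract (E k i v) (a 0 k)%:A.
  pose sm (r : seq 'I_d) : maps := fun i v => \sum_(k <- r) ract (E k i v) (a 0 k)%:A.
  have Hs r : morphism (sm r) /\ phiH (sm r) = \sum_(k <- r) a 0 k *: e k.
    elim: r => [|k r [ih1 ih2]].
      have -> : sm [::] = zeroH.
        by do 2!(apply: functional_extensionality_dep => ?); rewrite /sm big_nil.
      by rewrite big_nil phiH0; split=> //; exact: morphism0.
    have -> : sm (k :: r) = combH (a 0 k) (E k) (sm r).
      by do 2!(apply: functional_extensionality_dep => ?); rewrite /sm big_cons.
    rewrite phiH_comb ih2 big_cons; have [h1 h2] := hE k.
    by split; [exact: morphism_comb|rewrite h2].
  have [s1 s2] := Hs (index_enum 'I_d); rewrite -s2; split=> [/eqP|h].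
    by rewrite subr_eq0 => /eqP h; exact: phiH_det h.
  have -> : f = sm (index_enum 'I_d).
    by apply: functional_extensionality_dep => i; apply: functional_extensionality_dep => v; rewrite h.
  by rewrite subrr.
have [|a [ha ua]] := eB (phiH f); first by exists f.
by exists a; split=> [|a' ha']; [apply/key|apply/ua/key].
Qed.

Lemma hom_dimP : is_hom_dim V W (hom_dim V W).
Proof.
have [d hd] := hom_dim_ex.
by apply: (@getPex _ [set d | is_hom_dim V W d]); exists d.
Qed.

End FinHom.

Section Y.
Variables (K : fieldType) (n : nat) (Q : valued_quiver n) (Mod : modulation K Q).
Variables (V W : rep Mod).
Local Notation F := (mod_alg Mod).
Local Notation M := (mod_bim Mod).

Definition short_exact (E : rep Mod) (io : forall i, W i -> E i) (p : forall i, E i -> V i) :=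
  [/\ morphism io, morphism p, forall i, injective (io i),
      forall i v, exists e, p i e = v &
      forall i e, p i e = 0 <-> exists w, io i w = e].

Lemma linear_sub (A : falgType K) (X Y : vectType A^c) (f : X -> Y) : linear f ->
  forall u v, f (u - v) = f u - f v.
Proof.
move=> lf u v; pose g : {linear X -> Y} := HB.pack f (GRing.isLinear.Build _ _ _ _ f lf).
by rewrite -[f]/(g : _ -> _) linearB.
Qed.

Lemma mli (X Y : rep Mod) (f : forall i, X i -> Y i) (h : morphism f) i : linear (f i).
Proof. by case: h. Qed.
Arguments mli [X Y f] h i.

Lemma ext_dim_eq0_split : ext_dim V W = 0%N <->
  forall E io p, @short_exact E io p -> exists2 s : (forall i, V i -> E i), morphism s & forall i, cancel (s i) (p i).
Proof.
rewrite ext_dim_eq0; split=> [h E io p [mio mp iio sp ex]|h c hc].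
- have [s hs] : exists s : (forall i, V i -> E i), (forall i, linear (s i)) /\ forall i, cancel (s i) (p i).
    have : forall i, exists s : V i -> E i, linear s /\ cancel s (p i).
      move=> i; have /choice[b hb] := sp i.
      exists (fun v => \sum_s ract (b (r2v (delta_mx 0 s))) (v2r v 0 s : F i)); split.
        move=> a u v; rewrite scaler_sumr -big_split /=; apply: eq_bigr => k _.
        by rewrite linearP !mxE /ract scalerDl scalerA.
      move=> v; rewrite [RHS]v2r_expand.
      have lp : linear (p i) := mli mp i.
      pose g : {linear E i -> V i} := HB.pack (p i) (GRing.isLinear.Build _ _ _ _ _ lp).
      rewrite -[p i]/(g : _ -> _) linear_sum; apply: eq_bigr => k _.
      by rewrite linearZ /= hb.
    move=> hh0; have hh i := cid (hh0 i); exists (fun i => sval (hh i)).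
    by split=> i; case: (svalP (hh i)).
  case: hs => ls ps; have lsi i : linear (s i) by exact: ls.
  have : forall i j, exists c : V i -> M i j -> W j, arrow Q i j ->
     forall v x, io j (c v x) = s j (rep_map v x) - rep_map (s i v) x.
    move=> i j; case ij : (arrow Q i j); last by exists (fun _ _ => 0).
    have : forall vx : V i * M i j, exists w, io j w = s j (rep_map vx.1 vx.2) - rep_map (s i vx.1) vx.2.
      move=> [v x]; apply/ex; rewrite (linear_sub (mli mp j)) ps (mor_map mp) // ps subrr //.
    by move=> /choice[c hc]; exists (fun v x => c (v, x)) => _ v x; rewrite hc.
  move=> hh0; have hh i j := cid (hh0 i j); pose c : cochain V W := fun i j => sval (hh i j).
  have hc i j (ij : arrow Q i j) v x : io j (c i j v x) = s j (rep_map v x) - rep_map (s i v) x.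
    exact: (svalP (hh i j)).
  have cc : cocycle c.
    move=> i j ij; have bE := rep_balanced E ij; have bV := rep_balanced V ij.
    split=> [u v x|v x y|v a x|v x b]; apply: (iio j).
    + rewrite (linear_add (mli mio j)) !hc // (balDl bV) !(linear_add (lsi _)) (balDl bE).
      by rewrite opprD addrACA.
    + rewrite (linear_add (mli mio j)) !hc // (balDr bV) !(linear_add (lsi _)) (balDr bE).
      by rewrite opprD addrACA.
    + by rewrite !hc // (bal_ract bV) (linear_ract (lsi _)) (bal_ract bE).
    + by rewrite (linear_ract (mli mio j)) !hc // (bal_bract bV) (linear_ract (lsi _)) (bal_bract bE) ractDl ractN.
  have [g [lg cg]] := h c cc.
  exists (fun i v => s i v - io i (g i v)); last first.
    move=> i v; rewrite (linear_sub (mli mp i)) ps.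
    have /ex -> : exists w, io i w = io i (g i v) by exists (g i v).
    by rewrite subr0.
  split=> [i a u v|i j ij v x].
    rewrite ls lg (mli mio i) scalerBr opprD addrACA //.
  have bE := rep_balanced E ij.
  have e := hc i j ij v x; rewrite cg // (linear_sub (mli mio j)) (mor_map mio) // in e.
  have -> : rep_map (s i v - io i (g i v)) x = rep_map (s i v) x - rep_map (io i (g i v)) x.
    by apply/(canRL (subrK _)); rewrite opprK -(balDl bE) subrK.
  move/(canRL (subrK _)): (e) => e2.
  have -> : s j (rep_map v x) = io j (g j (rep_map v x)) - rep_map (io i (g i v)) x + rep_map (s i v) x.
    by rewrite e2 addrK subrK.
  by rewrite addrC -addrA addKr addrC.
- have bE : forall i j, arrow Q i j -> @balanced _ _ _ ((W i * V i)%type : vectType (F i)^c) (M i j)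
     ((W j * V j)%type : vectType (F j)^c)
     (fun e x => (rep_map e.1 x + c i j e.2 x, rep_map e.2 x)).
    move=> i j ij; have bV := rep_balanced V ij; have bW := rep_balanced W ij; have b := hc i j ij.
    split=> [u v x|v x y|v a x|v x d] /=.
    + by rewrite (balDl bV) (balDl bW) (balDl b) /= addrACA.
    + by rewrite (balDr bV) (balDr bW) (balDr b) /= addrACA.
    + by rewrite (bal_ract bV) (bal_ract bW) (bal_ract b).
    + by rewrite (bal_bract bV) (bal_bract bW) (bal_bract b) -ractDl.
  pose E : rep Mod := Rep bE.
  have [|s ms ps] := h E (fun i w => (w, 0)) (fun i e => e.2).
    split.
    + split=> [i a u v|i j ij w x].
        by apply: injective_projections; rewrite /= ?scaler0 ?addr0.
      congr (_, _); last by rewrite /= (bal_0l x (rep_balanced V ij)).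
      by rewrite /= (bal_0l x (hc i j ij)) addr0.
    + by split.
    + by move=> i w w' [].
    + by move=> i v; exists (0, v).
    + by move=> i [w v]; split=> [/= ->|[w' [_ <-]]] //; exists w.
  exists (fun i v => (s i v).1); split=> [i a u v|i j ij v x].
    by rewrite (mli ms _).
  rewrite (mor_map ms) //=.
  by have -> : (s i v).2 = v by [exact: (ps i v)]; rewrite addrAC subrr add0r.
Qed.
End Y.

End HomExtDim.

(* Main.v *)
Require Import Defs.
From HB Require Import structures.
From mathcomp Require Import all_boot all_order all_algebra.
From mathcomp Require Import falgebra ring lra.
From mathcomp Require Import all_classical all_reals all_analysis.

(* Fix the direction v = (1, ..., 1), on which all roots are positive, and send the label of
   a point x to the product, in G(S), of the generators x(b) for the walls D(b) crossed by
   the ray from x - oo v to x at points where M_b is stable. Compartments are convex and, by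
   admissibility, meet no wall; crossing D(b) in the positive direction multiplies the label
   by x(b). So the point is that the label is constant along paths of points x whose rays
   meet only strata of codimension at most 2, and two generic points of a compartment are
   joined by two segments of such points.

   At a point y of codimension 2 at most two roots a, b of S are y-stable, <a, b> = 0 when
   a comes before b in the lateral order, and the roots c of S with y in D(c) are exactly
   those of S in Na + Nb: if M_c is semistable at y its stable submodules and quotients are
   exceptional, hence are in S, and the coefficients of c are recovered from the Euler form.
   On one side of y the ray crosses only D(a) and then D(b), on the other side it crosses
   all the D(c) in increasing order of slope; both products agree by the relation of the
   picture group.

   The representation theory needed is elementary: the Euler form hom - ext is a bilinear
   form in the dimension vectors, and maximal destabilizing submodules T of an exceptional
   module M satisfy Hom(T, M/T) = 0 and Ext(T, M) = 0. *)

Set Implicit Arguments.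
Unset Strict Implicit.
Unset Printing Implicit Defensive.
Import Order.TTheory GRing.Theory Num.Theory numFieldNormedType.Exports.
Import VectorInternalTheory HomExtDim.

(** * Linear algebra over a division algebra *)

(** If a label were defined by a chain of compartments, its independence of the chain would have to
    be proved; a product read off a ray is a definite element from the start, and only its local
    constancy is left to show. An obstacle is that [wall] tests subroots only, whereas kernels and
    images produce arbitrary submodules. The passage between the two rests on one fact: for a weight
    that is additive on dimension vectors and at most 0 on the submodules of a rigid M, a smallest
    nonzero submodule L of weight 0 is exceptional. Its endomorphisms are easy; its rigidity is not,
    since submodules do not inherit rigidity from M. Therefore L is first enlarged to a rigid
    submodule of M that has L at both ends, and Ext(L, L) = 0 follows from right exactness in both
    arguments. The geometry depends only on finitely many numbers, the levels at which a line meets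
    the hyperplanes of possible submodule dimensions; closeness and general position are conditions
    on the order of these numbers. *)

Section DivisionLinearAlgebra.
Local Open Scope classical_set_scope.
Local Open Scope ring_scope.

Lemma dim_rV (R : nzRingType) r : dim ('rV[R]_r : vectType R) = r.
Proof. exact: mul1n. Qed.

Variables (K : fieldType) (A : falgType K).

Lemma v2r_ractE (V : vectType A^c) (u v : V) (k : K) s :
  v2r (ract u k%:A + v) 0 s = k *: (v2r u 0 s : A) + (v2r v 0 s : A).
Proof.
rewrite /ract linearP !mxE.
by rewrite -[(_ * _ : A^c)]/((v2r u 0 s : A) * k%:A) -scalerAr mulr1.
Qed.

(** Dimensions are compared over K: in coordinates f is an injective K-linear map from A^(dim V) to
    A^(dim W), and dim A is positive because 1 <> 0 in A. *)
Lemma linear_inj_dim (V W : vectType A^c) (f : V -> W) :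
  linear f -> injective f -> (dim V <= dim W)%N.
Proof.
move=> lf fI.
pose vec (h : {ffun 'I_(dim V) -> A}) : V := r2v (\row_s (h s : A^c)).
pose G (h : {ffun 'I_(dim V) -> A}) : {ffun 'I_(dim W) -> A} :=
  [ffun t => v2r (f (vec h)) 0 t : A].
have vecP k h h' : vec (k *: h + h') = ract (vec h) k%:A + vec h'.
  apply: v2r_inj; apply/rowP => s; rewrite v2r_ractE /vec !r2vK !mxE.
  by rewrite !ffunE.
have lG : linear G.
  move=> k h h'; apply/ffunP => t; rewrite !ffunE vecP.
  by rewrite (linear_add lf) (linear_ract lf) v2r_ractE.
pose g : {linear _ -> _} := HB.pack G (GRing.isLinear.Build _ _ _ _ G lG).
have GI : injective g.
  move=> h h' /ffunP e; apply/ffunP => s.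
  have /fI/(congr1 v2r)/rowP/(_ s) : f (vec h) = f (vec h').
    by apply: v2r_inj; apply/rowP => t; have := e t; rewrite !ffunE.
  by rewrite /vec !r2vK !mxE.
have k0 : lker (linfun g) == 0%VS.
  by apply/lker0P => x y; rewrite !lfunE; exact: GI.
have := limg_dim_eq (f := linfun g) (U := fullv).
rewrite (eqP k0) capv0 => /(_ erefl) e.
have := dimvS (subvf (limg (linfun g))); rewrite e !dimvf /=.
rewrite -[dim {ffun 'I_(dim V) -> A}]/(#|'I_(dim V)| * dim A)%N.
rewrite -[dim {ffun 'I_(dim W) -> A}]/(#|'I_(dim W)| * dim A)%N.
rewrite !card_ord leq_pmul2r // -dimvf lt0n dimv_eq0.
apply/negP => /eqP z; have := memvf (1 : A); rewrite z memv0.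
by rewrite oner_eq0.
Qed.

Hypothesis AV : forall a : A, a != 0 -> a \is a GRing.unit.

(* The map f encodes a maximal family of vectors of U that is free modulo the image of h. *)
Lemma maximal_linear_inj (V : vectType A^c) (U : set V) s (h : 'rV[A^c]_s -> V) :
  linear h -> U 0 -> (forall a x y, U x -> U y -> U (a *: x + y)) ->
  injective h ->
  exists r (f : 'rV[A^c]_r -> V), [/\ linear f, forall w, U (f w),
    injective (fun z : 'rV[A^c]_r * 'rV[A^c]_s => f z.1 + h z.2) &
    forall u, U u -> exists z, u = f z.1 + h z.2].
Proof.
move=> lh U0 UD hI.
pose P r := `[< exists f : 'rV[A^c]_r -> V, [/\ linear f, forall w, U (f w) &
    injective (fun z : 'rV[A^c]_r * 'rV[A^c]_s => f z.1 + h z.2)] >].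
have P0 : exists r, P r.
  exists 0%N; apply/asboolP; exists (fun _ => 0); split=> //.
    by move=> a x y; rewrite scaler0 addr0.
  by move=> [x y] [x' y'] /=; rewrite !add0r => /hI ->; rewrite (thinmx0 x) (thinmx0 x').
have Pb r : P r -> (r <= dim V)%N.
  move=> /asboolP[f [lf _ fI]].
  have := @linear_inj_dim 'rV[A^c]_r V f lf; rewrite dim_rV; apply.
  move=> x y e; have := fI (x, 0) (y, 0); rewrite /= (linear_0 lh) !addr0.
  by move=> /(_ e) [].
case: (ex_maxnP P0 Pb) => r /asboolP[f [lf fU fI]] rmax.
exists r, f; split=> // u Uu; apply: contrapT => nu.
suff : P (1 + r)%N by move=> /rmax; rewrite add1n ltnn.
apply/asboolP.
exists (fun w : 'rV[A^c]_(1 + r) => (lsubmx w 0 0) *: u + f (rsubmx w)); split.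
- move=> a x y; rewrite linearP (linearP rsubmx) lf mxE [in LHS]mxE scalerDl.
  by rewrite scalerDr scalerA -!addrA; congr (_ + _); rewrite addrCA.
- by move=> w; apply: UD.
move=> [w z] [w' z'] /= e.
pose c : A^c := lsubmx w 0 0 - lsubmx w' 0 0.
have e2 : c *: u = f (rsubmx w' - rsubmx w) + h (z' - z).
  rewrite /c scalerBl (linear_sub lf) (linear_sub lh) addrACA -opprD.
  apply/eqP; rewrite subr_eq eq_sym [X in X == _]addrAC subr_eq.
  by rewrite [X in X == _]addrC !addrA -e.
have c0 : c = 0.
  apply: contrapT => /eqP cn; apply: nu.
  have cu : (c : A) \is a GRing.unit by apply: AV.
  exists (((c : A)^-1 : A^c) *: (rsubmx w' - rsubmx w), ((c : A)^-1 : A^c) *: (z' - z)) => /=.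
  rewrite -[_ *: (rsubmx w' - _)]addr0 lf (linear_0 lf) addr0.
  rewrite -[_ *: (z' - z)]addr0 lh (linear_0 lh) addr0 -scalerDr -e2 scalerA.
  by rewrite -[(_ * c : A^c)]/((c : A) * (c : A)^-1) divrr // scale1r.
move: e2; rewrite c0 scale0r => /esym e2.
have [/eqP w0 /eqP z0] : rsubmx w' - rsubmx w = 0 /\ z' - z = 0.
  have := fI (rsubmx w' - rsubmx w, z' - z) (0, 0).
  by rewrite /= e2 (linear_0 lf) (linear_0 lh) addr0 => /(_ erefl) [-> ->].
rewrite subr_eq0 in w0; rewrite subr_eq0 in z0; rewrite (eqP z0); congr (_, _).
rewrite -[w]hsubmxK -[w']hsubmxK (eqP w0); congr row_mx.
by apply/rowP => i; rewrite ord1; apply/eqP; rewrite -subr_eq0; apply/eqP.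
Qed.

(** Inclusion and projection come with a retraction and a section, so that the subspace and its
    quotient are both carried by row spaces and structure maps can be transported by formulas. *)
Record splitting (V : vectType A^c) (U : set V) := Splitting {
  spl_sub : nat;
  spl_quot : nat;
  spl_in : 'rV[A^c]_spl_sub -> V;
  spl_retr : V -> 'rV[A^c]_spl_sub;
  spl_sect : 'rV[A^c]_spl_quot -> V;
  spl_proj : V -> 'rV[A^c]_spl_quot;
  spl_in_linear : linear spl_in;
  spl_retr_linear : linear spl_retr;
  spl_sect_linear : linear spl_sect;
  spl_proj_linear : linear spl_proj;
  spl_inK : cancel spl_in spl_retr;
  spl_sectK : cancel spl_sect spl_proj;
  spl_sum : forall v, spl_in (spl_retr v) + spl_sect (spl_proj v) = v;
  spl_projP : forall v, U v <-> spl_proj v = 0 }.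

(** A maximal free family of U is completed in V: [maximal_linear_inj] is applied to U with [s = 0],
    then to the whole space on top of the result. *)
Lemma subspace_split (V : vectType A^c) (U : set V) :
  U 0 -> (forall a x y, U x -> U y -> U (a *: x + y)) ->
  exists _ : splitting U, True.
Proof.
move=> U0 UD.
have [r [f [lf fU fI fS]]] := @maximal_linear_inj V U 0 (fun _ => 0)
  (fun a x y => esym (etrans (congr1 (+%R^~ 0) (scaler0 _ a)) (addr0 _))) U0 UD
  (fun x y _ => etrans (thinmx0 x) (esym (thinmx0 y))).
have fI' : injective f.
  by move=> x y e; have := fI (x, 0) (y, 0); rewrite /= e => /(_ erefl) [].
have [s [g [lg _ gI gS]]] := @maximal_linear_inj V setT r f lf I
  (fun _ _ _ _ _ => I) fI'.
have /choice[q hq] : forall v, exists z, v = g z.1 + f z.2.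
  by move=> v; exact: gS.
have qK z : q (g z.1 + f z.2) = z by apply: gI; rewrite -hq.
have lq a x y : q (a *: x + y) = a *: q x + q y.
  apply: gI; rewrite -hq /= lf lg {1}(hq x) {1}(hq y) scalerDr.
  by rewrite -!addrA; congr (_ + _); rewrite addrCA.
have qf w : q (f w) = (0, w).
  by rewrite -[f w]add0r -(linear_0 lg); exact: (qK (0, w)).
have qg w : q (g w) = (w, 0).
  by rewrite -[g w]addr0 -(linear_0 lf); exact: (qK (w, 0)).
unshelve eexists; last by [].
apply: (@Splitting _ U r s f (fun v => (q v).2) g (fun v => (q v).1)) => //.
- by move=> a x y; rewrite lq.
- by move=> a x y; rewrite lq.
- by move=> w; rewrite qf.
- by move=> w; rewrite qg.
- by move=> v; rewrite addrC -hq.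
- move=> v; split=> [/fS[z]|e]; first by rewrite addr0 => ->; rewrite qf.
  by rewrite (hq v) e (linear_0 lg) add0r.
Qed.

End DivisionLinearAlgebra.

(** * Representations: exact sequences, Hom and Ext *)

Section ExactSequences.
Local Open Scope classical_set_scope.
Local Open Scope ring_scope.
Variables (K : fieldType) (n : nat) (Q : valued_quiver n) (Mod : modulation K Q).
Local Notation F := (mod_alg Mod).
Local Notation rep := (rep Mod).
Implicit Types V W X Y M N T I E : rep.

Lemma linear_section (A : falgType K) (V W : vectType A^c) (p : V -> W) :
  linear p -> (forall w, exists v, p v = w) ->
  exists s : W -> V, linear s /\ cancel s p.
Proof.
move=> lp /choice[b hb].
exists (fun v => \sum_s ract (b (r2v (delta_mx 0 s))) (v2r v 0 s : A)); split.
  move=> a u v; rewrite scaler_sumr -big_split /=; apply: eq_bigr => k _.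
  by rewrite linearP !mxE /ract scalerDl scalerA.
move=> v; rewrite [RHS]v2r_expand.
pose g : {linear V -> W} := HB.pack p (GRing.isLinear.Build _ _ _ _ _ lp).
rewrite -[p]/(g : _ -> _) linear_sum; apply: eq_bigr => k _.
by rewrite linearZ /= hb.
Qed.

Lemma linear_retraction (A : falgType K) (V W : vectType A^c) (f : V -> W) :
  (forall a : A, a != 0 -> a \is a GRing.unit) ->
  linear f -> injective f -> exists r : W -> V, linear r /\ cancel f r.
Proof.
move=> AV lf fI.
have [||[d e h rho g p lh lrho lg lp hK gK hg Up] _] :=
  subspace_split AV (U := [set w | exists v, f v = w]).
- by exists 0; rewrite (linear_0 lf).
- by move=> a _ _ [v <-] [v' <-]; exists (a *: v + v'); rewrite lf.
have /choice[r hr] : forall w, exists v, f v = h (rho w).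
  move=> w; apply/Up; rewrite -[LHS]gK; set z := h _.
  have : z + g (p z) = z + 0 by rewrite -{3}(hg z) /z hK addr0.
  by move=> /addrI ->; rewrite (linear_0 lp).
exists r; split=> [a x y|v]; apply: fI.
  by rewrite hr lf !hr lrho lh.
rewrite hr -[RHS]hg; have -> : p (f v) = 0 by apply/Up; exists v.
by rewrite (linear_0 lg) addr0.
Qed.

Lemma mor_lin V W (f : forall i, V i -> W i) : morphism f -> forall i, linear (f i).
Proof. by case. Qed.


Local Arguments mor_lin [V W f] mf i : rename.

Lemma morphism_id V : morphism (fun i => @id (V i)).
Proof. by split. Qed.

Lemma morphism_comp V W X (f : forall i, V i -> W i) (g : forall i, W i -> X i) :
  morphism f -> morphism g -> morphism (fun i v => g i (f i v)).
Proof.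
move=> mf mg; split=> [i a u v|i j ij v x].
  by rewrite (mor_lin mf) (mor_lin mg).
by rewrite (mor_map mf) // (mor_map mg).
Qed.

Lemma morphism_factor_inj V W X (g : forall i, X i -> W i) (j : forall i, V i -> W i) :
  morphism g -> morphism j -> (forall i, injective (j i)) ->
  (forall i x, exists v, j i v = g i x) ->
  exists2 h : (forall i, X i -> V i), morphism h & forall i x, j i (h i x) = g i x.
Proof.
move=> mg mj jI hj; have hh i := choice (hj i).
have hE i x : j i (projT1 (hh i) x) = g i x by exact: (projT2 (hh i)).
exists (fun i => projT1 (hh i)) => //; split=> [i a u v|i k ik v x].
  by apply: jI; rewrite hE (mor_lin mj) !hE (mor_lin mg).
by apply: jI; rewrite hE (mor_map mj) // hE (mor_map mg).
Qed.

Lemma morphism_factor_surj V W X (q : forall i, V i -> W i) (g : forall i, V i -> X i) :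
  morphism q -> morphism g -> (forall i w, exists v, q i v = w) ->
  (forall i v, q i v = 0 -> g i v = 0) ->
  exists2 h : (forall i, W i -> X i), morphism h & forall i v, h i (q i v) = g i v.
Proof.
move=> mq mg qS hq; have hh i := choice (qS i).
pose h i w := g i (projT1 (hh i) w).
have sE i w : q i (projT1 (hh i) w) = w by exact: (projT2 (hh i)).
have hE i v : h i (q i v) = g i v.
  apply/eqP; rewrite -subr_eq0 -(linear_sub (mor_lin mg i)); apply/eqP/hq.
  by rewrite (linear_sub (mor_lin mq i)) sE subrr.
exists h => //; split=> [i a u v|i k ik v x].
  rewrite -[u](sE i) -[v](sE i) -(mor_lin mq i) !hE; exact: (mor_lin mg i).
by rewrite -[v](sE i) -(mor_map mq) // !hE (mor_map mg).
Qed.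

Lemma morphism_bij_inv V W (f : forall i, V i -> W i) :
  morphism f -> (forall i, injective (f i)) -> (forall i w, exists v, f i v = w) ->
  exists2 g : (forall i, W i -> V i), morphism g &
    forall i, cancel (f i) (g i) /\ cancel (g i) (f i).
Proof.
move=> mf fI fS.
have [g mg gE] := morphism_factor_inj (morphism_id W) mf fI fS.
by exists g => // i; split=> [v|w] //; apply: (fI i); rewrite gE.
Qed.

Lemma morphism_injP V W (f : forall i, V i -> W i) : morphism f ->
  (forall i v, f i v = 0 -> v = 0) -> forall i, injective (f i).
Proof.
move=> mf h i u v e; apply/eqP; rewrite -subr_eq0; apply/eqP/h.
by rewrite (linear_sub (mor_lin mf i)) e subrr.
Qed.

Lemma mor0 V W (f : forall i, V i -> W i) : morphism f -> forall i, f i 0 = 0.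
Proof. by move=> mf i; rewrite (linear_0 (mor_lin mf i)). Qed.

Lemma short_exact_dimvec V W E (io : forall i, W i -> E i) (p : forall i, E i -> V i) :
  short_exact io p -> dimvec E = dimvec W + dimvec V.
Proof.
move=> [mio mp iI pS ex]; apply/rowP => i; rewrite !mxE.
have [s [ls sK]] := linear_section (mor_lin mp i) (pS i).
have pio w : p i (io i w) = 0 by apply/ex; exists w.
pose f (z : W i * V i) : E i := io i z.1 + s z.2.
have lf : linear f.
  move=> a u v; rewrite /f /= (mor_lin mio i) ls scalerDr -!addrA; congr (_ + _).
  by rewrite addrCA.
have fI : injective f.
  move=> [u v] [u' v'] e.
  have /= e2 := congr1 (p i) e; rewrite /f !(linear_add (mor_lin mp i)) !pio /= !sK !add0r in e2.
  move: e; rewrite /f /= e2 => /addIr/iI -> //.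
have fS e : exists z, f z = e.
  have /ex[w hw] : p i (e - s (p i e)) = 0 by rewrite (linear_sub (mor_lin mp i)) sK subrr.
  by exists (w, p i e); rewrite /f /= hw subrK.
have [g [lg gK]] := linear_section lf fS.
apply/eqP; rewrite eqn_leq.
rewrite (linear_inj_dim lg (can_inj gK)).
by have := linear_inj_dim lf fI; apply.
Qed.

(** Sub and quotient representations are built here on row spaces; [kernel_image], [cokernel] and
    [pullback] are instances for a suitable U. *)
Lemma subrep_exact M (U : forall i, set (M i)) :
  (forall i, U i 0) -> (forall i a x y, U i x -> U i y -> U i (a *: x + y)) ->
  (forall i j, arrow Q i j -> forall v (x : mod_bim Mod i j), U i v -> U j (rep_map v x)) ->
  exists N T (io : forall i, N i -> M i) (p : forall i, M i -> T i),
    short_exact io p /\ forall i m, U i m <-> p i m = 0.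
Proof.
move=> U0 UD UM.
have spl i : splitting (U i).
  by have [h _] := cid (subspace_split (@mod_algV _ _ _ Mod i) (U0 i) (UD i)).
pose r i := spl_sub (spl i); pose s i := spl_quot (spl i).
pose f i : 'rV[(F i)^c]_(r i) -> M i := @spl_in _ _ _ _ (spl i).
pose rho i : M i -> 'rV[(F i)^c]_(r i) := @spl_retr _ _ _ _ (spl i).
pose g i : 'rV[(F i)^c]_(s i) -> M i := @spl_sect _ _ _ _ (spl i).
pose p i : M i -> 'rV[(F i)^c]_(s i) := @spl_proj _ _ _ _ (spl i).
have lf i : linear (f i) := @spl_in_linear _ _ _ _ (spl i).
have lrho i : linear (rho i) := @spl_retr_linear _ _ _ _ (spl i).
have lg i : linear (g i) := @spl_sect_linear _ _ _ _ (spl i).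
have lp i : linear (p i) := @spl_proj_linear _ _ _ _ (spl i).
have fK i : cancel (f i) (rho i) := @spl_inK _ _ _ _ (spl i).
have gK i : cancel (g i) (p i) := @spl_sectK _ _ _ _ (spl i).
have fg i v : f i (rho i v) + g i (p i v) = v := @spl_sum _ _ _ _ (spl i) v.
have Up i v : U i v <-> p i v = 0 := @spl_projP _ _ _ _ (spl i) v.
have pf i w : p i (f i w) = 0.
  rewrite -[LHS]gK; have : f i w + g i (p i (f i w)) = f i w + 0.
    by rewrite -{3}(fg i (f i w)) fK addr0.
  by move=> /addrI ->; rewrite (linear_0 (lp i)).
have Uf i w : U i (f i w) by apply/Up.
have fU i v : U i v -> f i (rho i v) = v.
  by move=> /Up e; rewrite -[RHS]fg e (linear_0 (lg i)) addr0.
have bN i j : arrow Q i j -> balanced (fun (w : 'rV[(F i)^c]_(r i)) (x : mod_bim Mod i j) =>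
    rho j (rep_map (f i w) x) : 'rV[(F j)^c]_(r j)).
  move=> ij; have b := rep_balanced M ij; split=> [u v x|v x y|v a x|v x a].
  - by rewrite (linear_add (lf i)) (balDl b) (linear_add (lrho j)).
  - by rewrite (balDr b) (linear_add (lrho j)).
  - by rewrite (linear_ract (lf i)) (bal_ract b).
  - by rewrite (bal_bract b) (linear_ract (lrho j)).
have bT i j : arrow Q i j -> balanced (fun (w : 'rV[(F i)^c]_(s i)) (x : mod_bim Mod i j) =>
    p j (rep_map (g i w) x) : 'rV[(F j)^c]_(s j)).
  move=> ij; have b := rep_balanced M ij; split=> [u v x|v x y|v a x|v x a].
  - by rewrite (linear_add (lg i)) (balDl b) (linear_add (lp j)).
  - by rewrite (balDr b) (linear_add (lp j)).
  - by rewrite (linear_ract (lg i)) (bal_ract b).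
  - by rewrite (bal_bract b) (linear_ract (lp j)).
exists (Rep bN), (Rep bT), f, p; split=> //; split.
- split=> // i j ij v x /=; rewrite fU //; exact: UM.
- split=> // i j ij v x /=; rewrite -{1}(fg i v) (balDl (rep_balanced M ij)).
  by rewrite (linear_add (lp j)) [X in X + _](_ : _ = 0) ?add0r //; apply/Up/UM.
- by move=> i; exact: can_inj (fK i).
- by move=> i v; exists (g i v); exact: gK.
- move=> i e; split=> [/Up/fU h|[w <-]]; last exact: pf.
  by exists (rho i e).
Qed.

Lemma kernel_image T X (f : forall i, T i -> X i) : morphism f ->
  exists N I (k : forall i, N i -> T i) (q : forall i, T i -> I i)
    (j : forall i, I i -> X i),
    [/\ short_exact k q, morphism j, forall i, injective (j i) &
        forall i t, j i (q i t) = f i t].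
Proof.
move=> mf.
have [|||N [I [k [q [kq kerq]]]]] := @subrep_exact T (fun i => [set t | f i t = 0]).
- by move=> i; exact: mor0.
- by move=> i a x y /= e e'; rewrite (mor_lin mf) e e' scaler0 addr0.
- move=> i j ij v x /= e; rewrite (mor_map mf) // e.
  exact: bal_0l (rep_balanced X ij).
have [mk mq kI qS ex] := kq.
have [|j mj jE] := morphism_factor_surj mq mf qS.
  by move=> i v /kerq.
exists N, I, k, q, j; split=> //; apply: morphism_injP => // i v.
by have [t <-] := qS i v; rewrite jE => /kerq.
Qed.

Lemma cokernel T M (f : forall i, T i -> M i) : morphism f ->
  (forall i, injective (f i)) ->
  exists X (p : forall i, M i -> X i), short_exact f p.
Proof.
move=> mf fI.
have [|||N [X [k [p [[mk mp kI pS ex] kerp]]]]] :=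
  @subrep_exact M (fun i => [set m | exists t, f i t = m]).
- by move=> i; exists 0; exact: mor0.
- by move=> i a _ _ [t <-] [t' <-]; exists (a *: t + t'); rewrite (mor_lin mf).
- by move=> i j ij _ x [t <-]; exists (rep_map t x); rewrite (mor_map mf).
by exists X, p; split=> // i e; split=> /kerp.
Qed.

(** N is the preimage of I in M, an extension of I by T. *)
Lemma pullback T M X I (io : forall i, T i -> M i) (p : forall i, M i -> X i)
    (j : forall i, I i -> X i) : short_exact io p -> morphism j ->
  (forall i, injective (j i)) ->
  exists N (k : forall i, T i -> N i) (b : forall i, N i -> I i) (a : forall i, N i -> M i),
  [/\ short_exact k b, morphism a, forall i, injective (a i),
      forall i t, a i (k i t) = io i t &
      forall i x, p i (a i x) = j i (b i x)] /\
  forall i m, (exists x, a i x = m) <-> (exists y, j i y = p i m).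
Proof.
move=> [mio mp ioI pS ex] mj jI.
have [|||N [Y [a [q [[ma mq aI qS exa] Uq]]]]] :=
  @subrep_exact M (fun i => [set m | exists y, j i y = p i m]).
- by move=> i; exists 0; rewrite (mor0 mj) (mor0 mp).
- move=> i c x y [u hu] [v hv]; exists (c *: u + v).
  by rewrite (mor_lin mj) hu hv (mor_lin mp).
- move=> i k ik v x [u hu]; exists (rep_map u x).
  by rewrite (mor_map mj) // hu (mor_map mp).
have im i m : (exists x, a i x = m) <-> (exists y, j i y = p i m).
  by split=> [/exa/Uq|/Uq/exa].
have [|b mb bE] := morphism_factor_inj (morphism_comp ma mp) mj jI.
  by move=> i x; apply/im; exists x.
have [|k mk kE] := morphism_factor_inj mio ma aI.
  move=> i t; apply/im; exists 0; rewrite (mor0 mj).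
  by apply/esym/ex; exists t.
exists N, k, b, a; split=> //; split=> //; split=> //.
- by move=> i x y e; apply: (ioI i); rewrite -!kE e.
- move=> i y; have [m hm] := pS i (j i y).
  have /im[x hx] : exists y, j i y = p i m by exists y.
  by exists x; apply: (jI i); rewrite bE hx hm.
- move=> i x; split=> [e|[t <-]].
    have /ex[t ht] : p i (a i x) = 0 by rewrite -bE e (mor0 mj).
    by exists t; apply: (aI i); rewrite kE.
  apply: (jI i); rewrite bE kE (mor0 mj); apply/ex; by exists t.
Qed.

Lemma dim_eq0 (A : nzRingType) (V : vectType A) (v : V) : dim V = 0%N -> v = 0.
Proof.
move=> d; apply: v2r_inj; apply/rowP => s.
by have := ltn_ord s; rewrite [X in (_ < X)%N]d.
Qed.

Lemma dimvec_cancel (a b : 'rV[nat]_n) : a = a + b -> b = 0.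
Proof.
move=> /rowP e; apply/rowP => i; have := e i; rewrite !mxE -[LHS]addn0.
by move=> /addnI.
Qed.

Lemma dimvec_inj_surj V W (f : forall i, V i -> W i) : morphism f ->
  (forall i, injective (f i)) -> dimvec V = dimvec W ->
  forall i w, exists v, f i v = w.
Proof.
move=> mf fI e.
have [X [p fp]] := cokernel mf fI; have := short_exact_dimvec fp.
rewrite e => /dimvec_cancel/rowP X0 i w.
case: fp => _ mp _ _ ex; apply/ex/dim_eq0.
by have := X0 i; rewrite !mxE.
Qed.

Lemma dimvec_surj_inj V W (f : forall i, V i -> W i) : morphism f ->
  (forall i w, exists v, f i v = w) -> dimvec V = dimvec W ->
  forall i, injective (f i).
Proof.
move=> mf fS e.
have [N [I [k [q [j [kq mj jI jE]]]]]] := kernel_image mf.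
have jS i w : exists x, j i x = w.
  by have [v <-] := fS i w; exists (q i v); rewrite jE.
have [g mg gK] := morphism_bij_inv mj jI jS.
have d1 : dimvec I = dimvec W.
  apply/rowP => i; rewrite !mxE; apply/eqP; rewrite eqn_leq.
  rewrite (linear_inj_dim (mor_lin mj i) (jI i)).
  by rewrite (linear_inj_dim (mor_lin mg i) (can_inj (gK i).2)).
have /rowP X0 : dimvec N = 0.
  by have := short_exact_dimvec kq; rewrite e d1 addrC => /dimvec_cancel.
apply: morphism_injP => // i v; rewrite -jE -(mor0 mj i) => /jI.
case: kq => mk _ kI _ ex /ex[w <-]; rewrite -(mor0 mk i); congr (k i _).
apply: dim_eq0.
by have := X0 i; rewrite !mxE.
Qed.

Lemma dimvec0P V : dimvec V = 0 <-> forall i (v : V i), v = 0.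
Proof.
split=> [/rowP e i v|e].
  by apply: dim_eq0; have := e i; rewrite !mxE.
apply/rowP => i; rewrite !mxE.
case d: (dim (V i)) => [//|d'].
have s : 'I_(dim (V i)) by rewrite d; exact: ord0.
have := e i (r2v (delta_mx 0 s)) => /(congr1 v2r)/rowP/(_ s).
by rewrite r2vK linear0 !mxE !eqxx => /eqP; rewrite oner_eq0.
Qed.

End ExactSequences.

Arguments mor_lin {K n Q Mod V W f} mf i : rename.

(** * Vanishing of Hom and Ext *)

Section HomExt.
Local Open Scope classical_set_scope.
Local Open Scope ring_scope.
Variables (K : fieldType) (n : nat) (Q : valued_quiver n) (Mod : modulation K Q).
Local Notation F := (mod_alg Mod).
Local Notation rep := (rep Mod).
Implicit Types V W X Y M N T I E L : rep.

Definition hom0 V W := forall f : (forall i, V i -> W i), morphism f ->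
  forall i v, f i v = 0.

Definition ext0 V W := forall c : cochain V W, cocycle c -> coboundary c.

Lemma hom0_projects V W X : projects V W -> hom0 V X -> hom0 W X.
Proof.
move=> [q mq qS] h0 f mf i w; have [v <-] := qS i w.
exact: (h0 _ (morphism_comp mq mf)).
Qed.

Lemma hom0_embeds V W X : embeds V W -> hom0 X W -> hom0 X V.
Proof.
move=> [j mj jI] h0 f mf i w; apply: (jI i); rewrite (mor0 mj).
exact: (h0 _ (morphism_comp mf mj)).
Qed.

Lemma embeds_refl V : embeds V V.
Proof. by exists (fun i => @id (V i)); [exact: morphism_id|move=> i u v]. Qed.

Lemma embeds_trans V W X : embeds V W -> embeds W X -> embeds V X.
Proof.
move=> [f mf fI] [g mg gI]; exists (fun i v => g i (f i v)).
  exact: morphism_comp.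
by move=> i; apply: inj_comp.
Qed.

Lemma projects_refl V : projects V V.
Proof. by exists (fun i => @id (V i)); [exact: morphism_id|move=> i w; exists w]. Qed.

Lemma projects_trans V W X : projects V W -> projects W X -> projects V X.
Proof.
move=> [f mf fS] [g mg gS]; exists (fun i v => g i (f i v)).
  exact: morphism_comp.
by move=> i x; have [w <-] := gS i x; have [v <-] := fS i w; exists v.
Qed.

Lemma short_exact_embeds V W E io p : @short_exact _ _ _ _ V W E io p -> embeds W E.
Proof. by case=> mio _ iI _ _; exists io. Qed.

Lemma short_exact_projects V W E io p : @short_exact _ _ _ _ V W E io p -> projects E V.
Proof. by case=> _ mp _ pS _; exists p. Qed.

(** Being balanced is the only condition on a cocycle, so a cocycle on N extends to M along linear
    retractions at the vertices. This is the right exactness of Ext over a hereditary algebra. *)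
Lemma ext0_embeds N M X : embeds N M -> ext0 M X -> ext0 N X.
Proof.
move=> [io mio ioI] e0 c cc.
have r0 i : exists r : M i -> N i, linear r /\ cancel (io i) r.
  exact (linear_retraction (@mod_algV _ _ _ Mod i) (mor_lin mio i) (ioI i)).
pose r i := sval (cid (r0 i)).
have rl i : linear (r i) by case: (svalP (cid (r0 i))).
have rK i : cancel (io i) (r i) by case: (svalP (cid (r0 i))).
have [|h [lh hE]] := e0 (fun i j m x => c i j (r i m) x).
  move=> i j ij; have b := cc i j ij; split=> [u v x|v x y|v a x|v x a].
  - by rewrite (linear_add (rl i)) (balDl b).
  - by rewrite (balDr b).
  - by rewrite (linear_ract (rl i)) (bal_ract b).
  - by rewrite (bal_bract b).
exists (fun i v => h i (io i v)); split=> [i a u v|i j ij v x].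
  by rewrite (mor_lin mio) lh.
by rewrite (mor_map mio) // -hE // rK.
Qed.

(** Dually, a cocycle with values in T lifts to M along linear sections at the vertices. *)
Lemma ext0_projects X M T : projects M T -> ext0 X M -> ext0 X T.
Proof.
move=> [p mp pS] e0 c cc.
have s0 i : exists s : T i -> M i, linear s /\ cancel s (p i).
  exact: linear_section (mor_lin mp i) (pS i).
pose s i := sval (cid (s0 i)).
have sl i : linear (s i) by case: (svalP (cid (s0 i))).
have sK i : cancel (s i) (p i) by case: (svalP (cid (s0 i))).
have [|h [lh hE]] := e0 (fun i j v x => s j (c i j v x)).
  move=> i j ij; have b := cc i j ij; split=> [u v x|v x y|v a x|v x a].
  - by rewrite (balDl b) (linear_add (sl j)).
  - by rewrite (balDr b) (linear_add (sl j)).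
  - by rewrite (bal_ract b).
  - by rewrite (bal_bract b) (linear_ract (sl j)).
exists (fun i v => p i (h i v)); split=> [i a u v|i j ij v x].
  by rewrite lh (mor_lin mp).
rewrite -(mor_map mp) // -(linear_sub (mor_lin mp j)) -hE //.
by rewrite sK.
Qed.

(** Exactness of Hom(N, T) -> Ext(N, N) -> Ext(N, M): a family h that bounds the cocycle in M
    becomes a morphism N -> T after p, which is 0, so h takes its values in N. *)
Lemma ext0_self_sub T N M io p : @short_exact _ _ _ _ T N M io p ->
  hom0 N T -> ext0 N M -> ext0 N N.
Proof.
move=> [mio mp ioI pS ex] h0 e0 c cc.
have [|h [lh hE]] := e0 (fun i j v x => io j (c i j v x)).
  move=> i j ij; have b := cc i j ij; split=> [u v x|v x y|v a x|v x a].
  - by rewrite (balDl b) (linear_add (mor_lin mio j)).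
  - by rewrite (balDr b) (linear_add (mor_lin mio j)).
  - by rewrite (bal_ract b).
  - by rewrite (bal_bract b) (linear_ract (mor_lin mio j)).
have ph0 : forall i v, p i (h i v) = 0.
  apply: (h0 (fun i v => p i (h i v))); split=> [i a u v|i j ij v x].
    by rewrite lh (mor_lin mp).
  rewrite -(mor_map mp) //; apply/eqP; rewrite -subr_eq0.
  rewrite -(linear_sub (mor_lin mp j)) -hE //.
  by apply/eqP/ex; exists (c i j v x).
have hh i v : exists w, io i w = h i v by apply/ex.
have g i := choice (hh i).
have gE i v : io i (projT1 (g i) v) = h i v by exact: (projT2 (g i)).
exists (fun i => projT1 (g i)); split=> [i a u v|i j ij v x]; apply: ioI.
  by rewrite gE (mor_lin mio) !gE lh.
by rewrite (linear_sub (mor_lin mio j)) (mor_map mio) // !gE -hE.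
Qed.

(** Exactness of Hom(N, T) -> Ext(T, T) -> Ext(M, T): the bounding family vanishes on N and descends
    to T. *)
Lemma ext0_self_quot T N M io p : @short_exact _ _ _ _ T N M io p ->
  hom0 N T -> ext0 M T -> ext0 T T.
Proof.
move=> [mio mp ioI pS ex] h0 e0 c cc.
have [|h [lh hE]] := e0 (fun i j v x => c i j (p i v) x).
  move=> i j ij; have b := cc i j ij; split=> [u v x|v x y|v a x|v x a].
  - by rewrite (linear_add (mor_lin mp i)) (balDl b).
  - by rewrite (balDr b).
  - by rewrite (linear_ract (mor_lin mp i)) (bal_ract b).
  - by rewrite (bal_bract b).
have hio : forall i v, h i (io i v) = 0.
  apply: (h0 (fun i v => h i (io i v))); split=> [i a u v|i j ij v x].
    by rewrite (mor_lin mio) lh.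
  rewrite (mor_map mio) //; apply/eqP; rewrite -subr_eq0 -hE //.
  have -> : p i (io i v) = 0 by apply/ex; exists v.
  by apply/eqP/(bal_0l x (cc i j ij)).
have g i := choice (pS i).
have pg i w : p i (projT1 (g i) w) = w by exact: (projT2 (g i)).
pose k i w := h i (projT1 (g i) w).
have kE i v : k i (p i v) = h i v.
  apply/eqP; rewrite -subr_eq0 -(linear_sub (lh i)).
  have [w <-] : exists w, io i w = projT1 (g i) (p i v) - v.
    by apply/ex; rewrite (linear_sub (mor_lin mp i)) pg subrr.
  by rewrite hio.
exists k; split=> [i a u v|i j ij v x].
  by rewrite -{1}[u](pg i) -{1}[v](pg i) -(mor_lin mp i) kE lh.
rewrite -[v](pg i) -(mor_map mp) // !kE -hE //.
Qed.

Lemma ext0P V W : ext_dim V W = 0%N <-> ext0 V W.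
Proof. exact: ext_dim_eq0. Qed.

Lemma ext0_split V W E io p : ext0 V W -> @short_exact _ _ _ _ V W E io p ->
  exists2 s : (forall i, V i -> E i), morphism s & forall i, cancel (s i) (p i).
Proof. by move=> /ext0P/ext_dim_eq0_split; apply. Qed.

Lemma division_end_inj V (f : forall i, V i -> V i) : division_end V ->
  morphism f -> ~ (forall i v, f i v = 0) -> forall i, injective (f i).
Proof.
move=> [_ dV] mf nf; have [|g _ gK] := dV f mf; last by move=> i; exact: can_inj (gK i).1.
apply: contrapT => h; apply: nf => i v; apply: contrapT => /eqP e; apply: h.
by exists i, v.
Qed.

Lemma division_end_neq0 V : division_end V -> dimvec V <> 0.
Proof. by move=> [[i [v v0]] _] /dimvec0P e; move: v0; rewrite (e i v) eqxx. Qed.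

(** Source and target have the same dimension vector, so an endomorphism with either property is
    bijective. *)
Lemma division_endP V : dimvec V <> 0 ->
  (forall f : (forall i, V i -> V i), morphism f -> ~ (forall i v, f i v = 0) ->
    (forall i, injective (f i)) \/ (forall i w, exists v, f i v = w)) ->
  division_end V.
Proof.
move=> V0 H; split.
  apply: contrapT => h; apply/V0/dimvec0P => i v; apply: contrapT => /eqP v0.
  by apply: h; exists i, v.
move=> f mf [i [v fv]]; apply: morphism_bij_inv => //.
  have [|//|] := H f mf; first by move=> e; rewrite e eqxx in fv.
  by move=> fS; apply: dimvec_surj_inj.
have [||//] := H f mf; first by move=> e; rewrite e eqxx in fv.
by move=> fI; apply: dimvec_inj_surj.
Qed.

Lemma exceptionalP V : exceptional V <-> division_end V /\ ext0 V V.
Proof. by split=> [[? /ext0P]|[? /ext0P]]. Qed.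

End HomExt.

(** * Stable submodules and quotients of rigid modules are exceptional *)

Lemma ex_argmin (T : Type) (P : T -> Prop) (f : T -> nat) : (exists x, P x) ->
  exists x, P x /\ forall y, P y -> (f x <= f y)%N.
Proof.
move=> [x Px].
have ex : exists k, (fun k => `[< exists x, P x /\ f x = k >]) k.
  by exists (f x); apply/asboolP; exists x.
case: (ex_minnP ex) => k /asboolP[y [Py fy]] kmin.
exists y; split=> // z Pz; rewrite fy; apply: kmin.
by apply/asboolP; exists z.
Qed.

Lemma ex_argmax (T : Type) (P : T -> Prop) (f : T -> nat) b : (exists x, P x) ->
  (forall x, P x -> (f x <= b)%N) ->
  exists x, P x /\ forall y, P y -> (f y <= f x)%N.
Proof.
move=> exP fb.
have [x [Px h]] := @ex_argmin T P (fun x => b - f x)%N exP.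
by exists x; split=> // y Py; have := h y Py; rewrite leq_sub2lE // fb.
Qed.

Section ExceptionalFactors.
Local Open Scope classical_set_scope.
Local Open Scope ring_scope.
Variables (K : fieldType) (n : nat) (Q : valued_quiver n) (Mod : modulation K Q).
Local Notation rep := (rep Mod).
Implicit Types V W X Y M N T I E L : rep.
Variables (R : realDomainType) (th : 'rV[nat]_n -> R).
Hypothesis thD : forall a b : 'rV[nat]_n, th (a + b) = th a + th b.

Definition dsize (d : 'rV[nat]_n) : nat := (\sum_i d 0%R i)%N.

Lemma dsizeD a b : dsize (a + b) = (dsize a + dsize b)%N.
Proof. by rewrite /dsize -big_split; apply: eq_bigr => i _; rewrite mxE. Qed.

Lemma dsize_eq0 a : dsize a = 0%N -> a = 0.
Proof.
move=> /eqP; rewrite sum_nat_eq0 => /forall_inP h; apply/rowP => i.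
by rewrite mxE; apply/eqP/h.
Qed.

Lemma dsize0 : dsize 0 = 0%N.
Proof. by rewrite /dsize big1 // => i _; rewrite mxE. Qed.

Lemma dsize_gt0 a : a <> 0 -> (0 < dsize a)%N.
Proof. by move=> a0; rewrite lt0n; apply/eqP => /dsize_eq0. Qed.

Lemma th_0 : th 0 = 0.
Proof. by have := thD 0 0; rewrite addr0 => /esym/eqP; rewrite -subr_eq0 addrK => /eqP. Qed.

Lemma embeds_dsize V W : embeds V W -> (dsize (dimvec V) <= dsize (dimvec W))%N.
Proof.
move=> [f mf fI]; have [X [p fp]] := cokernel mf fI.
by rewrite (short_exact_dimvec fp) dsizeD leq_addr.
Qed.

Lemma embeds_dimvec_eq V W : embeds V W -> (dsize (dimvec W) <= dsize (dimvec V))%N ->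
  dimvec V = dimvec W.
Proof.
move=> [f mf fI]; have [X [p fp]] := cokernel mf fI.
rewrite (short_exact_dimvec fp) dsizeD -[leqRHS]addn0 leq_add2l leqn0.
by move=> /eqP/dsize_eq0 ->; rewrite addr0.
Qed.

Lemma hom0_neg V W : ~ hom0 V W -> exists2 f : (forall i, V i -> W i), morphism f &
  ~ (forall i v, f i v = 0).
Proof.
move=> h; apply: contrapT => nf; apply: h => f mf; apply: contrapT => h.
by apply: nf; exists f.
Qed.

Lemma image_neq0 V W I (f : forall i, V i -> W i) (q : forall i, V i -> I i)
    (j : forall i, I i -> W i) : morphism j -> (forall i v, j i (q i v) = f i v) ->
  ~ (forall i v, f i v = 0) -> dimvec I <> 0.
Proof.
move=> mj jE nf /dimvec0P I0; apply: nf => i v.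
by rewrite -jE (I0 i (q i v)) (mor0 mj).
Qed.

Lemma zero_rep0 i (v : zero_rep Mod i) : v = 0.
Proof. exact: thinmx0. Qed.

Lemma dimvec_zero_rep : dimvec (zero_rep Mod) = 0.
Proof. by apply/dimvec0P => i v; exact: zero_rep0. Qed.

Lemma morphism_zero V W : morphism (fun i (_ : V i) => 0 : W i).
Proof. exact: morphism0. Qed.

Lemma short_exact_zero_quot V : exists io p, @short_exact _ _ _ _ (zero_rep Mod) V V io p.
Proof.
exists (fun i => id), (fun i _ => 0); split.
- exact: morphism_id.
- exact: morphism_zero.
- by move=> i u v.
- by move=> i v; exists 0; rewrite (zero_rep0 v).
- by move=> i e; split=> // _; exists e.
Qed.

Lemma short_exact_zero_sub V : exists io p, @short_exact _ _ _ _ V (zero_rep Mod) V io p.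
Proof.
exists (fun i _ => 0), (fun i => id); split.
- exact: morphism_zero.
- exact: morphism_id.
- by move=> i u v _; rewrite (zero_rep0 u) (zero_rep0 v).
- by move=> i v; exists v.
- by move=> i e; split=> [->|[w <-]] //; exists 0.
Qed.

(** * Smallest submodules of weight zero *)

Section Sub.
Variables (M L : rep).
Hypotheses (M_rigid : ext0 M M) (M_le0 : forall N, embeds N M -> th (dimvec N) <= 0).
Hypotheses (LM : embeds L M) (L_neq0 : dimvec L <> 0) (thL : th (dimvec L) = 0).
Hypothesis L_min : forall N, embeds N M -> dimvec N <> 0 -> th (dimvec N) = 0 ->
  (dsize (dimvec L) <= dsize (dimvec N))%N.

(** Kernel and image of a nonzero endomorphism have weights at most 0 with sum 0. The image is thus
    a nonzero submodule of weight 0, and minimality of L makes it all of L. *)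
Lemma sub_division_end : division_end L.
Proof.
apply: division_endP => // f mf nf; right.
have [N [I [k [q [j [kq mj jI jE]]]]]] := kernel_image mf.
have IL : embeds I L by exists j.
have I0 := image_neq0 mj jE nf.
have dL := short_exact_dimvec kq.
have thI : th (dimvec I) = 0.
  apply/eqP; rewrite eq_le M_le0; last exact: embeds_trans IL LM.
  have := M_le0 (embeds_trans (short_exact_embeds kq) LM).
  by rewrite -[X in X <= _](addrK (th (dimvec I))) -thD -dL thL sub0r oppr_le0.
have e := embeds_dimvec_eq IL (L_min (embeds_trans IL LM) I0 thI).
have jS := dimvec_inj_surj mj jI e.
move=> i w; have [y <-] := jS i w; case: kq => _ _ _ qS _.
by have [x <-] := qS i y; exists x; rewrite jE.
Qed.

(* N is the smallest submodule of M such that Hom(L, M/N) = 0; it is filtered by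
   copies of L, hence it is rigid and has L both as a submodule and as a quotient. *)
Lemma sub_rigid : ext0 L L.
Proof.
pose P (N : rep) := embeds N M /\ exists X io p,
  @short_exact _ _ _ _ X N M io p /\ hom0 L X.
have [|N [[NM [X [io [p [iop LX]]]]] Nmin]] := @ex_argmin rep P (fun N => dsize (dimvec N)).
  exists M; split; first exact: embeds_refl.
  have [io [p h]] := short_exact_zero_quot M; exists (zero_rep Mod), io, p; split=> //.
  by move=> f _ i v; rewrite (zero_rep0 (f i v)).
(* A proper N1 in N has Hom(L, N/N1) <> 0. Otherwise Hom(L, M/N1) = 0, because M/N1 is an extension
   of M/N by N/N1, and N would not be smallest. *)
have sub_N N1 N2 k q : @short_exact _ _ _ _ N2 N1 N k q ->
    (dsize (dimvec N1) < dsize (dimvec N))%N ->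
    ~ hom0 L N2.
  move=> kq lt h0; have N1M := embeds_trans (short_exact_embeds kq) NM.
  have [mio mp ioI pS ex] := iop; have [mk mq kI qS exk] := kq.
  have [|X1 [p1 kp1]] := cokernel (morphism_comp mk mio).
    by move=> i; apply: inj_comp; [exact: ioI|exact: kI].
  have [_ mp1 _ p1S ex1] := kp1.
  suff : P N1 by move=> /Nmin; rewrite leqNgt lt.
  split=> //; exists X1, (fun i w => io i (k i w)), p1; split; first exact: kp1.
  move=> g mg.
  have [|j mj jE] := morphism_factor_surj mq (morphism_comp mio mp1) qS.
    move=> i v /exk[w <-]; apply/ex1; by exists w.
  have [|p' mp' p'E] := morphism_factor_surj mp1 mp p1S.
    by move=> i m /ex1[w <-]; apply/ex; exists (k i w).
  have p'g : forall i v, p' i (g i v) = 0 by exact: (LX _ (morphism_comp mg mp')).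
  have [||g' mg' g'E] := morphism_factor_inj mg mj.
  - apply: morphism_injP => // i v; have [u <-] := qS i v; rewrite jE => /ex1[w e].
    by apply/exk; exists w; apply: (ioI i).
  - move=> i l; have [m hm] := p1S i (g i l).
    have /ex[u hu] : p i m = 0 by rewrite -p'E hm.
    by exists (q i u); rewrite jE hu hm.
  by move=> i l; rewrite -g'E (h0 _ mg') (mor0 mj).
(* Hom(N, M/N) = 0: the image of a nonzero map is N/N1 for a proper N1, so it receives a nonzero map
   from L, and so does M/N. *)
have N_rigid : ext0 N N.
  apply: (ext0_self_sub iop _ (ext0_embeds NM M_rigid)).
  apply: contrapT => /hom0_neg[f mf nf].
  have [N1 [I [k [q [j [kq mj jI jE]]]]]] := kernel_image mf.
  apply: (sub_N _ _ _ _ kq); last by apply: (hom0_embeds _ LX); exists j.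
  rewrite (short_exact_dimvec kq) dsizeD -[X in (X < _)%N]addn0 ltn_add2l.
  exact/dsize_gt0/(image_neq0 mj jE nf).
have LN : embeds L N.
  have [f mf fI] := LM; have [mio mp ioI pS ex] := iop.
  have [|g mg gE] := morphism_factor_inj mf mio ioI.
    by move=> i l; apply/ex; exact: (LX _ (morphism_comp mf mp)).
  by exists g => // i x y e; apply: (fI i); rewrite -!gE e.
(* For a largest proper N1 of weight 0 the quotient N/N1 is L: a nonzero map from L to N/N1 is onto
   by maximality of N1 and injective by minimality of L. *)
pose P1 (N1 : rep) := (exists X k q, @short_exact _ _ _ _ X N1 N k q) /\
  (dsize (dimvec N1) < dsize (dimvec N))%N /\ th (dimvec N1) = 0.
have [||N1 [[[X1 [k [q kq]]] [ltN1 thN1]] N1max]] :=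
    @ex_argmax rep P1 (fun N => dsize (dimvec N)) (dsize (dimvec N)).
- exists (zero_rep Mod); split.
    by have [io' [p' h]] := short_exact_zero_sub N; exists N, io', p'.
  rewrite dimvec_zero_rep th_0 dsize0; split=> //.
  exact: leq_trans (dsize_gt0 L_neq0) (embeds_dsize LN).
- by move=> N1 [_ [/ltnW]].
have [g mg ng] := hom0_neg (sub_N _ _ _ _ kq ltN1).
have [L1 [I [k' [q' [j [kq' mj jI jE]]]]]] := kernel_image mg.
have [N2 [k2 [b [a [[k2b ma aI _ _] _]]]]] := pullback kq mj jI.
have N2N : embeds N2 N by exists a.
have I0 := image_neq0 mj jE ng.
have dN2 := short_exact_dimvec k2b.
have dL := short_exact_dimvec kq'.
have thI : th (dimvec I) <= 0.
  by have := M_le0 (embeds_trans N2N NM); rewrite dN2 thD thN1 add0r.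
have L1M := embeds_trans (short_exact_embeds kq') LM.
have thI0 : th (dimvec I) = 0.
  apply/eqP; rewrite eq_le thI /=; have := M_le0 L1M.
  by rewrite -[X in X <= _](addrK (th (dimvec I))) -thD -dL thL sub0r oppr_le0.
have L10 : dimvec L1 = 0.
  apply: contrapT => L1n.
  have thL1 : th (dimvec L1) = 0 by move: thL; rewrite dL thD thI0 addr0.
  have := L_min L1M L1n thL1; rewrite dL dsizeD -[leqRHS]addn0 leq_add2l leqn0.
  by move=> /eqP/dsize_eq0.
have dIL : dimvec L = dimvec I by rewrite dL L10 add0r.
have dIX : dimvec I = dimvec X1.
  have IX : embeds I X1 by exists j.
  apply: embeds_dimvec_eq IX _; rewrite leqNgt; apply/negP => lt.
  have [X2 [p2 ap2]] := cokernel ma aI.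
  have : P1 N2.
    split; first by exists X2, a, p2.
    rewrite dN2 thD thN1 thI0 add0r dsizeD (short_exact_dimvec kq) dsizeD.
    by rewrite ltn_add2l.
  move=> /N1max; rewrite dN2 dsizeD -[leqRHS]addn0 leq_add2l leqn0.
  by move=> /eqP/dsize_eq0.
have gI : forall i, injective (g i).
  apply: morphism_injP => // i v; rewrite -jE -(mor0 mj i) => /jI.
  case: kq' => mk _ kI _ ex /ex[w <-].
  by have /dimvec0P/(_ i w) -> := L10; rewrite (mor0 mk).
have gS := dimvec_inj_surj mg gI (etrans dIL dIX).
have [g' mg' gK] := morphism_bij_inv mg gI gS.
apply: ext0_projects (ext0_embeds LN N_rigid).
apply: projects_trans (short_exact_projects kq) _.
exists g' => // i v; by exists (g i v); exact: (gK i).1.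
Qed.

End Sub.

(** * Smallest quotients of weight zero *)

Section Quot.
Variables (M L : rep).
Hypotheses (M_rigid : ext0 M M) (M_ge0 : forall N, projects M N -> 0 <= th (dimvec N)).
Hypotheses (ML : projects M L) (L_neq0 : dimvec L <> 0) (thL : th (dimvec L) = 0).
Hypothesis L_min : forall N, projects M N -> dimvec N <> 0 -> th (dimvec N) = 0 ->
  (dsize (dimvec L) <= dsize (dimvec N))%N.

(** X is also a quotient of M, so its weight is at least 0 and both weights vanish. A nonzero X
    would then be a quotient of weight 0 smaller than L. *)
Lemma quot_cokernel_eq0 I X (j : forall i, I i -> L i) (p : forall i, L i -> X i) :
  short_exact j p -> dimvec I <> 0 -> 0 <= th (dimvec I) -> th (dimvec I) = 0 /\ dimvec X = 0.
Proof.
move=> jp I0 thI; have dL := short_exact_dimvec jp.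
have MX := projects_trans ML (short_exact_projects jp).
have thI0 : th (dimvec I) = 0.
  apply/eqP; rewrite eq_le thI andbT; have := M_ge0 MX.
  by rewrite -[X in _ <= X](addKr (th (dimvec I))) -thD -dL thL addr0 oppr_ge0.
split=> //; apply: contrapT => X0.
have thX : th (dimvec X) = 0 by move: thL; rewrite dL thD thI0 add0r.
have := L_min MX X0 thX; rewrite dL dsizeD -[leqRHS]add0n leq_add2r leqn0.
by move=> /eqP/dsize_eq0.
Qed.

Lemma quot_division_end : division_end L.
Proof.
apply: division_endP => // f mf nf; right.
have [N [I [k [q [j [kq mj jI jE]]]]]] := kernel_image mf.
have I0 := image_neq0 mj jE nf.
have [X [p jp]] := cokernel mj jI.
have [|_ X0] := quot_cokernel_eq0 jp I0.
  exact: M_ge0 (projects_trans ML (short_exact_projects kq)).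
have e : dimvec I = dimvec L by rewrite (short_exact_dimvec jp) X0 addr0.
have jS := dimvec_inj_surj mj jI e.
move=> i w; have [y <-] := jS i w; case: kq => _ _ _ qS _.
by have [x <-] := qS i y; exists x; rewrite jE.
Qed.

(** X is a smallest quotient of M whose kernel has no nonzero map to L. It is rigid and has L as a
    quotient and as a submodule, so Ext(X, X) = 0 gives Ext(L, X) = 0 and then Ext(L, L) = 0. *)
Lemma quot_rigid : ext0 L L.
Proof.
pose P (X : rep) := exists N io p, @short_exact _ _ _ _ X N M io p /\ hom0 N L.
have [|X [[N [io [p [iop NL]]]] Xmin]] := @ex_argmin rep P (fun N => dsize (dimvec N)).
  have [io [p h]] := short_exact_zero_sub M; exists M, (zero_rep Mod), io, p; split=> //.
  by move=> f mf i v; rewrite (zero_rep0 v) (mor0 mf).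
have MX := short_exact_projects iop.
have quot_X X1 X2 k q : @short_exact _ _ _ _ X1 X2 X k q ->
    (dsize (dimvec X1) < dsize (dimvec X))%N -> ~ hom0 X2 L.
  move=> kq lt h0; have [mio mp ioI pS ex] := iop; have [mk mq kI qS exk] := kq.
  have [N2 [k2 [b [a [[k2b ma aI ak pa] im]]]]] := pullback iop mk kI.
  have [mk2 mb k2I bS exb] := k2b.
  suff : P X1 by move=> /Xmin; rewrite leqNgt lt.
  exists N2, a, (fun i m => q i (p i m)); split.
    split=> //; first exact: morphism_comp.
    - by move=> i v; have [u <-] := qS i v; have [m <-] := pS i u; exists m.
    - move=> i m; split=> [/exk|]; first by move=> h; apply/im.
      by move=> h; apply/exk/im.
  move=> g mg.
  have [|g' mg' g'E] := morphism_factor_surj mb mg bS.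
    move=> i v /exb[w <-]; exact: (NL _ (morphism_comp mk2 mg)).
  by move=> i v; rewrite -g'E (h0 _ mg').
have X_rigid : ext0 X X.
  apply: (ext0_self_quot iop _ (ext0_projects MX M_rigid)).
  apply: contrapT => /hom0_neg[f mf nf].
  have [N1 [I [k [q [j [kq mj jI jE]]]]]] := kernel_image mf.
  have [X1 [p1 jp1]] := cokernel mj jI.
  apply: (quot_X _ _ _ _ jp1); last first.
    by apply: (hom0_projects _ NL); exact: short_exact_projects kq.
  rewrite (short_exact_dimvec jp1) dsizeD -[X in (X < _)%N]add0n ltn_add2r.
  exact/dsize_gt0/(image_neq0 mj jE nf).
have XL : projects X L.
  have [f mf fS] := ML; have [mio mp ioI pS ex] := iop.
  have [|g mg gE] := morphism_factor_surj mp mf pS.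
    move=> i v /ex[w <-]; exact: (NL _ (morphism_comp mio mf)).
  exists g => // i l; have [m <-] := fS i l; by exists (p i m).
have X_neq0 : dimvec X <> 0.
  move=> /dimvec0P X0; apply/L_neq0/dimvec0P => i v; have [f mf fS] := XL.
  by have [u <-] := fS i v; rewrite (X0 i u) (mor0 mf).
(* L embeds in X as the kernel N1 of a largest proper quotient X1 of weight 0. A nonzero map g from
   N1 to L is onto by [quot_cokernel_eq0], and injective because X modulo the kernel of g would be a
   larger such quotient. *)
pose P1 (X1 : rep) := (exists N1 k q, @short_exact _ _ _ _ X1 N1 X k q) /\
  (dsize (dimvec X1) < dsize (dimvec X))%N /\ th (dimvec X1) = 0.
have [||X1 [[[N1 [k [q kq]]] [ltX1 thX1]] X1max]] :=
    @ex_argmax rep P1 (fun N => dsize (dimvec N)) (dsize (dimvec X)).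
- exists (zero_rep Mod); split.
    by have [io' [p' h]] := short_exact_zero_quot X; exists X, io', p'.
  by rewrite dimvec_zero_rep th_0 dsize0; split=> //; exact: dsize_gt0.
- by move=> ? [_ [/ltnW]].
have [g mg ng] := hom0_neg (quot_X _ _ _ _ kq ltX1).
have [L1 [I [k' [q' [j [kq' mj jI jE]]]]]] := kernel_image mg.
have I0 := image_neq0 mj jE ng.
have [mk mq kI qS exk] := kq; have [mk' mq' k'I q'S exk'] := kq'.
have [|X2 [p2 kp2]] := cokernel (morphism_comp mk' mk).
  by move=> i; apply: inj_comp; [exact: kI|exact: k'I].
have dX := short_exact_dimvec kq; have dN1 := short_exact_dimvec kq'.
have dX2 : dimvec X2 = dimvec I + dimvec X1.
  have := short_exact_dimvec kp2; rewrite dX dN1 => /rowP e; apply/rowP => i.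
  by have := e i; rewrite !mxE -addrA => /addnI.
have MX2 := projects_trans MX (short_exact_projects kp2).
have thI : 0 <= th (dimvec I) by have := M_ge0 MX2; rewrite dX2 thD thX1 addr0.
have [Y [pY jpY]] := cokernel mj jI.
have [thI0 Y0] := quot_cokernel_eq0 jpY I0 thI.
have dIL : dimvec I = dimvec L by rewrite (short_exact_dimvec jpY) Y0 addr0.
have L10 : dimvec L1 = 0.
  apply: dsize_eq0; apply/eqP; rewrite -leqn0 leqNgt; apply/negP => lt.
  have : P1 X2.
    split; first by exists L1, (fun i w => k i (k' i w)), p2; exact: kp2.
    by rewrite dX2 thD thX1 thI0 addr0 dX dN1 !dsizeD -addnA -[X in (X < _)%N]add0n ltn_add2r.
  move=> /X1max; rewrite dX2 dsizeD -[leqRHS]add0n leq_add2r leqn0.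
  by move=> /eqP/dsize_eq0.
have gI : forall i, injective (g i).
  apply: morphism_injP => // i v; rewrite -jE -(mor0 mj i) => /jI/exk'[w <-].
  by have /dimvec0P/(_ i w) -> := L10; rewrite (mor0 mk').
have gS : forall i w, exists v, g i v = w.
  by apply: dimvec_inj_surj => //; rewrite dN1 L10 add0r.
have [g' mg' gK] := morphism_bij_inv mg gI gS.
apply: ext0_projects XL (ext0_embeds _ X_rigid).
apply: embeds_trans (short_exact_embeds kq).
by exists g' => // i; exact: can_inj (gK i).2.
Qed.

End Quot.
End ExceptionalFactors.

(** * The Euler form *)

Section VectorSpaces.
Local Open Scope classical_set_scope.
Local Open Scope ring_scope.
Variable K : fieldType.

Lemma rV_sum_linear (X : lmodType K) d (u : 'I_d -> X) :
  linear (fun a : 'rV[K]_d => \sum_k a 0 k *: u k).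
Proof.
move=> k a b; rewrite scaler_sumr -big_split /=; apply: eq_bigr => l _.
by rewrite !mxE scalerDl scalerA.
Qed.

(** This turns the unique coordinates of [is_hom_dim] (with B = 0) and of [is_ext_dim] (with B the
    coboundaries) into dimensions of vector spaces. *)
Lemma dim_quot_family (X : vectType K) (U B : {vspace X}) d (u : 'I_d -> X) :
  (B <= U)%VS -> (forall k, u k \in U) ->
  (forall x, x \in U -> exists! a : 'rV[K]_d, x - \sum_k a 0 k *: u k \in B) ->
  \dim U = (d + \dim B)%N.
Proof.
move=> BU uU ux.
pose G (a : 'rV[K]_d) := \sum_k a 0 k *: u k.
pose g : {linear 'rV[K]_d -> X} := HB.pack G (GRing.isLinear.Build _ _ _ _ G (rV_sum_linear u)).
pose f := linfun g.
have fE a : f a = G a by rewrite lfunE.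
have fB a : f a \in B -> a = 0.
  rewrite fE => GB; have [b [_ bu]] := ux 0 (mem0v U).
  rewrite -(bu a); last by rewrite sub0r memvN.
  apply: bu; rewrite sub0r memvN.
  by rewrite big1 ?mem0v // => k _; rewrite mxE scale0r.
have dI : \dim (limg f) = d.
  rewrite limg_dim_eq ?dimvf ?dim_rV //.
  by apply/eqP; rewrite capfv; apply/lker0P => a b e; apply/eqP; rewrite -subr_eq0;
    apply/eqP/fB; rewrite linearB /= e subrr mem0v.
rewrite -{1}dI -dimv_disjoint_sum.
  congr (\dim _); apply/eqP; rewrite eqEsubv subv_add BU andbT; apply/andP; split.
    apply/subvP => x xU; have [a [ha _]] := ux x xU.
    by rewrite -[x](subrK (G a)) addrC memv_add // -fE memv_img // memvf.
  apply/subvP => _ /memv_imgP[a _ ->]; rewrite fE.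
  by apply: memv_suml => k _; apply: memvZ.
apply/eqP; rewrite -subv0; apply/subvP => x; rewrite memv_cap => /andP[/memv_imgP[a _ ->] /fB ->].
by rewrite linear0 mem0v.
Qed.

(** Let U be a largest invariant subspace whose dimension is a multiple of dim D. For h outside U
    the orbit hD has dimension dim D and meets U in 0, because the action of a nonzero u can be
    undone; so U + hD would be larger. *)
Lemma division_dvd_dim (H D : vectType K) (act : H -> D -> H) (mul : D -> D -> D) :
  (forall h, linear (act h)) -> (forall h u v, act (act h u) v = act h (mul u v)) ->
  (forall u, linear (act ^~ u)) -> (exists e, forall h, act h e = h) ->
  (forall u, u != 0 -> exists v, forall h, act (act h u) v = h) ->
  (dim D %| dim H)%N.
Proof.
move=> actl actA actr [e acte] actV.
pose actD h : {linear D -> H} := HB.pack (act h) (GRing.isLinear.Build _ _ _ _ _ (actl h)).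
have act0 h : act h 0 = 0 by rewrite -[act h]/(actD h : _ -> _) linear0.
pose actH u : {linear H -> H} := HB.pack (act ^~ u) (GRing.isLinear.Build _ _ _ _ _ (actr u)).
have act0l u : act 0 u = 0 by rewrite -[act 0 u]/(actH u 0) linear0.
have actDl u x y : act (x + y) u = act x u + act y u.
  by rewrite -[act _ u]/(actH u _) linearD.
pose P d := `[< exists U : {vspace H}, (forall h u, h \in U -> act h u \in U) /\
   (dim D %| \dim U)%N /\ \dim U = d >].
have P0 : exists d, P d.
  exists 0%N; apply/asboolP; exists 0%VS; rewrite dimv0 dvdn0; split=> // h u.
  by rewrite memv0 => /eqP ->; rewrite act0l mem0v.
have Pb d : P d -> (d <= dim H)%N.
  by move=> /asboolP[U [_ [_ <-]]]; rewrite -dimvf dimvS // subvf.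
case: (ex_maxnP P0 Pb) => d /asboolP[U [Uact [dU Ud]]] dmax.
have [Uf|/negP nU] := eqVneq U fullv; first by rewrite -[dim H]dimvf -Uf.
have [h hU] : exists h, h \notin U.
  apply: contrapT => no; apply: nU; rewrite eqEsubv subvf; apply/subvP => h _.
  by apply/negPn/negP => hU; apply: no; exists h.
pose f := linfun (actD h).
have fE u : f u = act h u by rewrite lfunE.
have fU u : f u \in U -> u = 0.
  move=> fuU; apply/eqP/negPn/negP => /actV[v uv].
  by move: hU; rewrite -(uv h) -fE Uact.
have dI : \dim (limg f) = dim D.
  rewrite limg_dim_eq ?dimvf //.
  by apply/eqP; rewrite capfv; apply/lker0P => a b ab; apply/eqP; rewrite -subr_eq0;
    apply/eqP/fU; rewrite linearB /= ab subrr mem0v.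
have dsum : \dim (U + limg f) = (\dim U + dim D)%N.
  rewrite dimv_disjoint_sum ?dI //.
  apply/eqP; rewrite -subv0; apply/subvP => x.
  rewrite memv_cap => /andP[xU /memv_imgP[a _ xa]].
  by rewrite xa (fU a) ?linear0 ?mem0v // -xa.
have : P (\dim U + dim D)%N.
  apply/asboolP; exists (U + limg f)%VS; rewrite dsum dvdn_addr //; split=> // x u.
  move=> /memv_addP[y yU [_ /memv_imgP[v _ ->] ->]].
  by rewrite actDl memv_add ?Uact // fE actA -fE memv_img // memvf.
(* Maximality leaves only dim D = 0; then e = 0, and h, which equals h acted on by e, is 0 and lies
   in U. *)
move=> /dmax; rewrite -Ud -[leqRHS]addn0 leq_add2l leqn0 => /eqP D0.
have e0 : e = 0 by apply: dim_eq0.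
by move: hU; rewrite -(acte h) e0 act0 mem0v.
Qed.

End VectorSpaces.

(** * Right duals of bimodules, as coordinates for cocycles *)

Section RightDual.
Local Open Scope classical_set_scope.
Local Open Scope ring_scope.
Variables (K : fieldType) (A B : falgType K) (M : bimodule A B).

Definition right_linear (h : M -> B) : Prop :=
  (forall x y, h (x + y) = h x + h y) /\ forall x b, h (bract x b) = h x * b.

(* The flag b is meant to be the existence of an arrow; without arrow the space of
   coordinates is 0. *)
Record right_dual (b : bool) := RightDual {
  rd_dim : nat;
  rd_fun : 'rV[K]_rd_dim -> M -> B;
  rd_coord : (M -> B) -> 'rV[K]_rd_dim;
  rd_right_linear : forall a, right_linear (rd_fun a);
  rd_funP : forall k u v x, rd_fun (k *: u + v) x = k *: rd_fun u x + rd_fun v x;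
  rd_funK : forall a, rd_coord (rd_fun a) = a;
  rd_coordK : forall h, b -> right_linear h -> rd_fun (rd_coord h) = h;
  rd_dim0 : ~~ b -> rd_dim = 0%N }.

Lemma right_linear_scale h k x : right_linear h -> h (k *: x) = k *: h x.
Proof. by move=> [hD hZ]; rewrite -bract_alg hZ mulr_algr. Qed.

Lemma right_linear_comb h h' k : right_linear h -> right_linear h' ->
  right_linear (fun x => k *: h x + h' x).
Proof.
move=> [hD hZ] [hD' hZ']; split=> [x y|x b].
  by rewrite hD hD' scalerDr addrACA.
by rewrite hZ hZ' mulrDl scalerAl.
Qed.

Lemma right_linear0 : right_linear (fun _ => 0).
Proof. by split=> *; rewrite ?addr0 ?mul0r. Qed.

Lemma right_linear_det h h' : right_linear h -> right_linear h' ->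
  (forall u, h (r2v (delta_mx 0 u)) = h' (r2v (delta_mx 0 u))) -> h = h'.
Proof.
move=> rh rh' e; apply/funext => x.
have sumE g : right_linear g -> g x = \sum_u v2r x 0 u *: g (r2v (delta_mx 0 u)).
  move=> rg; rewrite -{1}[x]v2rK {1}[v2r x]row_sum_delta linear_sum /=.
  have g0 : g 0 = 0 by rewrite -[0](scale0r (0 : M)) right_linear_scale // scale0r.
  have -> : forall (r : seq 'I_(dim M)) y, g (\sum_(u <- r) y u) = \sum_(u <- r) g (y u).
    move=> r y; elim: r => [|u r ih]; first by rewrite !big_nil.
    by rewrite !big_cons rg.1 ih.
  by apply: eq_bigr => u _; rewrite linearZ /= right_linear_scale.
by rewrite !sumE //; apply: eq_bigr => u _; rewrite e.
Qed.

Lemma right_dual_ex b : exists _ : right_dual b, True.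
Proof.
case: b; last first.
  unshelve eexists; last by [].
  apply: (@RightDual _ 0 (fun _ _ => 0) (fun _ => 0)) => //.
  - by move=> a; exact: right_linear0.
  - by move=> *; rewrite scaler0 addr0.
  - by move=> a; apply/rowP => -[].
pose phi (h : M -> B) : {ffun 'I_(dim M) -> B} := [ffun u => h (r2v (delta_mx 0 u))].
have phi_comb k h h' : phi (fun x => k *: h x + h' x) = k *: phi h + phi h'.
  by apply/ffunP => u; rewrite !ffunE.
have phi0 : phi (fun _ => 0) = 0 by apply/ffunP => u; rewrite !ffunE.
have phi_inj h h' : right_linear h -> right_linear h' -> phi h = phi h' -> h = h'.
  move=> rh rh' /ffunP e; apply: right_linear_det => // u.
  by have := e u; rewrite !ffunE.
pose S := [set y | exists2 h, right_linear h & phi h = y].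
have [||||y ->|d [e [eS eu]]] := @quot_basis K _ S [set 0].
- by exists (fun _ => 0); [exact: right_linear0|].
- move=> a _ _ [h rh <-] [h' rh' <-]; exists (fun x => a *: h x + h' x) => //.
  exact: right_linear_comb.
- by [].
- by move=> a x y /= -> ->; rewrite scaler0 addr0.
- by exists (fun _ => 0); [exact: right_linear0|].
have hh k : exists h, right_linear h /\ phi h = e k by have [h] := eS k; exists h.
have [E hE] := choice hh.
pose un (a : 'rV[K]_d) (x : M) : B := \sum_k a 0 k *: E k x.
have unr a : right_linear (un a).
  split=> [x y|x b].
    rewrite -big_split; apply: eq_bigr => k _ /=; have [[hD _] _] := hE k.
    by rewrite hD scalerDr.
  rewrite mulr_suml; apply: eq_bigr => k _ /=; have [[_ hZ] _] := hE k.
  by rewrite hZ scalerAl.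
have phiun a : phi (un a) = \sum_k a 0 k *: e k.
  apply/ffunP => u; rewrite ffunE sum_ffunE; apply: eq_bigr => k _.
  by have [_ <-] := hE k; rewrite !ffunE.
have cf h : exists a, right_linear h -> un a = h.
  have [rh|nh] := pselect (right_linear h); last by exists 0.
  have [|a [/= ha _]] := eu (phi h); first by exists h.
  exists a => _; apply: phi_inj => //; rewrite phiun; apply/eqP.
  by rewrite eq_sym -subr_eq0 ha.
have [C hC] := choice cf.
unshelve eexists; last by [].
apply: (@RightDual true d un C unr) => [k u v x|a|h _ rh|//]; last exact: hC.
  by rewrite /un scaler_sumr -big_split; apply: eq_bigr => l _; rewrite !mxE scalerDl scalerA.
have [|b [_ hb]] := eu (phi (un a)); first by exists (un a).
transitivity b; first by apply/esym/hb; rewrite /= -phiun hC // subrr.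
by apply: hb; rewrite /= phiun subrr.
Qed.

End RightDual.

(** * The two-term complex computing Hom and Ext *)

Section Euler.
Local Open Scope classical_set_scope.
Local Open Scope ring_scope.
Variables (K : fieldType) (n : nat) (Q : valued_quiver n) (Mod : modulation K Q).
Local Notation F := (mod_alg Mod).
Local Notation M := (mod_bim Mod).
Local Notation rep := (rep Mod).

Definition arrow_dual i j : right_dual (M i j) (arrow Q i j) :=
  projT1 (cid (right_dual_ex (M i j) (arrow Q i j))).

Section Pair.
Variables V W : rep.

Lemma kc_surj (A : falgType K) (U : vectType A^c) (y : 'I_(dim U) -> 'I_(dim A) -> K) :
  exists w : U, forall t u, kc w t u = y t u.
Proof.
exists (r2v (\row_t ((r2v (\row_u y t u) : A) : A^c)) : U) => t u.
by rewrite /kc r2vK mxE r2vK mxE.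
Qed.

Definition lin_maps (f : forall i, V i -> W i) := forall i, linear (f i).

Lemma phiH_inj f g : lin_maps f -> lin_maps g -> phiH f = phiH g -> f = g.
Proof.
move=> lf lg /ffunP h; do 2!(apply: functional_extensionality_dep => ?).
rewrite (linear_sumE (lf _)) (linear_sumE (lg _)); apply: eq_bigr => s _.
congr ract; apply: kc_inj => t u.
by have := h (existT _ _ (s, (t, u)) : TH V W); rewrite !ffunE.
Qed.

Lemma phiH_surj (y : {ffun TH V W -> K^o}) : exists2 f, lin_maps f & phiH f = y.
Proof.
have hw i (s : 'I_(dim (V i))) : exists w : W i, forall t u,
    kc w t u = y (existT _ i (s, (t, u)) : TH V W).
  exact: (kc_surj (fun t u => y (existT _ i (s, (t, u)) : TH V W))).
have w i := choice (hw i).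
exists (fun i v => \sum_s ract (projT1 (w i) s) (v2r v 0 s : F i)).
  move=> i a u v; rewrite scaler_sumr -big_split /=; apply: eq_bigr => s _.
  by rewrite linearP !mxE /ract scalerDl scalerA.
apply/ffunP => -[i [s [t u]]]; rewrite ffunE /= -(projT2 (w i) s).
congr kc; rewrite (bigD1 s) //= big1 => [|s' ss']; rewrite r2vK mxE eqxx.
  by rewrite eqxx /ract scale1r addr0.
by rewrite eq_sym in ss'; rewrite /= eq_sym (negPf ss') /ract scale0r.
Qed.

(** In bases of V_i and W_j a cocycle at i -> j is a matrix of right linear maps from M_ij to F_j.
    The number of coordinates is therefore bilinear in the dimension vectors; pairs without arrow
    contribute nothing, as [rd_dim] is 0 there. *)
Definition cochain_index := {ij : 'I_n * 'I_n &
  ('I_(dim (V ij.1)) * ('I_(dim (W ij.2)) * 'I_(rd_dim (arrow_dual ij.1 ij.2))))%type}.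

Definition cochain_coef (c : cochain V W) i j (s : 'I_(dim (V i))) (t : 'I_(dim (W j)))
  (x : M i j) : F j := v2r (c i j (r2v (delta_mx 0 s)) x) 0 t.

Definition cochain_coords (c : cochain V W) : {ffun cochain_index -> K^o} :=
  [ffun t : cochain_index =>
  rd_coord (arrow_dual (tag t).1 (tag t).2)
    (cochain_coef c (tagged t).1 (tagged t).2.1) 0 (tagged t).2.2].

Lemma cochain_coef_right_linear (c : cochain V W) i j s t : cocycle c -> arrow Q i j ->
  right_linear (@cochain_coef c i j s t).
Proof.
move=> cc ij; have b := cc i j ij; split=> [x y|x d]; rewrite /cochain_coef.
  by rewrite (balDr b) linearD mxE.
by rewrite (bal_bract b) /ract linearZ mxE.
Qed.

Lemma cochain_coords_comb k (c c' : cochain V W) : cocycle c -> cocycle c' ->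
  cochain_coords (combE k c c') = k *: cochain_coords c + cochain_coords c'.
Proof.
move=> cc cc'; apply/ffunP => -[[i j] [s [t l]]]; rewrite !ffunE /=.
have [ij|/negP nij] := pselect (arrow Q i j); last first.
  by have := ltn_ord l; rewrite /= [X in (_ < X)%N](rd_dim0 _ nij).
set D := arrow_dual i j.
have rc := cochain_coef_right_linear s t cc ij.
have rc' := cochain_coef_right_linear s t cc' ij.
set h := cochain_coef _ _ _ in rc *; set h' := cochain_coef _ _ _ in rc' *.
have -> : cochain_coef (combE k c c') s t = rd_fun (k *: rd_coord D h + rd_coord D h').
  apply/funext => x; rewrite rd_funP !rd_coordK //.
  by rewrite /cochain_coef /combE v2r_ractE.
by rewrite rd_funK !mxE.
Qed.

Lemma rd_fun0 i j x : rd_fun (0 : 'rV[K]_(rd_dim (arrow_dual i j))) x = 0.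
Proof.
have := rd_funP (-1) (0 : 'rV[K]_(rd_dim (arrow_dual i j))) 0 x.
by rewrite scaler0 addr0 scaleN1r addNr.
Qed.

Lemma cochain_coords_eq0 (c : cochain V W) : cocycle c -> cochain_coords c = 0 ->
  forall i j, arrow Q i j -> forall v x, c i j v x = 0.
Proof.
move=> cc /ffunP c0 i j ij; have b := cc i j ij.
apply: (@bal_det _ _ _ _ _ _ _ (fun _ _ => 0) b); first exact: bal0.
move=> s u; apply: v2r_inj; rewrite linear0; apply/rowP => t; rewrite mxE.
rewrite -[LHS]/(cochain_coef c s t (r2v (delta_mx 0 u))).
rewrite -(rd_coordK (arrow_dual i j) ij (cochain_coef_right_linear s t cc ij)).
rewrite (_ : rd_coord _ _ = 0) ?rd_fun0 //; apply/rowP => l; rewrite mxE.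
by have := c0 (existT _ (i, j) (s, (t, l)) : cochain_index); rewrite !ffunE.
Qed.

Lemma cochain_coords_surj (y : {ffun cochain_index -> K^o}) :
  exists2 c : cochain V W, cocycle c & cochain_coords c = y.
Proof.
pose a i j (s : 'I_(dim (V i))) (t : 'I_(dim (W j))) : 'rV[K]_(rd_dim (arrow_dual i j)) :=
  \row_l y (existT _ (i, j) (s, (t, l)) : cochain_index).
pose h i j s t := rd_fun (@a i j s t).
have hr i j s t : right_linear (@h i j s t) := rd_right_linear _.
pose c : cochain V W := fun i j v x => \sum_s \sum_t
  ract (r2v (delta_mx 0 t)) (h i j s t (lact (v2r v 0 s : F i) x)).
exists c.
  move=> i j ij; split=> [u v x|v x z|v b x|v x b]; rewrite /c.
  - rewrite -big_split; apply: eq_bigr => s _; rewrite -big_split; apply: eq_bigr => t _ /=.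
    rewrite -ractDr -(hr i j s t).1 linearD mxE; congr (ract _ (h _ _ _ _ _)).
    have l := @lact_linearl _ _ _ (M i j) x.
    by have := l 1 (v2r u 0 s) (v2r v 0 s); rewrite !scale1r.
  - rewrite -big_split; apply: eq_bigr => s _; rewrite -big_split; apply: eq_bigr => t _ /=.
    rewrite -ractDr -(hr i j s t).1; congr (ract _ (h _ _ _ _ _)).
    by have := @lact_linear _ _ _ (M i j) (v2r v 0 s) 1 x z; rewrite !scale1r.
  - apply: eq_bigr => s _; apply: eq_bigr => t _; rewrite /ract linearZ mxE.
    by rewrite -lactM.
  - rewrite ract_sum; apply: eq_bigr => s _; rewrite ract_sum; apply: eq_bigr => t _.
    by rewrite lact_bract (hr i j s t).2 ractA.
apply/ffunP => -[[i j] [s [t l]]]; rewrite !ffunE /=.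
suff -> : cochain_coef c s t = h i j s t by rewrite rd_funK mxE.
apply/funext => x; rewrite /cochain_coef /c linear_sum summxE (bigD1 s) //=.
have lact0 : lact (0 : F i) x = 0.
  by have := @lact_linearl _ _ _ (M i j) x (-1) 0 0; rewrite scaler0 addr0 scaleN1r addNr.
have h0 s' t' : h i j s' t' 0 = 0 by apply: dbl0; rewrite -(hr i j s' t').1 addr0.
rewrite [X in _ + X]big1 ?addr0 => [|s' ss'].
  rewrite linear_sum summxE (bigD1 t) //= big1 ?addr0 => [|t' tt'].
    rewrite /ract linearZ r2vK !mxE !eqxx /= lact1.
    have e1 : v2r (r2v (delta_mx 0 t) : W j) 0 t = 1 by rewrite r2vK mxE !eqxx.
    exact: etrans (congr1 (fun z : F j => z * h i j s t x) e1) (mul1r _).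
  rewrite /ract linearZ mxE.
  have e0 : v2r (r2v (delta_mx 0 t') : W j) 0 t = 0.
    by rewrite r2vK mxE [t == t']eq_sym (negPf tt') andbF.
  exact: etrans (congr1 (fun z : F j => z * h i j s t' _) e0) (mul0r _).
rewrite r2vK mxE (negPf ss') andbF lact0 big1 ?linear0 ?mxE // => t' _.
by rewrite h0 /ract scale0r.
Qed.

(** On families of linear maps, with values in the cocycles, this is the complex with kernel Hom(V,
    W) and cokernel Ext(V, W). *)
Definition differential (f : forall i, V i -> W i) : cochain V W := fun i j v x =>
  if arrow Q i j then f j (rep_map v x) - rep_map (f i v) x else 0.

Lemma differential_comb k f g : lin_maps f -> lin_maps g ->
  differential (combH k f g) = combE k (differential f) (differential g).
Proof.
move=> lf lg; do 4!(apply: functional_extensionality_dep => ?).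
rewrite /differential /combE /combH; case: ifP => ij; last by rewrite ract0 addr0.
have bW := rep_balanced W ij.
rewrite (balDl bW) (bal_ract bW) ractDl ractN lact_alg -(bract_alg _ k) (bal_bract bW).
by rewrite opprD addrACA.
Qed.

Lemma differential_cocycle f : lin_maps f -> cocycle (differential f).
Proof.
move=> lf i j ij; rewrite /differential ij.
have bW := rep_balanced W ij; have bV := rep_balanced V ij.
split=> [u v x|v x z|v b x|v x b].
- by rewrite (balDl bV) (linear_add (lf j)) (linear_add (lf i)) (balDl bW) opprD addrACA.
- by rewrite (balDr bV) (linear_add (lf j)) (balDr bW) opprD addrACA.
- by rewrite (bal_ract bV) (linear_ract (lf i)) (bal_ract bW).
- by rewrite (bal_bract bV) (linear_ract (lf j)) (bal_bract bW) ractDl ractN.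
Qed.

Lemma combH_lin k f g : lin_maps f -> lin_maps g -> lin_maps (combH k f g).
Proof. by move=> lf lg i; apply: linear_comb. Qed.

Lemma differentialE f c : lin_maps f -> cocycle c ->
  cochain_coords c = cochain_coords (differential f) <->
  forall i j, arrow Q i j -> forall v x, c i j v x = f j (rep_map v x) - rep_map (f i v) x.
Proof.
move=> lf cc; split=> [e i j ij v x|e].
  pose d := combE (-1) (differential f) c.
  have cd : cocycle d by apply: cocycle_comb => //; exact: differential_cocycle.
  have d0 : cochain_coords d = 0.
    by rewrite cochain_coords_comb // ?scaleN1r ?e ?addNr //; exact: differential_cocycle.
  have := cochain_coords_eq0 cd d0 ij v x; rewrite /d /combE /differential ij scaleN1r.
  by rewrite {1}/ract scaleN1r addrC => /eqP; rewrite subr_eq0 => /eqP.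
apply/ffunP => -[[i j] [s [t l]]]; rewrite !ffunE /=.
have [ij|/negP nij] := pselect (arrow Q i j); last first.
  by have := ltn_ord l; rewrite /= [X in (_ < X)%N](rd_dim0 _ nij).
suff -> : cochain_coef c s t = cochain_coef (differential f) s t by [].
apply/funext => x; by rewrite /cochain_coef /differential ij e.
Qed.

Lemma card_hom_index : #|{: TH V W}| =
  (\sum_i dim (V i) * (dim (W i) * dim (F i)))%N.
Proof.
rewrite card_tagged sumnE big_map big_enum; apply: eq_bigr => i _.
by rewrite !card_prod !card_ord.
Qed.

Lemma card_cochain_index : #|{: cochain_index}| =
  (\sum_ij dim (V ij.1) * (dim (W ij.2) * rd_dim (arrow_dual ij.1 ij.2)))%N.
Proof.
rewrite card_tagged sumnE big_map big_enum; apply: eq_bigr => i _.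
by rewrite !card_prod !card_ord.
Qed.

Lemma morphism_differential f : lin_maps f -> morphism f <-> cochain_coords (differential f) = 0.
Proof.
have c0 := cocycle0 V W.
have p0 : cochain_coords (@zeroE _ _ _ _ V W) = 0.
  have z : combE (-1) (@zeroE _ _ _ _ V W) (@zeroE _ _ _ _ V W) = @zeroE _ _ _ _ V W.
    by do 4!(apply: functional_extensionality_dep => ?); rewrite /combE /zeroE ract0 addr0.
  by have := cochain_coords_comb (-1) c0 c0; rewrite z scaleN1r addNr.
move=> lf; rewrite -p0; split=> [mf|/esym/differentialE e].
  apply/esym/differentialE => // i j ij v x; by rewrite (mor_map mf) // subrr.
split=> // i j ij v x; apply/eqP; rewrite -subr_eq0 -e //; exact: eqxx.
Qed.

(** Rank-nullity for [differential], read in the coordinates [phiH] and [cochain_coords]; the terms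
    are placed so that no natural number is subtracted. *)
Lemma euler_pair : (hom_dim V W + #|{: cochain_index}| = ext_dim V W + #|{: TH V W}|)%N.
Proof.
have un0 y : exists f, lin_maps f /\ phiH f = y by have [f] := phiH_surj y; exists f.
have [un unP] := choice un0.
have unl y : lin_maps (un y) by case: (unP y).
have unK y : phiH (un y) = y by case: (unP y).
have phiHK f : lin_maps f -> un (phiH f) = f by move=> lf; apply: phiH_inj => //; rewrite unK.
pose D y := cochain_coords (differential (un y)).
have lD : linear D.
  move=> k y z; rewrite /D -[k *: y + z]unK.
  have -> : un (phiH (un (k *: y + z))) = combH k (un y) (un z).
    by apply: phiH_inj => //; [exact: combH_lin|rewrite !unK phiH_comb !unK].
  by rewrite differential_comb // cochain_coords_comb //; apply: differential_cocycle.
pose d : {linear _ -> _} := HB.pack D (GRing.isLinear.Build _ _ _ _ D lD).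
pose delta := linfun d.
have deltaE y : delta y = cochain_coords (differential (un y)) by rewrite lfunE.
have kerE y : (y \in lker delta) = `[< morphism (un y) >].
  rewrite memv_ker deltaE; apply/eqP/asboolP => [|/morphism_differential -> //].
  by move/morphism_differential; apply.
have homE : \dim (lker delta) = hom_dim V W.
  have [e [me ue]] := hom_dimP V W.
  have := @dim_quot_family K _ (lker delta) 0%VS _ (fun k => phiH (e k)).
  rewrite dimv0 addn0; apply; first exact: sub0v.
    by move=> k; rewrite kerE; apply/asboolP; rewrite phiHK //; case: (me k).
  have sumE (a : 'rV[K]_(hom_dim V W)) :
      phiH (fun i v => \sum_k ract (e k i v) (a 0 k)%:A) = \sum_k a 0 k *: phiH (e k) /\
      lin_maps (fun i v => \sum_k ract (e k i v) (a 0 k)%:A).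
    elim: (index_enum _) => [|k r [ih1 ih2]].
      have -> : (fun i v => \sum_(k <- [::]) ract (e k i v) (a 0 k)%:A) = @zeroH _ _ _ _ V W.
        by do 2!(apply: functional_extensionality_dep => ?); rewrite big_nil.
      rewrite big_nil phiH0; split=> //; exact: (mor_lin (morphism0 V W)).
    have -> : (fun i v => \sum_(k <- k :: r) ract (e k i v) (a 0 k)%:A) =
        combH (a 0 k) (e k) (fun i v => \sum_(k <- r) ract (e k i v) (a 0 k)%:A).
      by do 2!(apply: functional_extensionality_dep => ?); rewrite big_cons.
    rewrite phiH_comb ih1 big_cons; split=> //; apply: combH_lin => //.
    exact: (mor_lin (me k)).
  move=> y; rewrite kerE => /asboolP my; have [a [ha ua]] := ue _ my.
  have [s1 s2] := sumE a.
  exists a; split=> [|b].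
    rewrite memv0 subr_eq0 -s1 -{1}[y]unK; apply/eqP; congr phiH.
    by do 2!(apply: functional_extensionality_dep => ?); rewrite ha.
  have [t1 t2] := sumE b.
  rewrite memv0 subr_eq0 -t1 => /eqP yb; apply: ua => i v.
  by rewrite yb phiHK.
have extE : dim {ffun cochain_index -> K^o} = (ext_dim V W + \dim (limg delta))%N.
  have [e [ce ue]] := ext_dimP V W.
  rewrite -dimvf.
  apply: (@dim_quot_family K _ fullv (limg delta) _ (fun k => cochain_coords (e k))).
  - exact: subvf.
  - by move=> k; rewrite memvf.
  have sumE (a : 'rV[K]_(ext_dim V W)) c : cocycle c -> exists2 c' : cochain V W,
      cocycle c' /\ cochain_coords c' = cochain_coords c - \sum_k a 0 k *: cochain_coords (e k) &
      c' = (fun i j v x => c i j v x - \sum_k ract (e k i j v x) (a 0 k)%:A).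
    move=> cc; eexists; last by reflexivity.
    elim: (index_enum _) => [|k r [ih1 ih2]].
      have -> : (fun i j v x => c i j v x - \sum_(k <- [::]) ract (e k i j v x) (a 0 k)%:A) = c.
        by do 4!(apply: functional_extensionality_dep => ?); rewrite big_nil subr0.
      by rewrite big_nil subr0.
    have -> : (fun i j v x => c i j v x - \sum_(k <- k :: r) ract (e k i j v x) (a 0 k)%:A) =
        combE (- a 0 k) (e k)
          (fun i j v x => c i j v x - \sum_(k <- r) ract (e k i j v x) (a 0 k)%:A).
      do 4!(apply: functional_extensionality_dep => ?); rewrite big_cons /combE.
      by rewrite scaleNr opprD addrCA {3}/ract scaleNr.
    rewrite cochain_coords_comb // ih2 big_cons; split; first exact: cocycle_comb.
    by rewrite opprD addrCA scaleNr.
  have cobP c : cocycle c -> (cochain_coords c \in limg delta) <-> coboundary c.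
    move=> cc; split=> [/memv_imgP[y _ h]|[h [lh hE]]].
      exists (un y); split; first exact: unl.
      by apply/differentialE => //; rewrite h deltaE.
    have -> : cochain_coords c = delta (phiH h).
      by rewrite deltaE; apply/differentialE; rewrite ?phiHK.
    by rewrite memv_img // memvf.
  move=> y _; have [c cc <-] := cochain_coords_surj y; have [a [ha ua]] := ue c cc.
  exists a; split=> [|b].
    by have [c' [cc' <-] c'E] := sumE a c cc; apply/cobP => //; rewrite c'E.
  by have [c' [cc' <-] c'E] := sumE b c cc => /(cobP _ cc'); rewrite c'E => /ua.
have := limg_ker_dim delta fullv; rewrite capfv homE dimvf => e0.
have d1 : dim {ffun cochain_index -> K^o} = #|{: cochain_index}| by rewrite -[RHS]muln1.
have dH : dim {ffun TH V W -> K^o} = #|{: TH V W}| by rewrite -[RHS]muln1.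
by rewrite -d1 extE -dH -e0 addnCA.
Qed.

End Pair.

Definition arrow_const (a : 'I_n * 'I_n) : nat := rd_dim (arrow_dual a.1 a.2).

(** The form is extended to vectors over R because roots will be expanded with real coefficients.
    The constants [arrow_const] stay abstract: the arguments use bilinearity and the values given by
    [eulerE]. *)
Definition euler (R : realDomainType) (x y : 'rV[R]_n) : R :=
  \sum_i (qval Q i)%:R * x 0 i * y 0 i -
  \sum_a (arrow_const a)%:R * x 0 a.1 * y 0 a.2.

Definition natv (R : realDomainType) (d : 'rV[nat]_n) : 'rV[R]_n := \row_i (d 0 i)%:R.

Lemma eulerE (R : realDomainType) (V W : rep) : euler (natv R (dimvec V)) (natv R (dimvec W)) =
  (hom_dim V W)%:R - (ext_dim V W)%:R.
Proof.
apply/eqP; rewrite /euler subr_eq addrAC eq_sym subr_eq; apply/eqP.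
have := euler_pair V W; rewrite card_cochain_index card_hom_index.
move=> /(congr1 (fun k : nat => k%:R : R)).
rewrite !natrD !natr_sum => e.
have h i : (dim (V i) * (dim (W i) * dim (F i)))%:R =
    (qval Q i)%:R * natv R (dimvec V) 0 i * natv R (dimvec W) 0 i.
  by rewrite !mxE !natrM -(mod_alg_dim Mod) dimvf; ring.
have g (a : 'I_n * 'I_n) : (dim (V a.1) * (dim (W a.2) * rd_dim (arrow_dual a.1 a.2)))%:R =
    (arrow_const a)%:R * natv R (dimvec V) 0 a.1 * natv R (dimvec W) 0 a.2.
  by rewrite !mxE !natrM; ring.
by rewrite -(eq_bigr _ (fun i _ => h i)) -(eq_bigr _ (fun a _ => g a)) e addrC.
Qed.

Lemma euler_linear_l (R : realDomainType) (y : 'rV[R]_n) a b x z :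
  euler (a *: x + b *: z) y = a * euler x y + b * euler z y.
Proof.
rewrite /euler !mulrBr addrACA -opprD !mulr_sumr -!big_split /=; congr (_ - _).
  by apply: eq_bigr => i _; rewrite !mxE; ring.
by apply: eq_bigr => i _; rewrite !mxE; ring.
Qed.

Lemma euler_linear_r (R : realDomainType) (y : 'rV[R]_n) a b x z :
  euler y (a *: x + b *: z) = a * euler y x + b * euler y z.
Proof.
rewrite /euler !mulrBr addrACA -opprD !mulr_sumr -!big_split /=; congr (_ - _).
  by apply: eq_bigr => i _; rewrite !mxE; ring.
by apply: eq_bigr => i _; rewrite !mxE; ring.
Qed.

End Euler.

(** * Divisibility of Hom dimensions and uniqueness of exceptional modules *)

Section EulerConsequences.
Local Open Scope classical_set_scope.
Local Open Scope ring_scope.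
Variables (K : fieldType) (n : nat) (Q : valued_quiver n) (Mod : modulation K Q).
Local Notation rep := (rep Mod).
Implicit Types V W X Y M N T I E L : rep.

(** Hom(V, W) is given by a predicate on families; this K-linear bijection with row vectors makes it
    a vector space to which [division_dvd_dim] applies. *)
Lemma hom_coordinates V W : exists (un : 'rV[K]_(hom_dim V W) -> forall i, V i -> W i) co,
  [/\ forall a, morphism (un a),
      forall k a b, un (k *: a + b) = combH k (un a) (un b),
      forall f, morphism f -> un (co f) = f &
      forall a, co (un a) = a].
Proof.
have [e [me ue]] := hom_dimP V W.
pose un (a : 'rV[K]_(hom_dim V W)) : forall i, V i -> W i :=
  fun i v => \sum_k ract (e k i v) (a 0 k)%:A.
have unP k a b : un (k *: a + b) = combH k (un a) (un b).
  do 2!(apply: functional_extensionality_dep => ?).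
  rewrite /combH /un ract_sum -big_split; apply: eq_bigr => l _ /=.
  rewrite !mxE -ractA -ractDr; congr ract.
  by rewrite scalerDl mulr_algr scalerA.
have mun a : morphism (un a).
  rewrite /un; elim: (index_enum _) => [|k r ih].
    have -> : (fun i v => \sum_(k <- [::]) ract (e k i v) (a 0 k)%:A) = @zeroH _ _ _ _ V W.
      by do 2!(apply: functional_extensionality_dep => ?); rewrite big_nil.
    exact: morphism0.
  have -> : (fun i v => \sum_(k <- k :: r) ract (e k i v) (a 0 k)%:A) =
      combH (a 0 k) (e k) (fun i v => \sum_(k <- r) ract (e k i v) (a 0 k)%:A).
    by do 2!(apply: functional_extensionality_dep => ?); rewrite big_cons.
  exact: morphism_comb.
have coE f : exists a, morphism f -> un a = f.
  have [mf|nf] := pselect (morphism f); last by exists 0.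
  have [a [ha _]] := ue f mf; exists a => _.
  by do 2!(apply: functional_extensionality_dep => ?); rewrite ha.
have [co hco] := choice coE.
exists un, co; split=> // a.
have [b [_ ub]] := ue (un a) (mun a).
transitivity b; last by apply: ub.
by apply/esym/ub => i v; rewrite -[LHS](congr1 (fun f => f i v) (hco _ (mun a))).
Qed.

Lemma hom_dim_eq0 V W : hom_dim V W = 0%N <-> hom0 V W.
Proof.
have [e [me ue]] := hom_dimP V W.
split=> [d0 f mf i v|h0].
  have [a [ha _]] := ue f mf; rewrite ha big1 // => k.
  by have := ltn_ord k; rewrite [X in (_ < X)%N]d0.
apply/eqP; rewrite -leqn0 leqNgt; apply/negP => d0.
have [|a [_ ua]] := ue (fun i _ => 0); first exact: morphism_zero.
have z (b : 'rV[K]_(hom_dim V W)) i (v : V i) : 0 = \sum_k ract (e k i v) (b 0 k)%:A.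
  by rewrite big1 // => k _; rewrite (h0 _ (me k)) ract0.
have := etrans (esym (ua 0 (z 0))) (ua (const_mx 1) (z _)).
move=> /rowP /(_ (Ordinal d0)); rewrite !mxE => /esym/eqP.
by rewrite oner_eq0.
Qed.

Lemma hom_dim_neq0 V W (f : forall i, V i -> W i) : morphism f ->
  ~ (forall i v, f i v = 0) -> hom_dim V W <> 0%N.
Proof. by move=> mf nf /hom_dim_eq0 h0; apply: nf; exact: h0. Qed.

Lemma embeds_hom_neq0 V W : dimvec V <> 0 -> embeds V W -> hom_dim V W <> 0%N.
Proof.
move=> V0 [f mf fI]; apply: (hom_dim_neq0 mf) => f0.
by apply/V0/dimvec0P => i v; apply: (fI i); rewrite f0 (mor0 mf).
Qed.

Lemma projects_hom_neq0 V W : dimvec W <> 0 -> projects V W -> hom_dim V W <> 0%N.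
Proof.
move=> W0 [f mf fS]; apply: (hom_dim_neq0 mf) => f0.
by apply/W0/dimvec0P => i w; have [v <-] := fS i w; rewrite f0.
Qed.

Lemma division_end_hom_gt0 V : division_end V -> (0 < hom_dim V V)%N.
Proof.
move=> dV; rewrite lt0n; apply/eqP/embeds_hom_neq0; last exact: embeds_refl.
exact: division_end_neq0.
Qed.

Lemma combH_post V W X k (f g : forall i, V i -> W i) (h : forall i, W i -> X i) :
  morphism h -> (fun i v => h i (combH k f g v)) =
  combH k (fun i v => h i (f i v)) (fun i v => h i (g i v)).
Proof.
move=> mh; do 2!(apply: functional_extensionality_dep => ?); rewrite /combH.
by rewrite (linear_add (mor_lin mh _)) (linear_ract (mor_lin mh _)).
Qed.

(** Precomposition makes Hom(V, W) a right vector space over the division algebra End(V). *)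
Lemma division_end_dvd_l V W : division_end V -> (hom_dim V V %| hom_dim V W)%N.
Proof.
move=> [_ dV].
have [un [co [mun unP unK coK]]] := hom_coordinates V V.
have [un' [co' [mun' unP' unK' coK']]] := hom_coordinates V W.
have mc a b : morphism (fun i v => un' a i (un b i v)) by exact: morphism_comp.
have mc0 a b : morphism (fun i v => un a i (un b i v)) by exact: morphism_comp.
have co'P k f g : morphism f -> morphism g -> co' (combH k f g) = k *: co' f + co' g.
  by move=> mf mg; rewrite -{1}(unK' f) // -{1}(unK' g) // -unP' coK'.
have := @division_dvd_dim K 'rV[K]_(hom_dim V W) 'rV[K]_(hom_dim V V)
  (fun h u => co' (fun i v => un' h i (un u i v)))
  (fun u w => co (fun i v => un u i (un w i v))).
rewrite !dim_rV; apply.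
- by move=> h k u w; rewrite unP combH_post // co'P.
- by move=> h u w; rewrite unK' // unK.
- move=> u k h h'; rewrite unP' -co'P //; congr co'.
- by exists (co (fun i v => v)) => h; rewrite unK ?coK' //; exact: morphism_id.
- move=> u u0; have [|g mg gK] := dV (un u) (mun u).
  + apply: contrapT => h; move/eqP: u0; apply; rewrite -[u]coK -[0]coK; congr co.
    apply: functional_extensionality_dep => i; apply: functional_extensionality_dep => v.
    transitivity (0 : V i).
      by apply: contrapT => /eqP e; apply: h; exists i, v.
    have := unP (-1) 0 0; rewrite scaler0 addr0 => /(congr1 (fun f => f i v)).
    by rewrite /combH scaleN1r /ract scaleN1r addNr.
  exists (co g) => h; rewrite unK // unK' // -[RHS]coK'; congr co'.
  by do 2!(apply: functional_extensionality_dep => ?); rewrite (gK _).2.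
Qed.

(** Here End(V) acts by postcomposition, so the product passed to [division_dvd_dim] is the opposite
    one. *)
Lemma division_end_dvd_r V W : division_end V -> (hom_dim V V %| hom_dim W V)%N.
Proof.
move=> [_ dV].
have [un [co [mun unP unK coK]]] := hom_coordinates V V.
have [un' [co' [mun' unP' unK' coK']]] := hom_coordinates W V.
have mc a b : morphism (fun i v => un b i (un' a i v)) by exact: morphism_comp.
have mc0 a b : morphism (fun i v => un a i (un b i v)) by exact: morphism_comp.
have co'P k f g : morphism f -> morphism g -> co' (combH k f g) = k *: co' f + co' g.
  by move=> mf mg; rewrite -{1}(unK' f) // -{1}(unK' g) // -unP' coK'.
have := @division_dvd_dim K 'rV[K]_(hom_dim W V) 'rV[K]_(hom_dim V V)
  (fun h u => co' (fun i v => un u i (un' h i v)))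
  (fun u w => co (fun i v => un w i (un u i v))).
rewrite !dim_rV; apply.
- by move=> h k u w; rewrite unP -co'P.
- by move=> h u w; rewrite unK' // unK.
- by move=> u k h h'; rewrite unP' combH_post // co'P.
- by exists (co (fun i v => v)) => h; rewrite unK ?coK' //; exact: morphism_id.
- move=> u u0; have [|g mg gK] := dV (un u) (mun u).
  + apply: contrapT => h; move/eqP: u0; apply; rewrite -[u]coK -[0]coK; congr co.
    apply: functional_extensionality_dep => i; apply: functional_extensionality_dep => v.
    transitivity (0 : V i).
      by apply: contrapT => /eqP e; apply: h; exists i, v.
    have := unP (-1) 0 0; rewrite scaler0 addr0 => /(congr1 (fun f => f i v)).
    by rewrite /combH scaleN1r /ract scaleN1r addNr.
  exists (co g) => h; rewrite unK // unK' // -[RHS]coK'; congr co'.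
  by do 2!(apply: functional_extensionality_dep => ?); rewrite (gK _).1.
Qed.

Lemma ext0_euler (R : realDomainType) V W : ext0 V W ->
  euler Mod (natv R (dimvec V)) (natv R (dimvec W)) = (hom_dim V W)%:R.
Proof. by move=> /ext0P e; rewrite eulerE e subr0. Qed.

Lemma hom0_euler (R : realDomainType) V W : hom0 V W ->
  euler Mod (natv R (dimvec V)) (natv R (dimvec W)) = - (ext_dim V W)%:R.
Proof. by move=> /hom_dim_eq0 e; rewrite eulerE e sub0r. Qed.

(* If f : V -> W is neither 0 nor injective and I is its image, then Ext(I, W) = 0,
   so <I, V> = <I, W> > 0 gives a nonzero map I -> V and a non injective nonzero
   endomorphism V -> I -> V. *)
Lemma exceptional_unique V W : exceptional V -> exceptional W -> dimvec V = dimvec W ->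
  exists2 f : (forall i, V i -> W i), morphism f &
    (forall i, injective (f i)) /\ (forall i w, exists v, f i v = w).
Proof.
move=> /exceptionalP[dV eV] /exceptionalP[dW eW] e.
have homVW : ~ hom0 V W.
  move=> h0; have := hom0_euler int h0; rewrite -e (ext0_euler _ eV) => h.
  have : (0 : int) < (hom_dim V V)%:R by rewrite ltr0n; exact: division_end_hom_gt0.
  by rewrite h oppr_gt0 ltNge ler0n.
have [f mf nf] := hom0_neg homVW.
have [N [I [k [q [j [kq mj jI jE]]]]]] := kernel_image mf.
have IW : embeds I W by exists j.
have I0 := image_neq0 mj jE nf.
have [|g mg ng] := @hom0_neg _ _ _ _ I V.
  move=> h0; have := hom0_euler int h0; rewrite e (ext0_euler _ (ext0_embeds IW eW)) => h.
  have : (0 : int) < (hom_dim I W)%:R.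
    by rewrite ltr0n lt0n; apply/eqP/embeds_hom_neq0.
  by rewrite h oppr_gt0 ltNge ler0n.
have [mk mq kI qS exk] := kq.
have gqI := division_end_inj dV (morphism_comp mq mg).
have fI : forall i, injective (f i).
  move=> i u v fuv; apply: gqI => [h|].
    by apply: ng => l w; have [x <-] := qS l w; exact: h.
  by have /jI -> : j i (q i u) = j i (q i v) by rewrite !jE.
by exists f => //; split=> //; exact: dimvec_inj_surj.
Qed.

Lemma root_moduleP beta : real_schur_root Mod beta ->
  exceptional (root_module Mod beta) /\ dimvec (root_module Mod beta) = beta.
Proof.
move=> [V eV dV]; rewrite /root_module; case: pselect => [ex|nex].
  exact: (projT2 (cid ex)).
by exfalso; apply: nex; exists V.
Qed.

(** By uniqueness, an exceptional module found as a factor can be exchanged for the chosen module of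
    its dimension vector. *)
Lemma root_module_iso L : exceptional L ->
  [/\ real_schur_root Mod (dimvec L), embeds (root_module Mod (dimvec L)) L,
      embeds L (root_module Mod (dimvec L)) & projects L (root_module Mod (dimvec L))].
Proof.
move=> eL; have rL : real_schur_root Mod (dimvec L) by exists L.
have [eR dR] := root_moduleP rL.
have [f mf [fI fS]] := exceptional_unique eL eR (esym dR).
have [g mg gK] := morphism_bij_inv mf fI fS.
split=> //; [exists g => // i|by exists f|by exists f].
exact: can_inj (gK i).2.
Qed.

Lemma projects_kernel M X : projects M X ->
  exists N io p, @short_exact _ _ _ _ X N M io p.
Proof.
move=> [f mf fS]; have [N [I [k [q [j [[mk mq kI qS exk] mj jI jE]]]]]] := kernel_image mf.
exists N, k, f; split=> // i e; rewrite -jE -(mor0 mj i); split=> [/jI/exk //|/exk ->].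
by [].
Qed.

End EulerConsequences.

(** * Walls and semistability *)

Lemma ex_argmax_dimvec (n : nat) (R : realDomainType) (P : 'rV[nat]_n -> Prop)
    (f : 'rV[nat]_n -> R) (b : nat) : (exists d, P d) ->
  (forall d, P d -> forall i, (d 0%R i <= b)%N) ->
  exists d, P d /\ forall d', P d' -> (f d' <= f d)%R.
Proof.
move=> [d0 Pd0] Pb.
pose T := {ffun 'I_n -> 'I_b.+1}.
pose v (t : T) : 'rV[nat]_n := (\row_i (t i : nat))%R.
have vS d : P d -> exists t, v t = d.
  move=> /Pb db; exists [ffun i => inord (d 0%R i)]; apply/rowP => i.
  by rewrite mxE ffunE inordK // ltnS.
have [t0 vt0] := vS d0 Pd0.
have Pt0 : `[< P (v t0) >] by apply/asboolP; rewrite vt0.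
case: (@Order.TotalTheory.arg_maxP _ _ T t0 (fun t => `[< P (v t) >])
  (fun t => f (v t)) Pt0) => t /asboolP Pt tmax.
exists (v t); split=> // d' Pd'; have [t' e] := vS d' Pd'.
by rewrite -e; apply: tmax; apply/asboolP; rewrite e.
Qed.

Section Stability.
Local Open Scope classical_set_scope.
Local Open Scope ring_scope.
Variables (K : fieldType) (n : nat) (Q : valued_quiver n) (Mod : modulation K Q).
Variable R : realType.
Local Notation rep := (rep Mod).
Local Notation pairing := (pairing Q).
Local Notation RM := (root_module Mod).
Implicit Types (x y : 'rV[R]_n) (V W X Y M N T I E L : rep).

Definition subdim (beta d : 'rV[nat]_n) := exists2 N, embeds N (RM beta) & dimvec N = d.

(** King's semistability of M_beta for the weight x. All submodules are tested, so that kernels and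
    images can be used directly. *)
Definition semistable x beta :=
  pairing x beta = 0 /\ forall d, subdim beta d -> pairing x d <= 0.

Definition stable x beta := pairing x beta = 0 /\
  forall d, subdim beta d -> d <> 0 -> d <> beta -> pairing x d < 0.

Lemma pairingD x (a b : 'rV[nat]_n) : pairing x (a + b) = pairing x a + pairing x b.
Proof.
rewrite /pairing -big_split; apply: eq_bigr => i _ /=.
by rewrite mxE natrD mulrDr mulrDl.
Qed.

Lemma pairing0 x : pairing x (0 : 'rV[nat]_n) = 0.
Proof. by rewrite /pairing big1 // => i _; rewrite mxE mulr0 mul0r. Qed.

Lemma subdim_refl beta : real_schur_root Mod beta -> subdim beta beta.
Proof. by move=> /root_moduleP[_ d]; exists (RM beta) => //; exact: embeds_refl. Qed.

Lemma stable_semistable x beta : stable x beta -> semistable x beta.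
Proof.
move=> [x0 h]; split=> // d sd.
have [->|/eqP d0] := eqVneq d 0; first by rewrite pairing0.
have [->|/eqP db] := eqVneq d beta; first by rewrite x0.
exact/ltW/h.
Qed.

Lemma embeds_quot_dimvec V W : embeds V W ->
  exists X, projects W X /\ dimvec W = dimvec V + dimvec X.
Proof.
move=> [f mf fI]; have [X [p fp]] := cokernel mf fI; exists X.
split; [exact: short_exact_projects fp|exact: short_exact_dimvec fp].
Qed.

Lemma subdim_le beta d : real_schur_root Mod beta -> subdim beta d ->
  forall i, (d 0%R i <= beta 0%R i)%N.
Proof.
move=> /root_moduleP[_ db] [N NR <-] i; have [X [_ e]] := embeds_quot_dimvec NR.
by rewrite -db e [leqRHS]mxE; exact: leq_addr.
Qed.

(** If some submodule has positive pairing, so do the submodules of maximal slope, as in a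
    Harder-Narasimhan filtration. A smallest one of these is exceptional, hence a subroot with
    positive pairing, which the wall forbids. *)
Lemma wall_semistable x beta : real_schur_root Mod beta ->
  wall Mod beta x <-> semistable x beta.
Proof.
move=> rb; split=> -[x0 h]; split=> //; last first.
  by move=> b' [rb' eb']; apply: h; exists (RM b') => //; case: (root_moduleP rb').
have [eR dR] := root_moduleP rb; have [_ rigid] := (exceptionalP _).1 eR.
move=> d1 sd1; rewrite leNgt; apply/negP => d1pos.
pose slope (d : 'rV[nat]_n) := pairing x d / (dsize d)%:R.
have [||d0 [[sd0 d0n] d0max]] := @ex_argmax_dimvec n R
    (fun d => subdim beta d /\ d <> 0) slope (\sum_i beta 0%R i)%N.
- by exists d1; split=> // z; move: d1pos; rewrite z pairing0 ltxx.
- move=> d [sd _] i; apply: leq_trans (subdim_le rb sd i) _.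
  by rewrite (bigD1 i) //= leq_addr.
set mu := slope d0 in d0max.
have sizeP (d : 'rV[nat]_n) : d <> 0 -> 0 < (dsize d)%:R :> R by move=> /dsize_gt0; rewrite ltr0n.
have mu0 : 0 < mu.
  have d1n : d1 <> 0 by move=> z; move: d1pos; rewrite z pairing0 ltxx.
  by apply: lt_le_trans (d0max _ (conj sd1 d1n)); rewrite divr_gt0 ?sizeP.
pose th (d : 'rV[nat]_n) := pairing x d - mu * (dsize d)%:R.
have thD a b : th (a + b) = th a + th b.
  by rewrite /th pairingD dsizeD natrD mulrDr opprD addrACA.
have thle N : embeds N (RM beta) -> th (dimvec N) <= 0.
  move=> Nb; have [->|/eqP N0] := eqVneq (dimvec N) 0; first by rewrite (th_0 thD).
  have sN : subdim beta (dimvec N) by exists N.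
  by rewrite /th subr_le0 -ler_pdivrMr ?sizeP //; exact: d0max.
have [|L [[LR [L0 thL]] Lmin]] := @ex_argmin rep (fun N => embeds N (RM beta) /\
    dimvec N <> 0 /\ th (dimvec N) = 0) (fun N => dsize (dimvec N)).
  case: sd0 => N NR dN; exists N; rewrite dN; split=> //; split=> //.
  by rewrite /th /mu /slope divfK ?subrr // gt_eqF ?sizeP.
have Lmin' N : embeds N (RM beta) -> dimvec N <> 0 -> th (dimvec N) = 0 ->
    (dsize (dimvec L) <= dsize (dimvec N))%N by move=> *; apply: Lmin.
have eL : exceptional L.
  apply/exceptionalP; split; first exact (sub_division_end thD thle LR L0 thL Lmin').
  exact: (sub_rigid thD rigid thle LR L0 thL Lmin').
have [rL RL _ _] := root_module_iso eL.
have := h _ (conj rL (embeds_trans RL LR)).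
move: thL; rewrite /th => /eqP; rewrite subr_eq0 => /eqP ->.
by rewrite leNgt mulr_gt0 ?sizeP.
Qed.

(** A smallest nonzero submodule L of pairing 0 is exceptional. It is stable because a nonzero
    submodule of L with pairing 0 cannot be smaller than L. *)
Lemma stable_sub x beta : real_schur_root Mod beta -> semistable x beta ->
  exists beta', [/\ subroot Mod beta' beta, subdim beta beta', stable x beta' &
    rhom Mod beta' beta <> 0%N].
Proof.
move=> rb [x0 h]; have [eR dR] := root_moduleP rb.
have [dV rigid] := (exceptionalP _).1 eR.
have thle N : embeds N (RM beta) -> pairing x (dimvec N) <= 0.
  by move=> NR; apply: h; exists N.
have [|L [[LR [L0 thL]] Lmin]] := @ex_argmin rep (fun N => embeds N (RM beta) /\
    dimvec N <> 0 /\ pairing x (dimvec N) = 0) (fun N => dsize (dimvec N)).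
  exists (RM beta); split; first exact: embeds_refl.
  by split; [exact: division_end_neq0|rewrite dR].
have Lmin' N : embeds N (RM beta) -> dimvec N <> 0 -> pairing x (dimvec N) = 0 ->
    (dsize (dimvec L) <= dsize (dimvec N))%N by move=> *; apply: Lmin.
have eL : exceptional L.
  apply/exceptionalP; split; first exact: (sub_division_end (pairingD x) thle LR L0 thL Lmin').
  exact: (sub_rigid (pairingD x) rigid thle LR L0 thL Lmin').
have [rL RL LRL _] := root_module_iso eL.
have RLb := embeds_trans RL LR.
exists (dimvec L); split=> //; first by exists L.
  split=> // d [N NL dN] d0 dL; rewrite lt_neqAle -dN thle ?andbT; last exact: embeds_trans NL RLb.
  apply/eqP => e; apply: dL; rewrite -dN.
  have NL' := embeds_trans NL RL.
  apply: (embeds_dimvec_eq NL'); apply: Lmin' => //; first exact: embeds_trans NL' LR.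
  by rewrite dN.
by apply: embeds_hom_neq0 => //; rewrite (root_moduleP rL).2.
Qed.

(** Quotients of a semistable module of pairing 0 have pairing at least 0, so the dual argument
    applies to a smallest nonzero quotient of pairing 0. *)
Lemma stable_quot x beta : real_schur_root Mod beta -> semistable x beta ->
  exists beta', [/\ quotient_root Mod beta' beta, stable x beta' &
    rhom Mod beta beta' <> 0%N].
Proof.
move=> rb [x0 h]; have [eR dR] := root_moduleP rb.
have [dV rigid] := (exceptionalP _).1 eR.
have thge N : projects (RM beta) N -> 0 <= pairing x (dimvec N).
  move=> /projects_kernel[N1 [io [p iop]]]; have := short_exact_dimvec iop.
  rewrite dR => e; move: x0; rewrite e pairingD => /eqP; rewrite addr_eq0 => /eqP e2.
  rewrite -oppr_le0 -e2; apply: h; exists N1 => //.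
  exact: short_exact_embeds iop.
have [|L [[LR [L0 thL]] Lmin]] := @ex_argmin rep (fun N => projects (RM beta) N /\
    dimvec N <> 0 /\ pairing x (dimvec N) = 0) (fun N => dsize (dimvec N)).
  exists (RM beta); split; first exact: projects_refl.
  by split; [exact: division_end_neq0|rewrite dR].
have Lmin' N : projects (RM beta) N -> dimvec N <> 0 -> pairing x (dimvec N) = 0 ->
    (dsize (dimvec L) <= dsize (dimvec N))%N by move=> *; apply: Lmin.
have eL : exceptional L.
  apply/exceptionalP; split; first exact: (quot_division_end (pairingD x) thge LR L0 thL Lmin').
  exact: (quot_rigid (pairingD x) rigid thge LR L0 thL Lmin').
have [rL RL _ LRL] := root_module_iso eL.
have Rb := projects_trans LR LRL.
exists (dimvec L); split=> //; last first.
  by apply: projects_hom_neq0 => //; rewrite (root_moduleP rL).2.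
split=> // d [N NL dN] d0 dL.
have [X [LX e]] := embeds_quot_dimvec (embeds_trans NL RL).
have RX := projects_trans LR LX.
have X0 : dimvec X <> 0 by move=> z; apply: dL; rewrite -dN e z addr0.
have := thL; rewrite e pairingD dN => /eqP; rewrite addr_eq0 => /eqP ->.
rewrite oppr_lt0 lt_neqAle thge // andbT eq_sym; apply/eqP => thX.
have := Lmin' _ RX X0 thX; rewrite e dsizeD -[leqRHS]add0n leq_add2r leqn0 dN.
by move=> /eqP/dsize_eq0.
Qed.

(** Schur's lemma: the image of a nonzero map has pairing 0, so it is all of M_b by stability of b,
    and the kernel is 0 by stability of a. *)
Lemma stable_orthogonal x a b : real_schur_root Mod a -> real_schur_root Mod b ->
  stable x a -> stable x b -> a <> b -> hom0 (RM a) (RM b).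
Proof.
move=> ra rb sa sb ab f mf; apply: contrapT => nf0.
have nf : ~ (forall i v, f i v = 0) by move=> z; exact: nf0.
have [N [I [k [q [j [kq mj jI jE]]]]]] := kernel_image mf.
have I0 := image_neq0 mj jE nf.
have [_ da] := root_moduleP ra; have [_ db] := root_moduleP rb.
have e := short_exact_dimvec kq; rewrite da in e.
have sI : subdim b (dimvec I) by exists I => //; exists j.
have sN : subdim a (dimvec N) by exists N => //; exact: short_exact_embeds kq.
have tI := (stable_semistable sb).2 _ sI; have tN := (stable_semistable sa).2 _ sN.
have eI : pairing x (dimvec I) = 0.
  have := sa.1; rewrite e pairingD => /eqP; rewrite addr_eq0 => /eqP eN.
  by apply/eqP; rewrite eq_le tI -oppr_le0 -eN.
have Ib : dimvec I = b.
  by apply: contrapT => h; have := sb.2 _ sI I0 h; rewrite eI ltxx.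
have [N0|/eqP N0] := eqVneq (dimvec N) 0; first by apply: ab; rewrite e N0 add0r.
have Na : dimvec N <> a.
  by move=> h; apply: I0; move: e; rewrite h => /dimvec_cancel.
have := sa.2 _ sN N0 Na; have := sa.1; rewrite e pairingD eI addr0 => ->.
by rewrite ltxx.
Qed.

(** A nonzero kernel would have negative pairing and leave an image of positive pairing in M_b. *)
Lemma stable_embeds x a b : real_schur_root Mod a -> real_schur_root Mod b ->
  stable x a -> semistable x b -> rhom Mod a b <> 0%N -> subdim b a.
Proof.
move=> ra rb sa sb hab; have [f mf nf] : exists2 f : (forall i, RM a i -> RM b i),
    morphism f & ~ (forall i v, f i v = 0).
  by apply: hom0_neg => /hom_dim_eq0.
have [N [I [k [q [j [kq mj jI jE]]]]]] := kernel_image mf.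
have I0 := image_neq0 mj jE nf.
have [_ da] := root_moduleP ra.
have e := short_exact_dimvec kq; rewrite da in e.
have sI : subdim b (dimvec I) by exists I => //; exists j.
have sN : subdim a (dimvec N) by exists N => //; exact: short_exact_embeds kq.
have [N0|/eqP N0] := eqVneq (dimvec N) 0; first by move: sI; rewrite e N0 add0r.
have Na : dimvec N <> a.
  by move=> h; apply: I0; move: e; rewrite h => /dimvec_cancel.
have := sa.2 _ sN N0 Na; have := sa.1; rewrite e pairingD => /eqP; rewrite addr_eq0 => /eqP ->.
by rewrite oppr_lt0 ltNge (sb.2 _ sI).
Qed.

(* A maximal destabilizing submodule T of M has Hom(T, M/T) = 0 and maps trivially to
   semistable modules. *)
Lemma destabilizing_sub x gamma : real_schur_root Mod gamma -> pairing x gamma = 0 ->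
  ~ semistable x gamma ->
  exists T X io p, [/\ @short_exact _ _ _ _ X T (RM gamma) io p,
    0 < pairing x (dimvec T), hom0 T X &
    forall a, real_schur_root Mod a -> semistable x a -> hom0 T (RM a)].
Proof.
move=> rg xg nss; have [_ dg] := root_moduleP rg.
have [d1 sd1 d1pos] : exists2 d, subdim gamma d & 0 < pairing x d.
  apply: contrapT => h; apply: nss; split=> // d sd; rewrite leNgt; apply/negP => dpos.
  by apply: h; exists d.
have [||d0 [sd0 d0max]] := @ex_argmax_dimvec n R (subdim gamma) (pairing x)
    (\sum_i gamma 0%R i)%N.
- by exists d1.
- move=> d sd i; apply: leq_trans (subdim_le rg sd i) _.
  by rewrite (bigD1 i) //= leq_addr.
have [|T [[[io mio ioI] xT] Tmin]] := @ex_argmin rep (fun N => embeds N (RM gamma) /\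
    pairing x (dimvec N) = pairing x d0) (fun N => dsize (dimvec N)).
  by case: sd0 => N NR dN; exists N; rewrite dN.
have TR : embeds T (RM gamma) by exists io.
have [X [p iop]] := cokernel mio ioI.
(* T is a smallest submodule of maximal pairing, so the kernel of a nonzero map on T has strictly
   smaller pairing and the image a positive one. *)
have T_sub Y (f : forall i, T i -> Y i) : morphism f -> ~ (forall i v, f i v = 0) ->
    exists I j, [/\ @morphism _ _ _ _ I Y j, forall i, injective (j i) & 0 < pairing x (dimvec I)].
  move=> mf nf; have [N [I [k [q [j [kq mj jI jE]]]]]] := kernel_image mf.
  exists I, j; split=> //; have I0 := image_neq0 mj jE nf.
  have NT := short_exact_embeds kq; have NR := embeds_trans NT TR.
  have e := short_exact_dimvec kq.
  rewrite -[X in 0 < X](addKr (pairing x (dimvec N))) -pairingD -e addrC subr_gt0 xT.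
  have sN : subdim gamma (dimvec N) by exists N.
  rewrite lt_neqAle d0max // andbT; apply/eqP => eN.
  have := Tmin N (conj NR eN); rewrite e dsizeD -[leqRHS]addn0 leq_add2l leqn0.
  by move=> /eqP/dsize_eq0.
exists T, X, io, p; split=> //; first by rewrite xT; apply: lt_le_trans d1pos (d0max _ sd1).
  move=> f mf; apply: contrapT => nf0.
  have nf : ~ (forall i v, f i v = 0) by move=> z; exact: nf0.
  have [I [j [mj jI xI]]] := T_sub _ f mf nf.
  (* The preimage N of the image of f would exceed the maximal pairing. *)
  have [N [k [b [a [[kb ma aI _ _] _]]]]] := pullback iop mj jI.
  have sN : subdim gamma (dimvec N) by exists N => //; exists a.
  have := d0max _ sN; rewrite (short_exact_dimvec kb) pairingD xT.
  by rewrite -subr_ge0 opprD addNKr oppr_ge0 leNgt xI.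
move=> a ra sa f mf; apply: contrapT => nf0.
have nf : ~ (forall i v, f i v = 0) by move=> z; exact: nf0.
have [I [j [mj jI xI]]] := T_sub _ f mf nf.
have : pairing x (dimvec I) <= 0 by apply: sa.2; exists I => //; exists j.
by rewrite leNgt xI.
Qed.

Lemma rhom_rext_euler a b : real_schur_root Mod a -> real_schur_root Mod b ->
  euler Mod (natv R a) (natv R b) = (rhom Mod a b)%:R - (rext Mod a b)%:R.
Proof.
by move=> /root_moduleP[_ da] /root_moduleP[_ db]; rewrite -{1}da -{1}db eulerE.
Qed.

Lemma euler_root_gt0 a : real_schur_root Mod a ->
  0 < euler Mod (natv R a) (natv R a) /\
  euler Mod (natv R a) (natv R a) = (rhom Mod a a)%:R.
Proof.
move=> /root_moduleP[/exceptionalP[da ea] e].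
rewrite -{1 2 3 4}e ext0_euler //; split=> //.
by rewrite ltr0n division_end_hom_gt0.
Qed.

(** A destabilizing T has <T, gamma> > 0, because T embeds in the rigid M_gamma; but <T, a> and <T,
    b> are at most 0, because T has no nonzero map to M_a or M_b. *)
Lemma semistable_combination x a b gamma (p q : R) : real_schur_root Mod a ->
  real_schur_root Mod b -> real_schur_root Mod gamma ->
  semistable x a -> semistable x b -> 0 <= p -> 0 <= q ->
  natv R gamma = p *: natv R a + q *: natv R b -> pairing x gamma = 0 ->
  semistable x gamma.
Proof.
move=> ra rb rg sa sb p0 q0 e xg; apply: contrapT => /(destabilizing_sub rg xg).
move=> [T [X [io [pr [iop xT _ hT]]]]].
have [_ da] := root_moduleP ra; have [_ db] := root_moduleP rb.
have [/exceptionalP[_ rigid] dg] := root_moduleP rg.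
have TR := short_exact_embeds iop.
have T0 : dimvec T <> 0 by move=> z; move: xT; rewrite z pairing0 ltxx.
have := ext0_euler R (ext0_embeds TR rigid).
rewrite dg e euler_linear_r -{1}da -{1}db (hom0_euler R (hT a ra sa)).
rewrite (hom0_euler R (hT b rb sb)) => h.
have : 0 < (hom_dim T (RM gamma))%:R :> R.
  by rewrite ltr0n lt0n; apply/eqP/embeds_hom_neq0.
by rewrite -h !mulrN -opprD oppr_gt0 ltNge addr_ge0 // mulr_ge0.
Qed.

Lemma pairing_natv x (d d1 d2 : 'rV[nat]_n) (p q : R) :
  natv R d = p *: natv R d1 + q *: natv R d2 ->
  pairing x d = p * pairing x d1 + q * pairing x d2.
Proof.
move=> /rowP e; rewrite /pairing !mulr_sumr -big_split; apply: eq_bigr => i _ /=.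
have := e i; rewrite !mxE => ->; ring.
Qed.

(* If T is the maximal destabilizing submodule of M and X = M/T, then <T, X> = 0 while
   <X, T> < 0 because M is indecomposable; the signs contradict <a, b> = 0. *)
Lemma semistable_near x0 x a b gamma (p q : R) : real_schur_root Mod a ->
  real_schur_root Mod b -> real_schur_root Mod gamma ->
  rhom Mod a b = 0%N -> rext Mod a b = 0%N -> rhom Mod b a = 0%N ->
  0 < p -> 0 < q -> natv R gamma = p *: natv R a + q *: natv R b ->
  semistable x0 gamma ->
  (forall d, subdim gamma d -> pairing x0 d = 0 ->
     exists c e, natv R d = c *: natv R a + e *: natv R b) ->
  (forall d, subdim gamma d -> pairing x0 d < 0 -> pairing x d < 0) ->
  pairing x gamma = 0 -> pairing x a < 0 -> semistable x gamma.
Proof.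
move=> ra rb rg hab xab hba p0 q0 e s0 gen near xg xa; apply: contrapT.
move=> /(destabilizing_sub rg xg)[T [X [io [pr [iop xT hTX _]]]]].
have [_ da] := root_moduleP ra; have [_ db] := root_moduleP rb.
have [/exceptionalP[dg rigid] eg] := root_moduleP rg.
have TR := short_exact_embeds iop; have RX := short_exact_projects iop.
have sT : subdim gamma (dimvec T) by exists T.
have T0 : dimvec T <> 0 by move=> z; move: xT; rewrite z pairing0 ltxx.
have dim := short_exact_dimvec iop; rewrite eg in dim.
have X0 : dimvec X <> 0.
  by move=> z; move: xT; rewrite -[dimvec T]addr0 -z -dim xg ltxx.
have [c [d eT]] : exists c d, natv R (dimvec T) = c *: natv R a + d *: natv R b.
  apply: gen => //; apply/eqP; rewrite eq_le (s0.2 _ sT) /= leNgt; apply/negP => /near.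
  by move=> /(_ sT); rewrite ltNge ltW.
have eX : natv R (dimvec X) = (p - c) *: natv R a + (q - d) *: natv R b.
  have -> : natv R (dimvec X) = natv R gamma - natv R (dimvec T).
    by rewrite dim; apply/rowP => i; rewrite !mxE natrD addrAC subrr add0r.
  by rewrite e eT !scalerBl opprD addrACA.
have [mio mpr ioI prS ex] := iop.
(* A composite M -> X -> T -> M kills T, so it is not injective and must be 0. *)
have hXT : hom0 X T.
  move=> f mf; apply: contrapT => nf.
  have inj := division_end_inj dg (morphism_comp (morphism_comp mpr mf) mio).
  apply/T0/dimvec0P => i v; apply: (ioI i); apply: inj => [h|].
    apply: nf => l u; have [m <-] := prS l u; apply: (ioI l); rewrite (mor0 mio).
    exact: h.
  rewrite (mor0 mio) (_ : pr i (io i v) = 0) ?(mor0 mf) ?(mor0 mpr) ?(mor0 mf) //.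
  by apply/ex; exists v.
(* A section of M -> X would give a nonzero endomorphism M -> X -> M that kills T. *)
have xXT : ~ ext0 X T.
  move=> x0'; have [s ms sK] := ext0_split x0' iop.
  have inj := division_end_inj dg (morphism_comp mpr ms).
  apply/T0/dimvec0P => i v; apply: (ioI i); apply: inj => [h|].
    apply/X0/dimvec0P => l u; rewrite -[u]sK.
    have [m <-] := prS l u; have := h l m => /= ->; exact: mor0.
  by rewrite (mor0 mio) (_ : pr i (io i v) = 0) ?(mor0 mpr) //; apply/ex; exists v.
have E1 : euler Mod (natv R (dimvec T)) (natv R (dimvec X)) = 0.
  rewrite ext0_euler; last exact: ext0_projects RX (ext0_embeds TR rigid).
  by rewrite ((hom_dim_eq0 _ _).2 hTX).
have E2 : euler Mod (natv R (dimvec X)) (natv R (dimvec T)) < 0.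
  rewrite hom0_euler // oppr_lt0 ltr0n lt0n; apply/eqP => z.
  exact/xXT/ext0P.
have Eab : euler Mod (natv R a) (natv R b) = 0.
  by rewrite rhom_rext_euler // hab xab subrr.
have Eba : euler Mod (natv R b) (natv R a) <= 0.
  by rewrite rhom_rext_euler // hba sub0r oppr_le0.
have xe := pairing_natv x e; have xTe := pairing_natv x eT.
have xb : pairing x b = - (p / q) * pairing x a.
  apply: (mulfI (lt0r_neq0 q0)); rewrite mulrA mulrN mulrCA divff ?lt0r_neq0 // mulr1.
  by apply/eqP; rewrite mulNr -addr_eq0 addrC -xe xg.
(* The pairing of x with T is p * d - q * c times the positive number - pairing x a / q. *)
have cd : 0 < p * d - q * c.
  have : 0 < - pairing x a / q by rewrite divr_gt0 // oppr_gt0.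
  move: xT; rewrite xTe xb => h1 h2.
  have : 0 < (- pairing x a / q) * (p * d - q * c).
    move: h1; congr (_ < _).
    have qn : q != 0 := lt0r_neq0 q0.
    by field.
  by rewrite pmulr_rgt0.
move: E1 E2; rewrite eX eT !euler_linear_l !euler_linear_r Eab => E1 E2.
(* As <a, b> = 0, the left side is <T, X> - <X, T>, which is positive by E1 and E2. *)
have : (d * (p - c) - (q - d) * c) * euler Mod (natv R b) (natv R a) <= 0.
  apply: mulr_ge0_le0 => //.
  by rewrite (_ : _ - _ = p * d - q * c) ?ltW //; ring.
rewrite leNgt => /negP; apply; move: E1 E2.
set A := euler _ _ _; set B := euler _ (natv R b) (natv R a); set C := euler _ _ _.
lra.
Qed.

End Stability.

(** * Labels of points *)

Lemma sorted_level_split (R : realDomainType) (T : eqType) (f : T -> R) (c : R) (s : seq T) :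
  sorted (fun j k => f k <= f j)%R s -> all (fun k => f k <= c)%R s ->
  s = [seq k <- s | f k == c] ++ [seq k <- s | f k != c].
Proof.
elim: s => [//|k s ih] /= ps /andP[kc sc].
have tr : transitive (fun j k : T => f k <= f j)%R by move=> a b d /= ba ad; exact: le_trans ad ba.
have [fk|fk] := eqVneq (f k) c; first by rewrite /= -ih ?(path_sorted ps).
have kall : all (fun l => f l != c) s.
  apply/allP => l ls; have /allP/(_ l ls) := order_path_min tr ps.
  by move=> lk; rewrite lt_eqF // (le_lt_trans lk) // lt_neqAle fk.
rewrite (_ : [seq l <- s | f l == c] = [::]) /=.
  by rewrite (all_filterP kall).
apply/eqP; rewrite -size_eq0 size_filter -leqn0 leqNgt -has_count -all_predC.
exact: kall.
Qed.

Section Words.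
Local Open Scope classical_set_scope.
Local Open Scope ring_scope.
Variables (K : fieldType) (n : nat) (Q : valued_quiver n) (Mod : modulation K Q).
Variables (R : realType) (m : nat) (S : 'I_m -> 'rV[nat]_n).
Variable le : rel 'I_m.
Hypotheses (adm : admissible_set Mod S) (lat : lateral_ordering Mod S le).
Local Notation pairing := (pairing Q).
Local Notation stable := (stable Mod).
Local Notation semistable := (semistable Mod).
Local Notation subdim := (subdim Mod).
Local Notation rhom := (rhom Mod).
Local Notation rext := (rext Mod).
Local Notation G := (picture_group Mod S).
Local Notation euler := (euler Mod).
Local Notation natv := (natv R).
Implicit Types (x y : 'rV[R]_n) (d : 'rV[nat]_n) (i j k l : 'I_m).

Definition ones : 'rV[R]_n := const_mx 1.
Definition height d : R := pairing ones d.
(** The line through x in the direction [ones] meets H(d) at distance [level x d] behind x, measured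
    in multiples of [ones]. Positive levels lie on the ray ending at x, and larger levels are met
    earlier. *)
Definition level x d : R := pairing x d / height d.
Definition crossing x d : 'rV[R]_n := x - level x d *: ones.

Lemma pairing_comb (t : R) x y d : pairing (x + t *: y) d = pairing x d + t * pairing y d.
Proof.
rewrite /pairing mulr_sumr -big_split; apply: eq_bigr => i _ /=.
by rewrite !mxE; ring.
Qed.

Lemma height_gt0 d : d <> 0 -> 0 < height d.
Proof.
move=> d0; rewrite /height /pairing; have [i di] : exists i : 'I_n, d 0 i != 0%N.
  apply: contrapT => h; apply: d0; apply/rowP => i; rewrite mxE; apply: contrapT => /eqP di.
  by apply: h; exists i.
rewrite (bigD1 i) //= mxE ltr_wpDr //.
  by apply: sumr_ge0 => j _; rewrite mxE mul1r mulr_ge0.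
by rewrite mul1r mulr_gt0 // ltr0n ?lt0n // -lt0n qval_gt0.
Qed.

Lemma pairing_crossing x d e : e <> 0 ->
  pairing (crossing x d) e = height e * (level x e - level x d).
Proof.
move=> e0; rewrite /crossing -scaleNr pairing_comb -/(height e) mulrBr {2}/level.
rewrite mulNr [level x d * _]mulrC; congr (_ - _).
by rewrite [RHS]mulrC divfK // gt_eqF ?height_gt0.
Qed.

Let rootS k : real_schur_root Mod (S k) := adm_root adm k.

Lemma S_neq0 k : S k <> 0.
Proof.
have [/exceptionalP[dV _] <-] := root_moduleP (rootS k).
exact: division_end_neq0.
Qed.

Lemma S_height k : 0 < height (S k). Proof. exact/height_gt0/S_neq0. Qed.

Lemma le_anti i j : le i j -> le j i -> i = j.
Proof. by move: lat => [[_ a _ _] _] ij ji; apply: a; rewrite ij ji. Qed.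

Lemma rhom_le i j : rhom (S i) (S j) <> 0%N -> le i j.
Proof. by move: lat => [_ /(_ i j)[h _]] /h. Qed.

Lemma rhom_rext i j : rhom (S i) (S j) <> 0%N -> rext (S i) (S j) = 0%N.
Proof.
move=> /rhom_le ij; apply: contrapT; move: lat => [_ /(_ i j)[_ h]] /h[ji nij].
by apply: nij; exact: le_anti.
Qed.

Lemma eulerS_gt0 i j : 0 < euler (natv (S i)) (natv (S j)) -> le i j.
Proof.
rewrite rhom_rext_euler //; move=> h; apply: rhom_le => z; move: h.
by rewrite z sub0r oppr_gt0 ltNge ler0n.
Qed.

Lemma natv_height d d1 d2 (p q : R) : natv d = p *: natv d1 + q *: natv d2 ->
  height d = p * height d1 + q * height d2.
Proof. exact: pairing_natv. Qed.

(** Positive heights give c > 0, so the Euler form is positive in both orders; there are nonzero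
    maps both ways, and the lateral ordering is antisymmetric. *)
Lemma proportional_roots i j (c : R) : natv (S i) = c *: natv (S j) -> i = j.
Proof.
move=> e; have e' : natv (S i) = c *: natv (S j) + 0 *: natv (S j).
  by rewrite scale0r addr0.
have := natv_height e'; rewrite mul0r addr0 => h.
have c0 : 0 < c by rewrite -(pmulr_lgt0 _ (S_height j)) -h S_height.
apply: le_anti; apply: eulerS_gt0.
  rewrite e' euler_linear_l mul0r addr0 mulr_gt0 //.
  by case: (euler_root_gt0 R (rootS j)).
rewrite e' euler_linear_r mul0r addr0 mulr_gt0 //.
by case: (euler_root_gt0 R (rootS j)).
Qed.

Definition dimbound : nat := (\sum_(k < m) \sum_(i < n) S k 0%R i)%N.
(** A finite list containing the dimension vectors of all submodules of the modules in S; general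
    position is asked with respect to this list. *)
Definition dimvecs : seq 'rV[nat]_n :=
  [seq \row_i (t i : nat) | t : {ffun 'I_n -> 'I_dimbound.+1}].

Lemma subdim_dimvecs k d : subdim (S k) d -> d \in dimvecs.
Proof.
move=> /(subdim_le (rootS k)) h; apply/mapP.
exists [ffun i => inord (d 0 i)]; first by rewrite mem_enum.
apply/rowP => i; rewrite mxE ffunE inordK // ltnS; apply: leq_trans (h i) _.
rewrite /dimbound (bigD1 k) //= (bigD1 i) //= -addnA; exact: leq_addr.
Qed.

Lemma S_dimvecs k : S k \in dimvecs.
Proof. exact/subdim_dimvecs/subdim_refl. Qed.

Definition dependent3 (d1 d2 d3 : 'rV[nat]_n) := exists a b c : R,
  a *: natv d1 + b *: natv d2 + c *: natv d3 = 0 /\ ~ (a = 0 /\ b = 0 /\ c = 0).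

(** Equal levels mean a common point of the line with the hyperplanes, so this says that the line
    through x meets only strata of codimension at most 2. *)
Definition good x := forall d1 d2 d3, d1 \in dimvecs -> d2 \in dimvecs -> d3 \in dimvecs ->
  d1 <> 0 -> d2 <> 0 -> d3 <> 0 -> level x d1 = level x d2 -> level x d1 = level x d3 ->
  dependent3 d1 d2 d3.

Definition active x k := 0 < level x (S k) /\ stable (crossing x (S k)) (S k).

Definition before x j k : bool := (level x (S k) < level x (S j)) ||
  (level x (S j) == level x (S k)) && le j k.

(* The roots crossed, in this order, by the ray coming from minus infinity to x in
   the direction of the vector ones. *)
Definition crossings x := [seq k <- sort (before x) (enum 'I_m) | `[< active x k >] ].

Definition label (s : seq 'I_m) : G := pg_class _ [seq (true, k) | k <- s].

Lemma label_cat s t : label (s ++ t) = (label s * label t)%g.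
Proof. by rewrite /label map_cat pg_classM. Qed.

Lemma before_total x : total (before x).
Proof.
move: lat => [[_ _ _ tot] _] j k; rewrite /before.
have [->|h] := eqVneq (level x (S j)) (level x (S k)); first by rewrite ltxx ?eqxx /= tot.
by rewrite !orbF orbC; move: h; rewrite neq_lt.
Qed.

Lemma before_trans x : transitive (before x).
Proof.
move: lat => [[_ _ tr _] _] k j l; rewrite /before.
move=> /orP[jk|/andP[/eqP jk ljk]] /orP[kl|/andP[/eqP kl lkl]].
- by rewrite (lt_trans kl jk).
- by rewrite -kl jk.
- by rewrite jk kl.
- by rewrite jk kl eqxx (tr k) ?orbT.
Qed.

Lemma crossings_sorted x : sorted (before x) (crossings x).
Proof. apply: sorted_filter; [exact: before_trans|exact/sort_sorted/before_total]. Qed.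

Lemma crossings_uniq x : uniq (crossings x).
Proof. by rewrite filter_uniq // sort_uniq enum_uniq. Qed.

Lemma mem_crossings x k : k \in crossings x <-> active x k.
Proof. by rewrite mem_filter mem_sort mem_enum andbT; split=> /asboolP. Qed.

(** Both lists are concatenations of blocks with constant f, in decreasing order of f. With f the
    level at x0, two nearby words are compared one crossing point of x0 at a time. *)
Lemma label_levels (f : 'I_m -> R) (s t : seq 'I_m) :
  sorted (fun j k => f k <= f j) s -> sorted (fun j k => f k <= f j) t ->
  (forall c, label [seq k <- s | f k == c] = label [seq k <- t | f k == c]) ->
  label s = label t.
Proof.
have tr : transitive (fun j k => f k <= f j) by move=> a b d /= ba ad; exact: le_trans ad ba.
suff H cs s' t' : sorted (fun c c' => c' < c) cs -> all (fun k => f k \in cs) (s' ++ t') ->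
    sorted (fun j k => f k <= f j) s' -> sorted (fun j k => f k <= f j) t' ->
    (forall c, label [seq k <- s' | f k == c] = label [seq k <- t' | f k == c]) ->
    label s' = label t'.
  apply: (H (rev (sort <=%R (undup [seq f k | k <- s ++ t])))).
    by rewrite rev_sorted sort_lt_sorted undup_uniq.
  by apply/allP => k ks; rewrite mem_rev mem_sort mem_undup map_f.
elim: cs s' t' => [|c cs ih] s' t' /=.
  by case: s' => [|? ?] //; case: t'.
move=> pcs; rewrite all_cat => /andP[sA tA] sS tS e.
have ltc : all (fun c' => c' < c) cs.
  by apply: order_path_min pcs => a b d /= ba ad; exact: lt_trans ad ba.
have lec u : all (fun k => f k \in c :: cs) u -> all (fun k => f k <= c) u.
  move=> /allP uA; apply/allP => k /uA; rewrite inE => /orP[/eqP -> //|h].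
  exact/ltW/(allP ltc).
rewrite (sorted_level_split sS (lec _ sA)) (sorted_level_split tS (lec _ tA)).
rewrite !label_cat e; congr (_ * _)%g; apply: ih.
- exact: path_sorted pcs.
- rewrite all_cat; apply/andP; split; apply/allP => k; rewrite mem_filter => /andP[fk kk].
    by have := allP sA k kk; rewrite inE (negPf fk).
  by have := allP tA k kk; rewrite inE (negPf fk).
- exact: sorted_filter.
- exact: sorted_filter.
move=> c'; rewrite -!filter_predI.
have [->|cc'] := eqVneq c' c.
  have nil u : [seq k <- u | predI (fun k => f k == c) (fun k => f k != c) k] = [::].
    by rewrite (@eq_filter _ _ pred0) ?filter_pred0 // => k /=; rewrite andbN.
  by rewrite !nil.
have same u : [seq k <- u | predI (fun k => f k == c') (fun k => f k != c) k] =
    [seq k <- u | f k == c'].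
  by apply: eq_filter => k /=; have [->|] := eqVneq (f k) c'.
by rewrite !same.
Qed.



(** A combinatorial neighbourhood of x0: strict comparisons of levels at x0 persist at x, while ties
    may be broken in either way. *)
Definition near x0 x := (forall k d, d \in dimvecs -> d <> 0 ->
    (level x0 d < level x0 (S k) -> level x d < level x (S k)) /\
    (level x0 (S k) < level x0 d -> level x (S k) < level x d)) /\
  (forall k, (0 < level x0 (S k) -> 0 < level x (S k)) /\
             (level x0 (S k) < 0 -> level x (S k) < 0)).

Lemma near_refl x : near x x. Proof. by []. Qed.

Lemma pairing_crossing_lt0 x k d : d <> 0 ->
  pairing (crossing x (S k)) d < 0 <-> level x d < level x (S k).
Proof.
by move=> d0; rewrite pairing_crossing // pmulr_rlt0 ?height_gt0 // subr_lt0.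
Qed.

Lemma pairing_crossing_gt0 x k d : d <> 0 ->
  0 < pairing (crossing x (S k)) d <-> level x (S k) < level x d.
Proof.
by move=> d0; rewrite pairing_crossing // pmulr_rgt0 ?height_gt0 // subr_gt0.
Qed.

Lemma pairing_crossing_self x k : pairing (crossing x (S k)) (S k) = 0.
Proof. by rewrite pairing_crossing ?subrr ?mulr0 //; exact: S_neq0. Qed.

Lemma near_lt0 x0 x k d : near x0 x -> d \in dimvecs ->
  pairing (crossing x0 (S k)) d < 0 -> pairing (crossing x (S k)) d < 0.
Proof.
move=> [h _] dd; have [->|/eqP d0] := eqVneq d 0; first by rewrite !pairing0 ltxx.
by move=> /(pairing_crossing_lt0 _ _ d0)/(h k d dd d0).1 ?; apply/pairing_crossing_lt0.
Qed.

Lemma near_gt0 x0 x k d : near x0 x -> d \in dimvecs ->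
  0 < pairing (crossing x0 (S k)) d -> 0 < pairing (crossing x (S k)) d.
Proof.
move=> [h _] dd; have [->|/eqP d0] := eqVneq d 0; first by rewrite !pairing0 ltxx.
by move=> /(pairing_crossing_gt0 _ _ d0)/(h k d dd d0).2 ?; apply/pairing_crossing_gt0.
Qed.

(** Semistability is closed and passes from x back to x0; stability is open and passes from x0 to x
    in [near_stable]. *)
Lemma near_semistable x0 x k : near x0 x ->
  semistable (crossing x (S k)) (S k) -> semistable (crossing x0 (S k)) (S k).
Proof.
move=> nx [_ h]; split=> [|d sd]; first exact: pairing_crossing_self.
rewrite leNgt; apply/negP => /(near_gt0 nx (subdim_dimvecs sd)).
by rewrite ltNge h.
Qed.

Lemma near_stable x0 x k : near x0 x ->
  stable (crossing x0 (S k)) (S k) -> stable (crossing x (S k)) (S k).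
Proof.
move=> nx [_ h]; split=> [|d sd d0 dS]; first exact: pairing_crossing_self.
exact: near_lt0 nx (subdim_dimvecs sd) (h d sd d0 dS).
Qed.

(** The vertical ordering enters here: the stable subroot is again in S. *)
Lemma semistable_stable_sub y k : semistable y (S k) -> exists i,
  [/\ stable y (S i), subdim (S k) (S i) & rhom (S i) (S k) <> 0%N].
Proof.
move=> /(stable_sub (rootS k))[b [sb sdb stb hb]].
by have [i _ e] := adm_vertical adm (or_introl sb); exists i; rewrite e.
Qed.

Lemma semistable_stable_quot y k : semistable y (S k) -> exists j,
  stable y (S j) /\ rhom (S k) (S j) <> 0%N.
Proof.
move=> /(stable_quot (rootS k))[b [sb stb hb]].
by have [i _ e] := adm_vertical adm (or_intror sb); exists i; rewrite e.
Qed.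

Lemma S_injective i j : S i = S j -> i = j. Proof. exact: (adm_inj adm). Qed.

Lemma stable_rhom0 y i j : stable y (S i) -> stable y (S j) -> i <> j ->
  rhom (S i) (S j) = 0%N.
Proof.
move=> si sj ij; apply/hom_dim_eq0.
by apply: (stable_orthogonal (rootS i) (rootS j) si sj) => /S_injective.
Qed.

(** * Points of codimension at most two *)

Definition rank2 y := forall d1 d2 d3,
  d1 \in dimvecs -> d2 \in dimvecs -> d3 \in dimvecs ->
  d1 <> 0 -> d2 <> 0 -> d3 <> 0 -> pairing y d1 = 0 -> pairing y d2 = 0 ->
  pairing y d3 = 0 -> dependent3 d1 d2 d3.

Section Rank2.
Variable y : 'rV[R]_n.
Hypothesis rk : rank2 y.

Lemma rank2_span i j d : pairing y (S i) = 0 -> pairing y (S j) = 0 -> i <> j ->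
  d \in dimvecs -> pairing y d = 0 ->
  exists c e, natv d = c *: natv (S i) + e *: natv (S j).
Proof.
move=> yi yj ij dd yd; have [->|/eqP d0] := eqVneq d 0.
  by exists 0, 0; rewrite !scale0r addr0; apply/rowP => l; rewrite !mxE.
have [a [b [c [e n0]]]] := rk (S_dimvecs i) (S_dimvecs j) dd (@S_neq0 i) (@S_neq0 j) d0 yi yj yd.
have [c0|c0] := eqVneq c 0.
  exfalso; apply: n0; rewrite c0; move: e; rewrite c0 scale0r addr0.
  move=> /eqP; rewrite addr_eq0 => /eqP e.
  have [a0|a0] := eqVneq a 0.
    split=> //; split=> //; move: e; rewrite a0 scale0r => /esym/eqP.
    rewrite oppr_eq0 scaler_eq0 => /orP[/eqP //|/eqP z].
    have := S_neq0 (k := j); case; apply/rowP => l; move/rowP/(_ l): z.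
    by rewrite !mxE => /eqP; rewrite pnatr_eq0 => /eqP.
  exfalso; apply: ij; apply: (@proportional_roots i j (- (b / a))).
  apply: (scalerI a0); rewrite e scalerA mulrN mulrCA divff // mulr1.
  by rewrite scaleNr.
exists (- (a / c)), (- (b / c)); apply: (scalerI c0).
rewrite scalerDr !scalerA !mulrN [c * (a / c)]mulrCA [c * (b / c)]mulrCA divff //.
rewrite !mulr1 !scaleNr -opprD.
by apply/eqP; rewrite -addr_eq0 addrC e.
Qed.

(** As for simple roots: distinct stable roots have Euler products at most 0 in both orders, while
    squares and heights are positive, so every choice of signs in S l = c S i + e S j is
    contradictory. *)
Lemma stable_le2 i j l : stable y (S i) -> stable y (S j) -> stable y (S l) ->
  i <> j -> l = i \/ l = j.
Proof.
move=> si sj sl ij; apply: contrapT => /not_orP[li lj].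
have [c [e h]] := rank2_span si.1 sj.1 ij (S_dimvecs l) sl.1.
have Ele k k' : k <> k' -> stable y (S k) -> stable y (S k') ->
    euler (natv (S k)) (natv (S k')) <= 0.
  by move=> kk sk sk'; rewrite rhom_rext_euler // (stable_rhom0 sk sk' kk) sub0r oppr_le0.
have Egt k : 0 < euler (natv (S k)) (natv (S k)) by case: (euler_root_gt0 R (rootS k)).
have hh := natv_height h.
have hl := S_height l; have hi := S_height i; have hj := S_height j.
have := Egt l; have := Egt i; have := Egt j.
have := Ele i j ij si sj; have := Ele i l (nesym li) si sl; have := Ele j l (nesym lj) sj sl.
have := Ele l i li sl si; have := Ele l j lj sl sj; have := Ele j i (nesym ij) sj si.
rewrite h !euler_linear_l !euler_linear_r.
set A := euler (natv (S i)) (natv (S i)); set B := euler (natv (S i)) (natv (S j)).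
set C := euler (natv (S j)) (natv (S i)); set D := euler (natv (S j)) (natv (S j)).
move=> C0 h1 h2 h3 h4 B0 D0 A0 h5.
have [c0|c0] := leP 0 c; have [e0|e0] := leP 0 e.
- have : c * (c * A + e * B) + e * (c * C + e * D) <= 0.
    by rewrite -oppr_ge0 opprD -!mulrN addr_ge0 // mulr_ge0 // oppr_ge0.
  lra.
- have : c * A <= 0 by have : 0 <= e * B by [apply: mulr_le0; [exact: ltW|]]; lra.
  have cpos : 0 < c.
    rewrite lt_neqAle c0 andbT eq_sym; apply/eqP => z; move: hh; rewrite z mul0r add0r => hh.
    by move: hl; rewrite hh ltNge mulr_le0_ge0 // ltW.
  by rewrite leNgt mulr_gt0.
- have : e * D <= 0 by have : 0 <= c * C by [apply: mulr_le0; [exact: ltW|]]; lra.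
  have epos : 0 < e.
    rewrite lt_neqAle e0 andbT eq_sym; apply/eqP => z; move: hh; rewrite z mul0r addr0 => hh.
    by move: hl; rewrite hh ltNge mulr_le0_ge0 // ltW.
  by rewrite leNgt mulr_gt0.
- move: hl; rewrite hh ltNge => /negP; apply.
  by rewrite -oppr_ge0 opprD -!mulNr addr_ge0 // mulr_ge0 ?oppr_ge0 // ltW.
Qed.

Section Pair.
Variables i j : 'I_m.
Hypotheses (si : stable y (S i)) (sj : stable y (S j)) (ij : i <> j) (lij : le i j).

Lemma pair_rhom : rhom (S i) (S j) = 0%N /\ rhom (S j) (S i) = 0%N.
Proof.
split; first exact: stable_rhom0 si sj ij.
exact: stable_rhom0 sj si (nesym ij).
Qed.

Lemma pair_rext : rext (S i) (S j) = 0%N.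
Proof.
apply: contrapT; move: lat => [_ /(_ i j)[_ h]] /h[ji _].
by apply: ij; exact: le_anti.
Qed.

Lemma pair_euler : euler (natv (S i)) (natv (S j)) = 0.
Proof. by rewrite rhom_rext_euler // pair_rhom.1 pair_rext subrr. Qed.

Lemma natv_comb k (p q : nat) : S k = S i *+ p + S j *+ q <->
  natv (S k) = p%:R *: natv (S i) + q%:R *: natv (S j).
Proof.
have mulmxn d r (l : 'I_n) : (d *+ r) 0 l = (d 0%R l * r)%N.
  by elim: r => [|r ih]; rewrite ?mulr0n ?mxE ?muln0 // mulrS mxE ih mulnS.
split=> [->|/rowP e].
  apply/rowP => l; rewrite !mxE !mulmxn natrD !natrM.
  by congr (_ + _); rewrite mulrC.
apply/rowP => l; have := e l; rewrite !mxE !mulmxn => h.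
apply/eqP; rewrite -(eqr_nat R) h natrD !natrM; apply/eqP.
by congr (_ + _); rewrite mulrC.
Qed.

(* The coefficients are <S i, S k> / <S i, S i> and <S k, S j> / <S j, S j>, and they are
   integers because End(M_{S i}) and End(M_{S j}) are division algebras. *)
Lemma semistable_pair k : semistable y (S k) -> k <> i -> k <> j ->
  rhom (S i) (S k) <> 0%N /\
  exists p q : nat, [/\ (0 < p)%N, (0 < q)%N & S k = S i *+ p + S j *+ q].
Proof.
move=> sk ki kj.
have [a [sa _ hak]] := semistable_stable_sub sk.
have [b [sb hkb]] := semistable_stable_quot sk.
have lak := rhom_le hak; have lkb := rhom_le hkb.
(* If the stable submodule were S j, then j precedes k: a stable quotient S i would put j before i,
   and S j would force k = j. *)
have hik : rhom (S i) (S k) <> 0%N.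
  have [<- //|aj] := stable_le2 si sj sa ij.
  exfalso; subst a; have [bi|bj] := stable_le2 si sj sb ij; subst b.
    have [_ h] := pair_rhom; apply: ij; apply: le_anti => //.
    by move: lat => [[_ _ tr _] _]; exact: tr lak lkb.
  by apply: kj; apply: le_anti.
have hkj : rhom (S k) (S j) <> 0%N.
  have [bi|<- //] := stable_le2 si sj sb ij.
  by exfalso; subst b; apply: ki; apply: le_anti => //; exact: rhom_le.
split=> //.
have [c [e h]] := rank2_span si.1 sj.1 ij (S_dimvecs k) sk.1.
have [Ei Ei'] := euler_root_gt0 R (rootS i); have [Ej Ej'] := euler_root_gt0 R (rootS j).
have [/exceptionalP[di _] _] := root_moduleP (rootS i).
have [/exceptionalP[dj _] _] := root_moduleP (rootS j).
have /dvdnP[p hp] : (rhom (S i) (S i) %| rhom (S i) (S k))%N by exact: division_end_dvd_l.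
have /dvdnP[q hq] : (rhom (S j) (S j) %| rhom (S k) (S j))%N by exact: division_end_dvd_r.
have cp : c = p%:R.
  have := rhom_rext_euler R (rootS i) (rootS k); rewrite (rhom_rext hik) subr0 h.
  rewrite euler_linear_r pair_euler mulr0 addr0 hp natrM -Ei'.
  by move=> /mulIf; apply; rewrite gt_eqF.
have eq : e = q%:R.
  have := rhom_rext_euler R (rootS k) (rootS j); rewrite (rhom_rext hkj) subr0 h.
  rewrite euler_linear_l pair_euler mulr0 add0r hq natrM -Ej'.
  by move=> /mulIf; apply; rewrite gt_eqF.
exists p, q; split.
- by rewrite lt0n; apply/eqP => p0; apply: hik; rewrite hp p0.
- by rewrite lt0n; apply/eqP => q0; apply: hkj; rewrite hq q0.
- by apply/natv_comb; rewrite h cp eq.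
Qed.

Lemma pair_semistable k (p q : nat) : S k = S i *+ p + S j *+ q -> semistable y (S k).
Proof.
move=> /natv_comb e; apply: (semistable_combination (rootS i) (rootS j) (rootS k)
  (stable_semistable si) (stable_semistable sj) _ _ e); rewrite ?ler0n //.
by rewrite (pairing_natv Q y e) si.1 sj.1 !mulr0 addr0.
Qed.

Lemma pair_comb_pos k (p q : nat) : S k = S i *+ p + S j *+ q -> k <> i -> k <> j ->
  (0 < p)%N /\ (0 < q)%N.
Proof.
move=> /natv_comb e ki kj; split; rewrite lt0n; apply/eqP => z.
  by apply: kj; apply: (@proportional_roots _ _ q%:R); rewrite e z scale0r add0r.
by apply: ki; apply: (@proportional_roots _ _ p%:R); rewrite e z scale0r addr0.
Qed.

(** Semistability comes from [semistable_near]. A stable subroot S l then lies in the plane of S i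
    and S j and, like S k, is orthogonal to x', so it is proportional to S k and equal to it. *)
Lemma pair_stable_near x' k (p q : nat) : S k = S i *+ p + S j *+ q -> k <> i -> k <> j ->
  (forall d, d \in dimvecs -> pairing y d < 0 -> pairing x' d < 0) ->
  pairing x' (S k) = 0 -> pairing x' (S i) < 0 -> stable x' (S k).
Proof.
move=> ek ki kj nr xk xi; have [p0 q0] := pair_comb_pos ek ki kj.
have sk := pair_semistable ek; move/natv_comb: ek => e.
have p0' : 0 < p%:R :> R by rewrite ltr0n.
have q0' : 0 < q%:R :> R by rewrite ltr0n.
have gen d : subdim (S k) d -> pairing y d = 0 ->
    exists c e, natv d = c *: natv (S i) + e *: natv (S j).
  by move=> sd; apply: rank2_span => //; [exact: si.1|exact: sj.1|exact: subdim_dimvecs sd].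
have ssk : semistable x' (S k).
  apply: (semistable_near (rootS i) (rootS j) (rootS k) pair_rhom.1 pair_rext pair_rhom.2
    p0' q0' e sk gen) => // d sd; apply: nr; exact: subdim_dimvecs sd.
have [l [sl sdl hl]] := semistable_stable_sub ssk.
have yl : pairing y (S l) = 0.
  apply/eqP; rewrite eq_le sk.2 //= leNgt; apply/negP => /nr.
  by rewrite S_dimvecs => /(_ isT); rewrite sl.1 ltxx.
have [c [f h]] := rank2_span si.1 sj.1 ij (S_dimvecs l) yl.
suff <- : l = k by [].
apply: (@proportional_roots l k (c / p%:R)).
rewrite e h scalerDr !scalerA divfK ?gt_eqF //; congr (_ + _ *: _).
have := pairing_natv Q x' h; rewrite sl.1 => xl.
have := pairing_natv Q x' e; rewrite xk => xk'.
have xi0 : pairing x' (S i) != 0 by rewrite lt_eqF.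
have xj : pairing x' (S j) = - (p%:R / q%:R) * pairing x' (S i).
  have qn : q%:R != 0 :> R by rewrite gt_eqF.
  by apply: (mulfI qn); apply/eqP; rewrite -subr_eq0 xk'; apply/eqP; field.
move: xl; rewrite xj => xl.
have qn : q%:R != 0 :> R by rewrite gt_eqF.
have pn : p%:R != 0 :> R by rewrite gt_eqF.
have : (c - f * (p%:R / q%:R)) * pairing x' (S i) = 0 by rewrite [RHS]xl; ring.
move=> /eqP; rewrite mulf_eq0 (negPf xi0) orbF subr_eq0 => /eqP ->.
by field; rewrite pn qn.
Qed.

End Pair.
End Rank2.

Lemma before_anti x : antisymmetric (before x).
Proof.
move=> j k /andP[/orP[jk|/andP[/eqP jk ljk]] /orP[kj|/andP[/eqP kj lkj]]].
- by have := lt_trans jk kj; rewrite ltxx.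
- by move: jk; rewrite kj ltxx.
- by move: kj; rewrite jk ltxx.
- exact: le_anti.
Qed.

Lemma sorted_eq2 x i j (s : seq 'I_m) : sorted (before x) s -> uniq s -> before x i j ->
  i <> j -> (forall k, k \in s <-> k = i \/ k = j) -> s = [:: i; j].
Proof.
move=> ss us bij nij h; apply: (sorted_eq (@before_trans x) (@before_anti x)) => //=.
  by rewrite bij.
apply: uniq_perm => //=; first by rewrite inE andbT; apply/eqP.
move=> k; rewrite !inE; apply/idP/orP => [/h[->|->]|hk].
- by left.
- by right.
- by apply/h; case: hk => /eqP ->; [left|right].
Qed.

Lemma picture_label i j (s : seq ('I_m * (nat * nat))) : hom_orthogonal Mod (S i) (S j) ->
  rext (S i) (S j) = 0%N -> rank2_list S i j s ->
  label [:: i; j] = label [seq t.1 | t <- s].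
Proof.
move=> ho hx hs; apply/pg_classP; rewrite -map_comp.
by have := word_eq_rel [::] [::] (PictureRel ho hx hs); rewrite !cats0.
Qed.

Lemma level_comb x d d1 d2 (p q : R) : natv d = p *: natv d1 + q *: natv d2 ->
  level x d = (p * pairing x d1 + q * pairing x d2) / (p * height d1 + q * height d2).
Proof. by move=> e; rewrite /level (pairing_natv Q x e) (natv_height e). Qed.

(* The mediant of two fractions is monotone in the ratio of the weights. *)
Lemma pair_level_lt x i j k k' (p q p' q' : nat) : level x (S i) < level x (S j) ->
  S k = S i *+ p + S j *+ q -> S k' = S i *+ p' + S j *+ q' -> k <> k' ->
  level x (S k') <= level x (S k) -> (p * q' < p' * q)%N.
Proof.
move=> lij /natv_comb ek /natv_comb ek' kk'.
have hk := S_height k; have hk' := S_height k'; have hi := S_height i; have hj := S_height j.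
rewrite (level_comb x ek) (level_comb x ek') -(natv_height ek) -(natv_height ek').
rewrite ler_pdivrMr // mulrAC ler_pdivlMr // (natv_height ek) (natv_height ek').
move: lij; rewrite /level ltr_pdivrMr // mulrAC ltr_pdivlMr // => lij h.
have h2 : (p%:R * q'%:R - p'%:R * q%:R) *
    (pairing x (S j) * height (S i) - pairing x (S i) * height (S j)) <= 0.
  move: h; rewrite -subr_ge0 -oppr_le0; congr (_ <= _); ring.
have h3 : (p * q' <= p' * q)%N.
  rewrite -(ler_nat R) !natrM -subr_le0 leNgt; apply/negP => h3.
  by move: h2; rewrite leNgt mulr_gt0 // subr_gt0.
rewrite ltn_neqAle h3 andbT; apply/eqP => e; apply: kk'.
have /(congr1 (fun r => r%:R : R)) := e; rewrite !natrM => eR.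
have [p0|p0] := eqVneq p 0%N.
  have q0 : q <> 0%N.
    by move=> z; move: hk; rewrite (natv_height ek) p0 z !mul0r addr0 ltxx.
  have p'0 : p' = 0%N.
    by move: e; rewrite p0 mul0n => /esym/eqP; rewrite muln_eq0 => /orP[/eqP|/eqP].
  have q'0 : q' <> 0%N.
    by move=> z; move: hk'; rewrite (natv_height ek') p'0 z !mul0r addr0 ltxx.
  have qn : q'%:R != 0 :> R by rewrite pnatr_eq0; apply/eqP.
  apply: (@proportional_roots k k' (q%:R / q'%:R)).
  by rewrite ek ek' p0 p'0 !scale0r !add0r scalerA divfK.
have pn : p%:R != 0 :> R by rewrite pnatr_eq0.
apply/esym/(@proportional_roots k' k (p'%:R / p%:R)).
rewrite ek ek' scalerDr !scalerA divfK //; congr (_ + _ *: _).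
by apply: (mulfI pn); rewrite eR mulrA mulrCA divff // mulr1.
Qed.

(** The words at x and x0 are compared block by block; a block of level c > 0 only involves roots
    semistable at one point y0, where zero, one or two roots of S are stable. *)
Lemma crossings_near x0 x : good x0 -> near x0 x ->
  (forall k, level x0 (S k) = 0 -> ~ semistable x0 (S k)) ->
  label (crossings x) = label (crossings x0).
Proof.
move=> gx nx nwall; pose f k := level x0 (S k).
have lev_sorted y : near x0 y -> sorted (fun j k => f k <= f j) (crossings y).
  move=> [ny _]; apply: sub_sorted (crossings_sorted y) => j k.
  rewrite leNgt => bjk; apply/negP => fjk.
  have := (ny k (S j) (S_dimvecs j) (@S_neq0 j)).1 fjk.
  case/orP: bjk => [h1 h2|/andP[/eqP -> _]]; rewrite ?ltxx //.
  by have := lt_trans h1 h2; rewrite ltxx.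
apply: (label_levels (lev_sorted x nx) (lev_sorted x0 (near_refl x0))) => c.
have memB y k : k \in [seq k <- crossings y | f k == c] <-> active y k /\ f k = c.
  by rewrite mem_filter andbC; split=> [/andP[/mem_crossings ? /eqP]|[/mem_crossings -> /eqP]].
have sortB y : sorted (before y) [seq k <- crossings y | f k == c].
  by apply: sorted_filter; [exact: before_trans|exact: crossings_sorted].
have uniqB y : uniq [seq k <- crossings y | f k == c] by rewrite filter_uniq ?crossings_uniq.
(* Blocks with c <= 0 are empty: negative levels stay negative near x0, and a root active at x with
   level 0 at x0 would be semistable at x0. *)
have [c0|c0] := leP c 0.
  have nil y : near x0 y -> [seq k <- crossings y | f k == c] = [::].
    move=> ny; case e : [seq _ <- _ | _] => [//|k s]; exfalso.
    have [[lk sk] fk] : active y k /\ f k = c by apply/memB; rewrite e mem_head.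
    have [c00|c00] := eqVneq c 0.
      apply: (nwall k); first by rewrite -/(f k) fk.
      have := near_semistable ny (stable_semistable sk).
      by rewrite /crossing -/(f k) fk c00 scale0r subr0.
    have fneg : f k < 0 by rewrite fk lt_neqAle c00.
    by have := lt_trans lk ((ny.2 k).2 fneg); rewrite ltxx.
  by rewrite (nil x nx) (nil x0 (near_refl x0)).
pose y0 := x0 - c *: ones.
have cross0 k : f k = c -> crossing x0 (S k) = y0 by rewrite /crossing -/(f k) => ->.
have lev0 d : d <> 0 -> pairing y0 d = 0 -> level x0 d = c.
  move=> d0; rewrite /y0 -scaleNr pairing_comb mulNr => /eqP; rewrite subr_eq0 => /eqP e.
  by rewrite /level e -/(height d) mulfK // gt_eqF ?height_gt0.
have rk : rank2 y0.
  move=> d1 d2 d3 D1 D2 D3 n1 n2 n3 e1 e2 e3; apply: gx => //.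
    by rewrite !lev0.
  by rewrite !lev0.
have act_stable y k : near x0 y -> f k = c -> (active y k <-> stable (crossing y (S k)) (S k)).
  move=> ny fk; split=> [[]//|sk]; split=> //; apply: (ny.2 k).1.
  by rewrite -/(f k) fk.
have st_f k : semistable y0 (S k) -> f k = c.
  by move=> [e _]; apply: lev0 => //; exact: S_neq0.
have st_act0 k : stable y0 (S k) <-> active x0 k /\ f k = c.
  split=> [sk|[ak fk]].
    have fk := st_f k (stable_semistable sk).
    by split=> //; apply/(act_stable _ _ (near_refl x0) fk); rewrite cross0.
  by rewrite -(cross0 k fk); apply/(act_stable _ _ (near_refl x0) fk).
have act_semi y k : near x0 y -> active y k -> f k = c -> semistable y0 (S k).
  by move=> ny [_ sk] fk; rewrite -(cross0 k fk); exact: near_semistable ny (stable_semistable sk).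
have st_near y k : near x0 y -> stable y0 (S k) -> active y k /\ f k = c.
  move=> ny sk; have fk := st_f k (stable_semistable sk); split=> //.
  by apply/(act_stable y k ny fk)/(near_stable ny); rewrite cross0.
have [[i si]|none] := pselect (exists i, stable y0 (S i)); last first.
  have nil y : near x0 y -> [seq k <- crossings y | f k == c] = [::].
    move=> ny; case e : [seq _ <- _ | _] => [//|k s]; exfalso.
    have [ak fk] : active y k /\ f k = c by apply/memB; rewrite e mem_head.
    have [l [sl _ _]] := semistable_stable_sub (act_semi y k ny ak fk).
    by apply: none; exists l.
  by rewrite (nil x nx) (nil x0 (near_refl x0)).
have [[j [sj nij]]|only] := pselect (exists j, stable y0 (S j) /\ i <> j); last first.
  have onlyi k : stable y0 (S k) -> k = i.
    by move=> sk; apply: contrapT => ki; apply: only; exists k; split=> // e; apply: ki.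
  (* If S i is both the stable submodule and the stable quotient of S k, then i and k precede each
     other. *)
  have one y : near x0 y -> [seq k <- crossings y | f k == c] = [:: i].
    move=> ny; apply: perm_small_eq => //; apply: uniq_perm => // k; rewrite inE.
    apply/idP/eqP => [/memB[ak fk]|->]; last by apply/memB; exact: st_near.
    have sk := act_semi y k ny ak fk.
    have [a [sa _ ha]] := semistable_stable_sub sk.
    have [b [sb hb]] := semistable_stable_quot sk.
    rewrite (onlyi a sa) in ha; rewrite (onlyi b sb) in hb.
    by apply: le_anti; exact: rhom_le.
  by rewrite (one x nx) (one x0 (near_refl x0)).
have {si sj nij} [i' [j' [{}si {}sj {}nij lij]]] : exists i j,
    [/\ stable y0 (S i), stable y0 (S j), i <> j & le i j].
  move: lat => [[_ _ _ tot] _]; have /orP[lij|lji] := tot i j.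
    by exists i, j.
  by exists j, i; split=> //; exact: nesym.
move: i' j' si sj nij lij => {}i {}j si sj nij lij.
have fi := st_f i (stable_semistable si); have fj := st_f j (stable_semistable sj).
have B0 : [seq k <- crossings x0 | f k == c] = [:: i; j].
  apply: (sorted_eq2 (sortB x0) (uniqB x0)) => //.
    by rewrite /before -/(f i) -/(f j) fi fj eqxx lij orbT.
  move=> k; split=> [/memB/st_act0 sk|[->|->]]; last 2 first.
  - exact/memB/st_act0.
  - exact/memB/st_act0.
  exact: stable_le2 rk i j k si sj sk nij.
rewrite B0.
(* In this case S i is met no later than S j. At the crossing of another combination S k its
   submodule S i has pairing at least 0, so S k is not stable. *)
have [ji|ij] := leP (level x (S j)) (level x (S i)).
  rewrite (sorted_eq2 (sortB x) (uniqB x) _ nij) //.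
    by rewrite /before lij andbT orbC eq_sym -le_eqVlt.
  move=> k; split=> [/memB[ak fk]|[->|->]]; last 2 first.
  - exact/memB/st_near.
  - exact/memB/st_near.
  apply: contrapT => /not_orP[ki kj].
  have sk := act_semi x k nx ak fk.
  have [hik [p [q [p0 q0 e]]]] := semistable_pair rk si sj nij lij sk ki kj.
  have sdi := stable_embeds (rootS i) (rootS k) si sk hik.
  have [_ [_ st]] := ak; have := st _ sdi (@S_neq0 i) (fun h => ki (esym (S_injective h))).
  rewrite (pairing_crossing_lt0 _ _ (@S_neq0 i)) ltNge => /negP; apply.
  move/natv_comb: e => e.
  have pp : 0 < p%:R :> R by rewrite ltr0n.
  have qp : 0 < q%:R :> R by rewrite ltr0n.
  rewrite (level_comb x e) ler_pdivrMr ?addr_gt0 ?mulr_gt0 ?S_height // mulrDr.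
  have hi := S_height i; have hj := S_height j.
  have -> : pairing x (S i) = level x (S i) * height (S i).
    by rewrite /level divfK // gt_eqF.
  have -> : pairing x (S j) = level x (S j) * height (S j).
    by rewrite /level divfK // gt_eqF.
  by rewrite mulrCA lerD2l mulrCA ler_pM2r ?mulr_gt0.
(* Now S i has negative pairing at the crossing of every other combination, so all of them are
   stable; they are met from j to i, which is increasing order of a / b. *)
set L := [seq k <- crossings x | _].
have memL k : k \in L <-> exists p q, S k = S i *+ p + S j *+ q.
  split=> [/memB[ak fk]|[p [q e]]].
    have [->|/eqP ki] := eqVneq k i; first by exists 1%N, 0%N; rewrite mulr0n addr0.
    have [->|/eqP kj] := eqVneq k j; first by exists 0%N, 1%N; rewrite mulr0n add0r.
    have [_ [p [q [_ _ e]]]] := semistable_pair rk si sj nij lij (act_semi x k nx ak fk) ki kj.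
    by exists p, q.
  apply/memB.
  have [->|/eqP ki] := eqVneq k i; first exact: st_near.
  have [->|/eqP kj] := eqVneq k j; first exact: st_near.
  have sk := pair_semistable si sj e; have fk := st_f k sk.
  split=> //; apply/(act_stable x k nx fk).
  apply: (pair_stable_near rk si sj nij lij e ki kj) => [d dd||].
  - by rewrite -(cross0 k fk); exact: near_lt0.
  - exact: pairing_crossing_self.
  - apply/(pairing_crossing_lt0 _ _ (@S_neq0 i)).
    have [p0 q0] := pair_comb_pos e ki kj; move/natv_comb: e => e.
    have pp : 0 < p%:R :> R by rewrite ltr0n.
    have qp : 0 < q%:R :> R by rewrite ltr0n.
    rewrite (level_comb x e) ltr_pdivlMr ?addr_gt0 ?mulr_gt0 ?S_height // mulrDr.
    have hi := S_height i; have hj := S_height j.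
    have -> : pairing x (S i) = level x (S i) * height (S i).
      by rewrite /level divfK // gt_eqF.
    have -> : pairing x (S j) = level x (S j) * height (S j).
      by rewrite /level divfK // gt_eqF.
    by rewrite mulrCA ltrD2l mulrCA ltr_pM2l // ltr_pM2r.
have co0 k : exists pq : nat * nat, k \in L -> S k = S i *+ pq.1 + S j *+ pq.2.
  have [/memL[p [q e]]|h] := boolP (k \in L); first by exists (p, q).
  by exists (0%N, 0%N).
have [co hco] := choice co0.
have [hij hji] := pair_rhom si sj nij.
have := @picture_label i j [seq (k, co k) | k <- L].
rewrite -map_comp (eq_map (g := id)) // map_id => <- //.
- split=> //; by move/S_injective.
- exact: pair_rext nij lij.
split.
- move=> k; rewrite -map_comp (eq_map (g := id)) // map_id; exact: memL.
- by move=> _ /mapP[k kL ->] /=; exact: hco.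
rewrite pairwise_map.
have : pairwise (fun k k' => before x k k' && (k != k')) L.
  rewrite pairwise_relI -uniq_pairwise uniqB andbT.
  by rewrite -sorted_pairwise ?sortB //; exact: before_trans.
apply: (@sub_in_pairwise _ (mem L)); last exact/allP.
move=> k k' kL k'L /andP[b /eqP kk'] /=.
apply: (pair_level_lt ij (hco k kL) (hco k' k'L) kk').
by case/orP: b => [/ltW //|/andP[/eqP -> _]].
Qed.

(** * Constancy of the label along segments *)

Lemma small_affine (s : seq (R * R)) : exists2 delta : R, 0 < delta &
  forall t, `|t| < delta -> forall p, p \in s -> 0 < p.1 -> 0 < p.1 + t * p.2.
Proof.
elim: s => [|[a b] s [e e0 ih]]; first by exists 1.
(* The denominator is positive even for b = 0, and this bound on t makes |t b| smaller than a. *)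
pose c := if 0 < a then a / (1 + `|b|) else 1.
have b1 : 0 < 1 + `|b| by rewrite ltr_pwDl.
have c0 : 0 < c by rewrite /c; case: ifP => // a0; rewrite divr_gt0.
exists (Num.min e c) => [|t]; first by rewrite lt_min e0 c0.
rewrite lt_min => /andP[te tc] p; rewrite inE => /orP[/eqP -> /= a0|/ih]; last exact.
move: tc; rewrite /c a0 ltr_pdivlMr // => h.
have : `|t * b| < a.
  apply: le_lt_trans h; rewrite normrM ler_wpM2l //.
  by rewrite lerDr.
by rewrite ltr_norml => /andP[h1 _]; lra.
Qed.

Lemma level_affine (t : R) x y d : level (x + t *: y) d = level x d + t * level y d.
Proof. by rewrite /level pairing_comb mulrDl mulrA. Qed.

Lemma near_line x u : exists2 delta : R, 0 < delta &
  forall t, `|t| < delta -> near x (x + t *: u).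
Proof.
pose D k d := (level x (S k) - level x d, level u (S k) - level u d).
pose s1 := [seq D k d | k <- enum 'I_m, d <- dimvecs].
pose s2 := [seq (level x (S k), level u (S k)) | k <- enum 'I_m].
pose opp (p : R * R) := (- p.1, - p.2).
have [e e0 he] := small_affine ((s1 ++ map opp s1) ++ (s2 ++ map opp s2)).
exists e => // t /he{}he; split=> [k d dd _|k].
  have m1 : D k d \in s1 by apply: allpairs_f => //; rewrite mem_enum.
  rewrite !level_affine; split=> h.
    have := he (D k d); rewrite !mem_cat m1 /= subr_gt0 h => /(_ isT isT); lra.
  have := he (opp (D k d)); rewrite !mem_cat (map_f opp m1) !orbT.
  by move=> /(_ isT) /=; rewrite oppr_gt0 subr_lt0 h => /(_ isT); lra.
have m2 : (level x (S k), level u (S k)) \in s2.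
  by apply: (map_f (fun k => (level x (S k), level u (S k)))); rewrite mem_enum.
rewrite level_affine; split=> h.
  have := he (level x (S k), level u (S k)); rewrite !mem_cat m2 !orbT.
  by move=> /(_ isT h).
have := he (opp (level x (S k), level u (S k))); rewrite !mem_cat (map_f opp m2) !orbT.
by move=> /(_ isT) /=; rewrite oppr_gt0 h => /(_ isT); lra.
Qed.

(** Connectedness of the unit interval, by the supremum of the s such that P is constant on
    [0, s]. *)
Lemma locally_constant_segment (T : Type) (P : R -> T) :
  (forall s, 0 <= s <= 1 -> exists2 delta : R, 0 < delta &
    forall s', 0 <= s' <= 1 -> `|s' - s| < delta -> P s' = P s) ->
  P 0 = P 1.
Proof.
move=> H; pose A := [set s | 0 <= s <= 1 /\ forall r, 0 <= r <= s -> P r = P 0].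
have A0 : A 0.
  by split=> [|r]; [rewrite lexx ler01|rewrite -eq_le => /eqP <-].
have Aub : ubound A 1 by move=> s [/andP[]].
have supA : has_sup A by split; [exists 0|exists 1].
have c0 : 0 <= sup A by apply: sup_upper_bound.
have c1 : sup A <= 1 by apply: ge_sup => //; exists 0.
set c := sup A in c0 c1.
have [e e0 he] := H c (introT andP (conj c0 c1)).
have [s As cs] := sup_adherent e0 supA; rewrite -/c in cs.
have sc : s <= c by apply: sup_upper_bound.
have Ps r : 0 <= r -> r <= s -> P r = P 0.
  by move=> r0 rs; apply: As.2; rewrite r0 rs.
have s0 : 0 <= s by case: As => /andP[].
have Pc : P c = P 0.
  rewrite -(Ps s) //; apply/esym/he; first by rewrite s0 (le_trans sc).
  by rewrite ltr_norml; apply/andP; split; lra.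
have Pr r : 0 <= r -> r <= 1 -> r < c + e -> P r = P 0.
  move=> r0 r1 rc; have [rs|sr] := leP r s; first exact: Ps.
  rewrite -Pc; apply: he; first by rewrite r0.
  by rewrite ltr_norml; apply/andP; split; lra.
have [lt|ge] := ltP c 1; last by apply/esym/Pr => //; lra.
(* b is beyond c but still within e of it, which contradicts the choice of c as a supremum. *)
pose b := Num.min 1 (c + e / 2).
have : A b.
  split=> [|r /andP[r0]].
    by rewrite /b le_min ler01 ge_min lexx /= andbT; lra.
  rewrite /b le_min => /andP[r1 rc]; apply: Pr => //; lra.
move=> /(sup_upper_bound supA); rewrite -/c /b ge_min leNgt lt /=.
by rewrite gerDl leNgt divr_gt0.
Qed.

(** A sign 0 means that the wall misses the region of the earlier signs, which contains the
    compartment; a sign + or - keeps the compartment off the hyperplane. *)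
Lemma compartment_no_wall eps x k : admissible_sign Mod R S eps ->
  compartment Q R S eps x -> ~ semistable x (S k).
Proof.
move=> ae ux /(wall_semistable x (rootS k)) wx.
have rx : region Q S eps k x by move=> i ik; apply: ux.
case e : (eps k).
- by have : (wall Mod (S k) `&` region Q S eps k) x by []; rewrite (ae k).1.
- by have := ux k (ltn_ord k); rewrite e wx.1 ltxx.
- by have := ux k (ltn_ord k); rewrite e wx.1 ltxx.
Qed.

Lemma compartment_segment eps x z (s : R) : 0 <= s <= 1 ->
  compartment Q R S eps x -> compartment Q R S eps z ->
  compartment Q R S eps (x + s *: (z - x)).
Proof.
move=> /andP[s0 s1] ux uz i im; have := ux i im; have := uz i im.
have -> : pairing (x + s *: (z - x)) (S i) =
    (1 - s) * pairing x (S i) + s * pairing z (S i).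
  by rewrite pairing_comb -[z - x]addrC -[- x]scaleN1r addrC pairing_comb; ring.
case: (eps i) => // h1 h2.
- have [->|sn] := eqVneq s 0; first by rewrite subr0 mul1r mul0r addr0.
  apply: ltr_wpDl; first by rewrite mulr_ge0 ?subr_ge0 // ltW.
  by rewrite mulr_gt0 // lt_neqAle eq_sym sn.
- have [->|sn] := eqVneq s 0; first by rewrite subr0 mul1r mul0r addr0.
  have : s * pairing z (S i) < 0 by rewrite pmulr_rlt0 // lt_neqAle eq_sym sn.
  have : (1 - s) * pairing x (S i) <= 0 by rewrite mulr_ge0_le0 ?subr_ge0 // ltW.
  lra.
Qed.

Lemma segment_label eps x z : admissible_sign Mod R S eps ->
  compartment Q R S eps x -> compartment Q R S eps z ->
  (forall s, 0 <= s <= 1 -> good (x + s *: (z - x))) ->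
  label (crossings x) = label (crossings z).
Proof.
move=> ae ux uz gs.
pose P (s : R) := label (crossings (x + s *: (z - x))).
suff : P 0 = P 1 by rewrite /P scale1r scale0r addr0 [x + (z - x)]addrC subrK.
apply: locally_constant_segment => s s01.
have [e e0 he] := near_line (x + s *: (z - x)) (z - x).
exists e => // s' s'01 ss'; apply: crossings_near; first exact: gs.
  have -> : x + s' *: (z - x) = x + s *: (z - x) + (s' - s) *: (z - x).
    by rewrite -addrA -scalerDl [s + _]addrC subrK.
  exact: he.
move=> k _; apply: compartment_no_wall ae _.
exact: compartment_segment.
Qed.

(** * General position *)

Definition line_open (U : set 'rV[R]_n) := forall x u, U x ->
  exists2 delta : R, 0 < delta & forall t, `|t| < delta -> U (x + t *: u).

(** Zero sets are avoided one at a time: the part of U where F a <> 0 is again open along lines, and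
    it is nonempty because a point of the zero set can be moved off it inside U. *)
Lemma avoid_functionals (T : eqType) (s : seq T) (F : T -> 'rV[R]_n -> R) U :
  line_open U -> (exists x, U x) ->
  (forall a t x u, F a (x + t *: u) = F a x + t * F a u) ->
  (forall a, a \in s -> exists u, F a u != 0) ->
  exists x, U x /\ forall a, a \in s -> F a x != 0.
Proof.
move=> + + lF; elim: s U => [|a s ih] U oU [x Ux] nF; first by exists x.
have [||b bs|y [[Uy Fy] h]] := ih (fun x => U x /\ F a x != 0).
- move=> y u [Uy Fy]; have [e e0 he] := oU y u Uy.
  have [f f0 hf] := small_affine [:: (F a y, F a u); (- F a y, - F a u)].
  exists (Num.min e f) => [|t]; first by rewrite lt_min e0 f0.
  rewrite lt_min => /andP[/he Ut /hf h]; split=> //; rewrite lF.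
  move: Fy; rewrite !neq_lt => /orP[Fy|Fy]; apply/orP; [left|right].
    have := h (- F a y, - F a u); rewrite !inE eqxx orbT /= oppr_gt0 Fy => /(_ isT isT); lra.
  by have := h (F a y, F a u); rewrite !inE eqxx /= Fy => /(_ isT isT).
- have [Fx|/negPn/eqP Fx] := boolP (F a x != 0); first by exists x.
  have [|u Fu] := nF a; first exact: mem_head.
  have [e e0 he] := oU x u Ux; exists (x + (e / 2) *: u); split.
    by apply: he; rewrite ger0_norm; lra.
  by rewrite lF Fx add0r mulf_neq0 // gt_eqF //; lra.
- by apply: nF; rewrite inE bs orbT.
exists y; split=> // b; rewrite inE => /orP[/eqP -> //|]; exact: h.
Qed.

Lemma pairing_separates (c : 'I_n -> R) :
  (forall u : 'rV[R]_n, \sum_i u 0 i * c i * (qval Q i)%:R = 0) ->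
  forall i : 'I_n, c i = 0.
Proof.
move=> h i; have := h (delta_mx 0 i); rewrite (bigD1 i) //= big1 ?addr0 => [|j ji].
  rewrite mxE !eqxx mul1r => /eqP; rewrite mulf_eq0 => /orP[/eqP //|].
  by rewrite pnatr_eq0 eqn0Ngt qval_gt0.
by rewrite mxE (negPf ji) andbF !mul0r.
Qed.

Lemma pairing_comb_eq0 d1 d2 d3 (a b c : R) :
  (forall u, a * pairing u d1 + b * pairing u d2 + c * pairing u d3 = 0) ->
  a *: natv d1 + b *: natv d2 + c *: natv d3 = 0.
Proof.
move=> h; pose f (l : 'I_n) := a * (d1 0 l)%:R + b * (d2 0 l)%:R + c * (d3 0 l)%:R.
suff f0 (l : 'I_n) : f l = 0 by apply/rowP => l; rewrite !mxE; exact: f0.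
apply: pairing_separates => u; rewrite /f -[RHS](h u) /Defs.pairing !mulr_sumr -!big_split.
by apply: eq_bigr => i _ /=; ring.
Qed.

(** The determinant of the two level differences at x and at z. It vanishes as soon as some point of
    the line through x and z has equal levels at the three vectors. *)
Definition triple_functional x (t : 'rV[nat]_n * 'rV[nat]_n * 'rV[nat]_n) z : R :=
  (level x t.1.1 - level x t.1.2) * (level z t.1.1 - level z t.2) -
  (level x t.1.1 - level x t.2) * (level z t.1.1 - level z t.1.2).

Definition independent_triples : seq ('rV[nat]_n * 'rV[nat]_n * 'rV[nat]_n) :=
  [seq t <- [seq (t, d) | t <- [seq (d1, d2) | d1 <- dimvecs, d2 <- dimvecs], d <- dimvecs] |
    `[< t.1.1 <> 0 /\ t.1.2 <> 0 /\ t.2 <> 0 /\ ~ dependent3 t.1.1 t.1.2 t.2 >] ].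

Lemma mem_independent_triples d1 d2 d3 : d1 \in dimvecs -> d2 \in dimvecs -> d3 \in dimvecs ->
  d1 <> 0 -> d2 <> 0 -> d3 <> 0 -> ~ dependent3 d1 d2 d3 ->
  (d1, d2, d3) \in independent_triples.
Proof.
move=> h1 h2 h3 n1 n2 n3 nd; rewrite mem_filter; apply/andP; split; first exact/asboolP.
by apply: allpairs_f => //; apply: allpairs_f.
Qed.

Lemma triple_functional_neq0 x t : good x -> t \in independent_triples ->
  exists u, triple_functional x t u != 0.
Proof.
case: t => [[d1 d2] d3] gx; rewrite mem_filter => /andP[/asboolP/= [n1 [n2 [n3 nd]]] ht].
have [h12 h3] : (d1, d2) \in [seq (d1, d2) | d1 <- dimvecs, d2 <- dimvecs] /\ d3 \in dimvecs.
  by move/allpairsP: ht => [[a b] /= [h h' [-> ->]]].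
have [h1 h2] : d1 \in dimvecs /\ d2 \in dimvecs.
  by move/allpairsP: h12 => [[a b] /= [h h' [-> ->]]].
apply: contrapT => no; apply: (nd).
pose A := level x d1 - level x d2; pose B := level x d1 - level x d3.
(* These are the coefficients of the three levels of z in the functional, divided by the heights to
   become coefficients of pairings. *)
exists ((A - B) / height d1), (B / height d2), (- A / height d3); split.
  apply: pairing_comb_eq0 => u.
  have : triple_functional x (d1, d2, d3) u = 0.
    by apply: contrapT => /eqP h; apply: no; exists u.
  rewrite /triple_functional /= -/A -/B => <-; rewrite /level.
  ring.
move=> [_ [b0 a0]].
have hn d : d <> 0 -> (height d)^-1 != 0 by move=> d0; rewrite invr_eq0 gt_eqF ?height_gt0.
have B0 : B = 0.
  by apply/eqP; move/eqP: b0; rewrite mulf_eq0 (negPf (hn _ n2)) orbF.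
have A0 : A = 0.
  by apply/eqP; move/eqP: a0; rewrite mulf_eq0 (negPf (hn _ n3)) orbF oppr_eq0.
by apply: nd; apply: gx => //; apply/eqP; rewrite -subr_eq0; apply/eqP.
Qed.



Lemma triple_functional_affine x t (s : R) y u : triple_functional x t (y + s *: u) =
  triple_functional x t y + s * triple_functional x t u.
Proof. by rewrite /triple_functional !level_affine; ring. Qed.

Lemma level_sub x z d : level (z - x) d = level z d - level x d.
Proof. by rewrite -scaleN1r level_affine mulN1r. Qed.

Lemma good_segment x z : good x ->
  (forall t, t \in independent_triples -> triple_functional x t z != 0) ->
  forall s, good (x + s *: (z - x)).
Proof.
move=> gx nz s d1 d2 d3 h1 h2 h3 n1 n2 n3 e12 e13; apply: contrapT => nd.
have tz := nz _ (mem_independent_triples h1 h2 h3 n1 n2 n3 nd).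
have : triple_functional x (d1, d2, d3) (x + s *: (z - x)) = 0.
  by rewrite /triple_functional /= -e12 -e13 !subrr !mulr0 subrr.
rewrite triple_functional_affine.
have -> : triple_functional x (d1, d2, d3) (z - x) = triple_functional x (d1, d2, d3) z.
  by rewrite /triple_functional /= !level_sub; ring.
have -> : triple_functional x (d1, d2, d3) x = 0 by rewrite /triple_functional mulrC subrr.
rewrite add0r => /eqP; rewrite mulf_eq0 (negPf tz) orbF => /eqP s0.
by apply/nd/gx => //; move: e12 e13; rewrite s0 scale0r addr0.
Qed.

(** The segment from x to x' may contain bad points; z only has to avoid the finitely many
    functionals attached to x and to x'. *)
Lemma good_bridge x x' U : good x -> good x' -> line_open U -> (exists z, U z) ->
  exists z, [/\ U z, forall s, good (x + s *: (z - x)) & forall s, good (x' + s *: (z - x'))].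
Proof.
move=> gx gx' oU exU.
pose F (a : bool * ('rV[nat]_n * 'rV[nat]_n * 'rV[nat]_n)) :=
  triple_functional (if a.1 then x else x') a.2.
have [|a aI|z [Uz nz]] := @avoid_functionals _
    [seq (b, t) | b <- [:: true; false], t <- independent_triples] F U oU exU.
- by move=> a t y u; exact: triple_functional_affine.
- have [[b t] /= [_ tI ->]] := allpairsP aI.
  by rewrite /F /=; case: b => /=; exact: triple_functional_neq0.
exists z; split=> //; apply: good_segment => // t tI.
  by apply: (nz (true, t)); apply: allpairs_f.
by apply: (nz (false, t)); apply: allpairs_f.
Qed.

Lemma compartment_line_open eps : line_open (compartment Q R S eps).
Proof.
move=> x u ux; pose D i := (pairing x (S i), pairing u (S i)).
pose opp (p : R * R) := (- p.1, - p.2).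
have [e e0 he] := small_affine ([seq D i | i <- enum 'I_m] ++ map opp [seq D i | i <- enum 'I_m]).
exists e => // t /he{}he i im; have := ux i im.
have Di : D i \in [seq D i | i <- enum 'I_m] by rewrite map_f ?mem_enum.
rewrite pairing_comb; case: (eps i) => // h.
  by have := he (D i); rewrite mem_cat Di => /(_ isT h).
have := he (opp (D i)); rewrite mem_cat (map_f opp Di) orbT => /(_ isT) /=.
by rewrite oppr_gt0 h => /(_ isT); lra.
Qed.

Lemma compartment_label eps x x' : admissible_sign Mod R S eps ->
  good x -> good x' -> compartment Q R S eps x -> compartment Q R S eps x' ->
  label (crossings x) = label (crossings x').
Proof.
move=> ae gx gx' ux ux'.
have [|z [uz h h']] := good_bridge gx gx' (@compartment_line_open eps); first by exists x.
by rewrite (segment_label ae ux uz) // (segment_label ae ux' uz).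
Qed.

(** The line through x meets distinct hyperplanes at distinct points, hence only strata of
    codimension 1. *)
Definition generic x := forall d d', d \in dimvecs -> d' \in dimvecs -> d <> 0 -> d' <> 0 ->
  level x d = level x d' -> exists c : R, natv d = c *: natv d'.

Lemma generic_good x : generic x -> good x.
Proof.
move=> gx d1 d2 d3 h1 h2 h3 n1 n2 n3 e _; have [c h] := gx d1 d2 h1 h2 n1 n2 e.
exists 1, (- c), 0; split; last by move=> [/eqP]; rewrite oner_eq0.
by rewrite h scale1r scale0r addr0 scaleNr subrr.
Qed.

Lemma generic_point U : line_open U -> (exists x, U x) -> exists x, U x /\ generic x.
Proof.
move=> oU exU.
pose prop (p : 'rV[nat]_n * 'rV[nat]_n) := p.1 <> 0 /\ p.2 <> 0 /\
  ~ (exists c : R, natv p.1 = c *: natv p.2).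
pose F (p : 'rV[nat]_n * 'rV[nat]_n) z := level z p.1 - level z p.2.
have [|p|x [Ux nx]] := @avoid_functionals _
    [seq p <- [seq (d, d') | d <- dimvecs, d' <- dimvecs] | `[< prop p >] ] F U oU exU.
- by move=> p t y u; rewrite /F !level_affine; ring.
- rewrite mem_filter => /andP[/asboolP[n1 [n2 np]] _]; apply: contrapT => no; apply: np.
  have h1 := height_gt0 n1; have h2 := height_gt0 n2.
  exists (height p.1 / height p.2).
  have /eqP : (height p.1)^-1 *: natv p.1 + (- (height p.2)^-1) *: natv p.2 + 0 *: natv p.1 = 0.
    apply: pairing_comb_eq0 => u; rewrite mul0r addr0.
    have : F p u = 0 by apply: contrapT => /eqP h; apply: no; exists u.
    by rewrite /F /level => <-; ring.
  rewrite scale0r addr0 scaleNr subr_eq0 => /eqP e.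
  by rewrite -scalerA -e scalerA divff ?scale1r // gt_eqF.
exists x; split=> // d d' hd hd' n1 n2 e; apply: contrapT => np.
have := nx (d, d'); rewrite mem_filter /F e subrr eqxx => /(_ _)/negP; apply=> //.
by apply/andP; split; [exact/asboolP|exact: allpairs_f].
Qed.

(** * Crossing a wall *)

Lemma nbhs_entrywise x (B : set 'rV[R]_n) : nbhs x B <->
  exists2 e : R, 0 < e & forall y, (forall i : 'I_n, `|x 0 i - y 0 i| < e) -> B y.
Proof.
split=> [/nbhs_ballP[e /= e0 h]|[e e0 h]].
  exists e => // y hy; apply: h; split=> // i j; rewrite (ord1 i); exact: hy.
apply/nbhs_ballP; exists e => //= y [_ hy]; apply: h => i; exact: (hy 0 i).
Qed.

Lemma pairing_small x y d (e : R) : 0 <= e -> (forall i : 'I_n, `|x 0 i - y 0 i| < e) ->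
  `|pairing x d - pairing y d| <= e * height d.
Proof.
move=> e0 h; rewrite /height /Defs.pairing mulr_sumr -sumrB.
apply: le_trans (ler_norm_sum _ _ _) _; apply: ler_sum => i _.
rewrite !mxE mul1r -!mulrBl !normrM !normr_nat mulrA.
by rewrite ler_wpM2r // ler_wpM2r // ltW.
Qed.

Lemma closure_pairing U z d : closure U z -> pairing z d != 0 -> d <> 0 ->
  exists x, U x /\ 0 < pairing z d * pairing x d.
Proof.
move=> cU zd d0; have hd := height_gt0 d0.
have nz : 0 < `|pairing z d| by rewrite normr_gt0.
(* Within e the pairing with d changes by at most half its absolute value, so its sign is kept. *)
pose e := `|pairing z d| / 2 / height d.
have e0 : 0 < e by rewrite /e !divr_gt0.
have [|x [Ux /= hx]] := cU (fun y => forall i : 'I_n, `|z 0 i - y 0 i| < e).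
  by apply/nbhs_entrywise; exists e.
exists x; split=> //; have := pairing_small d (ltW e0) hx.
rewrite /e divfK ?gt_eqF //; move: zd.
rewrite neq_lt => /orP[zd|zd].
  rewrite [`|pairing z d|]ltr0_norm // ler_norml => /andP[h1 h2].
  by rewrite nmulr_rgt0 //; lra.
rewrite [`|pairing z d|]gtr0_norm // ler_norml => /andP[h1 h2].
by rewrite pmulr_rgt0 //; lra.
Qed.

(** This allows a generic x to be chosen such that its crossing point, rather than x itself, lies in
    a given piece of the wall. *)
Lemma open_crossing_line_open (O : set 'rV[R]_n) d : open O ->
  line_open (fun x => O (crossing x d)).
Proof.
move=> oO x u Ox.
have /nbhs_entrywise[e e0 he] : nbhs (crossing x d) O by exact: open_nbhs_nbhs.
pose w := crossing u d; pose C := 1 + \sum_i `|w 0 i|.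
have C0 : 0 < C by rewrite ltr_pwDl // sumr_ge0.
exists (e / C) => [|t]; first by rewrite divr_gt0.
rewrite ltr_pdivlMr // => ht; apply: he => i.
have -> : crossing x d 0 i - crossing (x + t *: u) d 0 i = - (t * w 0 i).
  by rewrite /w /crossing level_affine !mxE; ring.
rewrite normrN normrM; apply: le_lt_trans ht; rewrite ler_wpM2l //.
rewrite /C (bigD1 i) //= addrCA lerDl addr_ge0 // sumr_ge0 //.
Qed.

Lemma level_shift x (t : R) d : d <> 0 -> level (x + t *: ones) d = level x d + t.
Proof.
move=> d0; rewrite level_affine (_ : level ones d = 1) ?mulr1 //.
by rewrite /level -/(height d) divff // gt_eqF ?height_gt0.
Qed.

Lemma crossing_shift x (t : R) d : d <> 0 -> crossing (x + t *: ones) d = crossing x d.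
Proof.
by move=> d0; rewrite /crossing level_shift // scalerDl opprD addrACA subrr addr0.
Qed.

Lemma good_shift x (t : R) : good x -> good (x + t *: ones).
Proof.
move=> gx d1 d2 d3 h1 h2 h3 n1 n2 n3; rewrite !level_shift // => /addIr e12 /addIr e13.
exact: gx.
Qed.

Lemma before_shift x (t : R) : before (x + t *: ones) =2 before x.
Proof.
move=> j k; rewrite /before !level_shift ?ltrD2r; [|exact: S_neq0..].
by rewrite (inj_eq (@addIr _ t)).
Qed.

(** Points of one line in the direction [ones] share their crossing points and the order of these.
    Moving past z appends only k, whose level at z is 0 while the roots crossed before have positive
    level. *)
Lemma crossings_cross z k (t : R) : 0 < t -> level z (S k) = 0 -> stable z (S k) ->
  (forall j, level z (S j) = 0 -> j = k) ->
  near z (z + t *: ones) -> near z (z - t *: ones) ->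
  crossings (z + t *: ones) = crossings (z - t *: ones) ++ [:: k].
Proof.
move=> t0 zk sk only [_ np] [_ nm].
have crossz : crossing z (S k) = z by rewrite /crossing zk scale0r subr0.
have shiftm j : level (z - t *: ones) (S j) = level z (S j) - t.
  by rewrite -scaleNr level_shift //; exact: S_neq0.
have shiftp j : level (z + t *: ones) (S j) = level z (S j) + t.
  by rewrite level_shift //; exact: S_neq0.
have cp j : crossing (z + t *: ones) (S j) = crossing z (S j).
  by apply: crossing_shift; exact: S_neq0.
have cm j : crossing (z - t *: ones) (S j) = crossing z (S j).
  by rewrite -scaleNr; apply: crossing_shift; exact: S_neq0.
have am j : active (z - t *: ones) j -> 0 < level z (S j).
  by move=> [h _]; apply: lt_trans t0 _; move: h; rewrite shiftm subr_gt0.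
have actE j : active (z + t *: ones) j <-> active (z - t *: ones) j \/ j = k.
  rewrite /active cp cm; split=> [[lj sj]|[[lj sj]|->]].
  - have [e|ne] := eqVneq (level z (S j)) 0; first by right; exact: only.
    left; split=> //; apply: (nm j).1; move: ne; rewrite neq_lt => /orP[/(np j).2 h|//].
    by have := lt_trans lj h; rewrite ltxx.
  - split=> //; apply: (np j).1; apply: lt_trans t0 _.
    by move: lj; rewrite shiftm subr_gt0.
  - by rewrite crossz; split=> //; rewrite shiftp zk add0r.
have srt y : before y =2 before z -> sorted (before z) (crossings y).
  by move=> e; rewrite -(eq_sorted e); exact: crossings_sorted.
apply: (sorted_eq (@before_trans z) (@before_anti z)).
- by apply: srt; exact: before_shift.
- rewrite sorted_pairwise; last exact: before_trans.
  rewrite pairwise_cat /= andbT -sorted_pairwise; last exact: before_trans.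
  rewrite srt ?andbT; last by rewrite -scaleNr; exact: before_shift.
  rewrite allrel1r; apply/allP => j /mem_crossings /am lj.
  by rewrite /before zk lj.
apply: uniq_perm; first exact: crossings_uniq.
  rewrite cat_uniq crossings_uniq /= orbF andbT; apply/negP => /mem_crossings /am.
  by rewrite zk ltxx.
move=> j; rewrite mem_cat inE; apply/idP/orP => [/mem_crossings/actE[/mem_crossings|/eqP]|h].
- by left.
- by right.
- by apply/mem_crossings/actE; case: h => [/mem_crossings|/eqP]; [left|right].
Qed.

Lemma wall_crossing eps eps' k :
  wall_separated Mod (S k) (compartment Q R S eps) (compartment Q R S eps') ->
  compartment Q R S eps' `<=` positive_side Q R (S k) ->
  exists x x', [/\ good x, compartment Q R S eps x, good x', compartment Q R S eps' x' &
    label (crossings x') = (label (crossings x) * picture_gen Mod S k)%g].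
Proof.
move=> [sides [B [oB [z0 [Bz0 Hz0]] Bcl Bwall]]] pos.
have [|x [Bx gx]] := generic_point (@open_crossing_line_open B (S k) oB).
  by exists z0; rewrite /crossing /level Hz0 mul0r scale0r subr0.
pose z := crossing x (S k).
have z_lev d : d <> 0 -> level z d = level x d - level x (S k).
  by move=> d0; rewrite /z /crossing -scaleNr level_shift.
have Hz : hyperplane Q (S k) z.
  by apply: pairing_crossing_self.
have zk : level z (S k) = 0 by rewrite z_lev ?subrr //; exact: S_neq0.
have only j : level z (S j) = 0 -> j = k.
  rewrite z_lev; last exact: S_neq0.
  move=> /eqP; rewrite subr_eq0 => /eqP e.
  have [c h] := gx _ _ (S_dimvecs j) (S_dimvecs k) (@S_neq0 j) (@S_neq0 k) e.
  exact: proportional_roots h.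
have [cU cU'] := Bcl z (conj Bx Hz).
have semz : semistable z (S k) by apply/(wall_semistable z (rootS k)); exact: Bwall.
(* A stable subroot at z has level 0 there, and [only] identifies it with S k. *)
have stz : stable z (S k).
  have [i [si _ _]] := semistable_stable_sub semz.
  by have <- : i = k by apply: only; rewrite /level si.1 mul0r.
have neU A : closure A z -> exists y, A y.
  by move=> /(_ setT filterT)[y [Ay _]]; exists y.
have [y' uy'] := neU _ cU'; have [y uy] := neU _ cU.
have neg : compartment Q R S eps `<=` negative_side Q (S k).
  case: sides => [[]//|[_ h]]; have := pos _ uy'; have := h _ uy'.
  by rewrite /negative_side /positive_side /= => h1 h2; have := lt_trans h1 h2; rewrite ltxx.
have [e1 e10 h1] := near_line z ones.
pose t := e1 / 2.
have t0 : 0 < t by rewrite divr_gt0.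
have np : near z (z + t *: ones) by apply: h1; rewrite gtr0_norm // /t; lra.
have nm : near z (z - t *: ones).
  by rewrite -scaleNr; apply: h1; rewrite normrN gtr0_norm // /t; lra.
have lev_sign a j : (0 < level a (S j) <-> 0 < pairing a (S j)) /\
    (level a (S j) < 0 <-> pairing a (S j) < 0).
  have hj := S_height j; rewrite /level; split.
    by rewrite pmulr_lgt0 ?invr_gt0.
  by rewrite pmulr_llt0 ?invr_gt0.
(* For i <> k the point z is off H(S i), so it has the sign that e prescribes, and w inherits it;
   the sign at k alone depends on the side. *)
have sign_in e w : closure (compartment Q R S e) z -> near z w ->
    match e k with
    | Zero => True
    | Plus => 0 < pairing w (S k)
    | Minus => pairing w (S k) < 0
    end ->
    compartment Q R S e w.
  move=> ce nw hk i _; have [-> //|ik] := eqVneq i k.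
  have zi : pairing z (S i) != 0.
    apply/eqP => h; move/eqP: ik; apply; apply: only.
    by rewrite /level h mul0r.
  have [a [ua ha]] := closure_pairing ce zi (@S_neq0 i).
  have := ua i (ltn_ord i); case: (e i) => // hai.
    apply/(lev_sign w i).1/(nw.2 i).1/(lev_sign z i).1.
    by move: ha; rewrite pmulr_lgt0.
  apply/(lev_sign w i).2/(nw.2 i).2/(lev_sign z i).2.
  by move: ha; rewrite nmulr_lgt0.
have gz : good z.
  by rewrite /z /crossing -scaleNr; apply: good_shift; exact: generic_good.
have pp : 0 < pairing (z + t *: ones) (S k).
  by rewrite pairing_comb Hz add0r mulr_gt0 // S_height.
have pm : pairing (z - t *: ones) (S k) < 0.
  by rewrite -scaleNr pairing_comb Hz add0r mulNr oppr_lt0 mulr_gt0 // S_height.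
exists (z - t *: ones), (z + t *: ones); split.
- by rewrite -scaleNr; exact: good_shift.
- apply: sign_in => //; have := uy k (ltn_ord k); have := neg _ uy.
  rewrite /negative_side /=; case: (eps k) => // h h'.
  by have := lt_trans h h'; rewrite ltxx.
- exact: good_shift.
- apply: sign_in => //; have := uy' k (ltn_ord k); have := pos _ uy'.
  rewrite /positive_side /=; case: (eps' k) => // h h'.
  by have := lt_trans h h'; rewrite ltxx.
by rewrite (crossings_cross t0 zk stz only np nm) label_cat.
Qed.

Lemma labelling : exists g : ('I_m -> sign) -> G,
  forall (eps eps' : 'I_m -> sign) (k : 'I_m),
    admissible_sign Mod R S eps -> admissible_sign Mod R S eps' ->
    wall_separated Mod (S k) (compartment Q R S eps) (compartment Q R S eps') ->
    compartment Q R S eps' `<=` positive_side Q R (S k) ->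
    (g eps * picture_gen Mod S k = g eps')%g.
Proof.
have gE eps : exists a : G, forall x, admissible_sign Mod R S eps -> good x ->
    compartment Q R S eps x -> a = label (crossings x).
  have [[x [gx ux]]|no] := pselect (exists x, good x /\ compartment Q R S eps x).
    by exists (label (crossings x)) => y ae gy uy; exact: compartment_label ae gx gy ux uy.
  (* This default concerns empty compartments: any other contains a good point by [generic_point]
     and [generic_good]. *)
  by exists 1%g => x _ gx ux; exfalso; apply: no; exists x.
have [g hg] := choice gE.
exists g => eps eps' k ae ae' sep pos.
have [x [x' [gx ux gx' ux' e]]] := wall_crossing sep pos.
by rewrite (hg eps x) // (hg eps' x').
Qed.

End Words.

Theorem theorem1p2p1 (K : fieldType) (n : nat) (Q : valued_quiver n)
    (Mod : modulation K Q) (R : realType) (m : nat) (S : 'I_m -> 'rV[nat]_n) :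
  admissible_set Mod S ->
  exists g : ('I_m -> sign) -> picture_group Mod S,
    forall (eps eps' : 'I_m -> sign) (k : 'I_m),
      admissible_sign Mod R S eps ->
      admissible_sign Mod R S eps' ->
      wall_separated Mod (S k) (compartment Q R S eps) (compartment Q R S eps') ->
      (compartment Q R S eps' `<=` positive_side Q R (S k))%classic ->
      (g eps * picture_gen Mod S k = g eps')%g.
Proof.
move=> adm; have [le lat] := adm_lateral adm.
exact: labelling adm lat.
Qed.
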